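(* Consider the first order system for real-valued functions $(u,v,a,b)$ of $t\in\mathbb{R}$ $$u'=v,\qquad v'=-\left(a^{2}+b^{2}-\tfrac14\right)u,\qquad a'=-a+u^{2}b,\qquad b'=b-u^{2}a. \qquad (\mathrm{S})$$ Let $T_0=2^{\frac34}\pi$. Then there exist $T_0<T_1\le T_2$ such that for $T\in(T_0,T_1)\cup(T_2,+\infty)$ there exists a family $(u_T,v_T,a_T,b_T)$ of non-constant $2T$-periodic solutions to $(\mathrm{S})$. Moreover: (i) when $T\to T_0$, $$(u_T,v_T,a_T,b_T)\to\left(1,0,\tfrac{1}{2\sqrt2},\tfrac{1}{2\sqrt2}\right)$$ in $C^{2,\alpha}_{loc}(\mathbb{R})\times C^{2,\alpha}_{loc}(\mathbb{R})\times C^{1,\beta}_{loc}(\mathbb{R})\times C^{1,\beta}_{loc}(\mathbb{R})$, $0<\alpha,\beta<1$; (ii) when $T\to\infty$, there exists $t_0\in\mathbb{R}$ such that $$(u_T,v_T,a_T,b_T)\to\big(u_0(\cdot-t_0),u_0'(\cdot-t_0),a_0(\cdot-t_0),b_0(\cdot-t_0)\big)$$ in $C^{2,\alpha}_{loc}(\mathbb{R})\times C^{2,\alpha}_{loc}(\mathbb{R})\times C^{1,\beta}_{loc}(\mathbb{R})\times C^{1,\beta}_{loc}(\mathbb{R})$, $0<\alpha,\beta<1$, where $$(u_0(t),a_0(t),b_0(t)):=\left(2^{-\frac14}\cosh^{-\frac12}(t),\ \tfrac{3}{2\sqrt2}\,e^{-\frac t2}\cosh^{-\frac32}(t),\ \tfrac{3}{2\sqrt2}\,e^{\frac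 t2}\cosh^{-\frac32}(t)\right)$$ is the solution of $(\mathrm{S})$ given by the nontrivial homoclinic orbit.
   Context: The system $(\mathrm{S})$ is Hamiltonian with Hamiltonian function $H(u,v,a,b)=\frac{v^2}{2}+\frac{u^2}{2}\left(a^2+b^2-\frac14\right)-ab$. Its equilibrium points with $u\ge 0$ are $(0,0,0,0)$ and $\left(1,0,\pm\frac{1}{2\sqrt2},\pm\frac{1}{2\sqrt2}\right)$ (same sign in the last two components). A homoclinic orbit here is a nontrivial solution tending to $(0,0,0,0)$ as $t\to\pm\infty$. $C^{k,\alpha}_{loc}(\mathbb{R})$ denotes the local Hölder spaces.
   Formalization: The printed triple (u_0,a_0,b_0) does not solve (S); it is replaced by u_0=√(3/2) cosh^{-1/2}(t), a_0=(√3/(2√2)) e^{t/2} cosh^{-3/2}(t), b_0=(√3/(2√2)) e^{-t/2} cosh^{-3/2}(t), which does. *)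

(* Defs.v *)
From Stdlib Require Import Reals.
From Coquelicot Require Import Coquelicot.
Open Scope R_scope.

Definition solution (u v a b : R -> R) : Prop :=
  forall t : R,
    is_derive u t (v t) /\
    is_derive v t (- (a t ^ 2 + b t ^ 2 - 1 / 4) * u t) /\
    is_derive a t (- a t + u t ^ 2 * b t) /\
    is_derive b t (b t - u t ^ 2 * a t).

Definition constant_orbit (u v a b : R -> R) : Prop :=
  forall s t : R, u s = u t /\ v s = v t /\ a s = a t /\ b s = b t.

Definition periodic (P : R) (u v a b : R -> R) : Prop :=
  forall t : R,
    u (t + P) = u t /\ v (t + P) = v t /\ a (t + P) = a t /\ b (t + P) = b t.

Definition tends_to_origin (u v a b : R -> R) (e : Rbar) : Prop :=
  is_lim u e 0 /\ is_lim v e 0 /\ is_lim a e 0 /\ is_lim b e 0.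

Definition homoclinic (u v a b : R -> R) : Prop :=
  solution u v a b /\
  ~ (forall t : R, u t = 0 /\ v t = 0 /\ a t = 0 /\ b t = 0) /\
  tends_to_origin u v a b m_infty /\
  tends_to_origin u v a b p_infty.

(* Norms on the compact intervals [-r, r].  They take values in Rbar, so that an
   unbounded function has norm p_infty and never a junk real value. *)

Definition sup_norm (r : R) (f : R -> R) : Rbar :=
  Lub_Rbar (fun y => exists t : R, Rabs t <= r /\ y = Rabs (f t)).

Definition holder_seminorm (alpha r : R) (f : R -> R) : Rbar :=
  Lub_Rbar (fun y => exists s t : R,
    Rabs s <= r /\ Rabs t <= r /\ s <> t /\
    y = Rabs (f s - f t) / Rpower (Rabs (s - t)) alpha).

Fixpoint Ck_norm (k : nat) (r : R) (f : R -> R) : Rbar :=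
  match k with
  | O => sup_norm r f
  | S j => Rbar_plus (Ck_norm j r f) (sup_norm r (Derive_n f (S j)))
  end.

Definition holder_norm (k : nat) (alpha r : R) (f : R -> R) : Rbar :=
  Rbar_plus (Ck_norm k r f) (holder_seminorm alpha r (Derive_n f k)).

(* Derivatives of every order j <= k are required explicitly: Derive is total,
   so ex_derive_n f k alone does not imply that the lower ones exist. *)
Definition C_loc (k : nat) (alpha : R) (f : R -> R) : Prop :=
  (forall (j : nat) (t : R), (j <= k)%nat -> ex_derive_n f j t) /\
  (forall r : R, 0 < r -> is_finite (holder_norm k alpha r f)).

(* f T converges to g in C^{k,alpha}_loc(R) as T runs along the filter F. *)
Definition C_loc_lim (F : (R -> Prop) -> Prop) (k : nat) (alpha : R)
    (f : R -> R -> R) (g : R -> R) : Prop :=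
  F (fun T => C_loc k alpha (f T)) /\
  C_loc k alpha g /\
  (forall r eps : R, 0 < r -> 0 < eps ->
     F (fun T => Rbar_lt (holder_norm k alpha r (fun t => f T t - g t)) eps)).

Definition family_lim (F : (R -> Prop) -> Prop) (alpha beta : R)
    (u v a b : R -> R -> R) (u' v' a' b' : R -> R) : Prop :=
  C_loc_lim F 2 alpha u u' /\ C_loc_lim F 2 alpha v v' /\
  C_loc_lim F 1 beta a a' /\ C_loc_lim F 1 beta b b'.

Definition T0 : R := Rpower 2 (3 / 4) * PI.

(* Explicit homoclinic profile.  The source prints the amplitudes 2^(-1/4) for
   u0 and 3 / (2 sqrt 2) for a0, b0, and the factors exp (-t/2) in a0 and
   exp (t/2) in b0; that triple does not solve the system.  Substituting
     u0 = A cosh^(-1/2), a0 = B exp (t/2) cosh^(-3/2),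
     b0 = B exp (-t/2) cosh^(-3/2)
   the equations for a and b say A^2 = 3/2, and u'' = - (a^2 + b^2 - 1/4) u says
   2 B^2 = 3/4, while the opposite choice of exponentials admits no A at all. *)

Definition u0 (t : R) : R := sqrt (3 / 2) * Rpower (cosh t) (- (1 / 2)).

Definition a0 (t : R) : R :=
  sqrt 3 / (2 * sqrt 2) * exp (t / 2) * Rpower (cosh t) (- (3 / 2)).

Definition b0 (t : R) : R :=
  sqrt 3 / (2 * sqrt 2) * exp (- (t / 2)) * Rpower (cosh t) (- (3 / 2)).

(* Main.v *)
Require Import Defs.
From Stdlib Require Import Reals ZArith Lra Lia Psatz IndefiniteDescription.
From Coquelicot Require Import Coquelicot.
Open Scope R_scope.

(** Why the theorem holds.

The system is reversible: if (u, v, a, b) is a solution, so is (u, -v, b, a) run backwards in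
time.  An orbit that meets the fixed plane v = 0, a = b of this reversor at two times t1 < t2
can be reflected at both, and closes up to a periodic orbit of period 2 (t2 - t1)
([periodic_extension]).  A symmetric periodic orbit is therefore a root of two equations in two
unknowns: the initial point is chosen in the fixed plane, and the end point must lie in it.
Both families come from such planar problems close to an explicit orbit.  In both, the
non-degeneracy of the problem is read off by pairing the difference of two trajectories with
explicit solutions of the adjoint linearized equation: the derivative of such a pairing is
quadratically small, so that the pairing transports information from one end of the time
interval to the other.

Long periods.  On t <= 0, growing and decaying components are rescaled by powers of
e = exp (t/4), chosen so that the system becomes y' = - Lambda y + e P(y, e) with Lambda >= 0
diagonal and P polynomial.  As e is integrable on (-oo, 0], the distance between two
trajectories started at time -T grows at most by a factor that does not depend on T.  The
initial points are the points of the fixed plane near the origin, given by the amplitudes mu, nu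
of the two growing modes.  The linearization along the homoclinic orbit is solvable: in the
angle psi = 2 atan (exp t) it splits into F'' = - 4 F and F'' = 2 F.  The solutions that are even
about psi = pi/2, the cosine of 2 psi and a hyperbolic cosine, give two pairings whose values at
time 0 are multiples of v - (a - b) and v + (a - b), and whose values at time -T are, up to
O(exp (-T/4)), multiples of mu + nu/2 and mu - nu/2.  The planar problem is thus a small
perturbation of the identity, and has a root at distance O(exp (-T/4)) from the homoclinic
orbit ([shooting], [periodic_near_homoclinic]).

Periods near T0.  At the equilibrium the linear part splits into an oscillator of frequency lam
and a saddle of rates +lam and -lam, where lam ^ 4 = 2; so T0 = 2 pi / lam is its full period, and
the orbits found here have period T, half of the 2T of the theorem.  An approximate
solution of amplitude e and frequency lam (1 - k e^2), correct to second order, leaves a residual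
of size e^3.  Pairing with the saddle modes, the end condition in the saddle plane determines a
correction y = O(e^3) of the initial point.  Pairing with the oscillator, the remaining end
condition reads e^3 tau lam^2 (k - cstar) + O(e^4) = 0, with tau the half period and
cstar = 9/20 + 19 lam^2 / 80.  For a prescribed small value of kappa = k e^2 its sign
changes as e crosses sqrt (kappa / cstar), whence a root ([periodic_near_equilibrium]).  The
positivity of cstar is the reason why the periods lie above T0.

Convergence.  The field is polynomial, so every derivative of a component is a polynomial in
the state.  All solutions in play are bounded, hence convergence of the initial points implies
convergence of all derivatives, uniformly on compact intervals
([family_lim_of_initial_data]). *)

(** * Real analysis preliminaries *)

Lemma Rabs_mult_le (a b A B : R) : Rabs a <= A -> Rabs b <= B -> Rabs (a * b) <= A * B.
Proof.
  intros Ha Hb. rewrite Rabs_mult.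
  apply Rmult_le_compat; auto using Rabs_pos.
Qed.

Lemma Rabs_plus_le (a b A B : R) : Rabs a <= A -> Rabs b <= B -> Rabs (a + b) <= A + B.
Proof. intros; eapply Rle_trans; [apply Rabs_triang | lra]. Qed.

Lemma Rabs_le0 (x : R) : Rabs x <= 0 -> x = 0.
Proof.
  intros H. destruct (Req_dec x 0) as [|Hn]; auto. apply Rabs_pos_lt in Hn; lra.
Qed.

Lemma exp_mono (x y : R) : x <= y -> exp x <= exp y.
Proof. intros [H| ->]; [apply Rlt_le, exp_increasing, H | lra]. Qed.

Lemma pow_unit (x : R) (n : nat) : 0 <= x <= 1 -> 0 <= x ^ n <= 1.
Proof.
  intros H. split; [apply pow_le; lra|]. rewrite <- (pow1 n). apply pow_incr; lra.
Qed.

Lemma cosh_ge1 (x : R) : 1 <= cosh x.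
Proof.
  unfold cosh. assert (H := exp_pos x). assert (H' := exp_pos (- x)).
  assert (E : exp x * exp (- x) = 1) by (rewrite <- exp_plus, Rplus_opp_r; apply exp_0).
  assert (Hs := Rle_0_sqr (exp x - exp (- x))). unfold Rsqr in Hs.
  apply Rnot_lt_le; intros Hlt. nra.
Qed.

Lemma Rabs_sinh_le (x : R) : Rabs (sinh x) <= cosh x.
Proof.
  unfold sinh, cosh. assert (H := exp_pos x). assert (H' := exp_pos (- x)).
  apply Rabs_le; lra.
Qed.

Lemma sinh_half_le (x : R) : 0 <= x -> x / 2 <= sinh x.
Proof.
  intros Hx. unfold sinh. assert (h := exp_ineq1_le x).
  assert (h' : exp (- x) <= exp 0) by (apply exp_mono; lra). rewrite exp_0 in h'. lra.
Qed.

Lemma is_derive_R (f : R -> R) (t d d' : R) : is_derive f t d -> d = d' -> is_derive f t d'.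
Proof. intros H <-; exact H. Qed.

Lemma is_derive_sub (f g : R -> R) (t d d' : R) :
  is_derive f t d -> is_derive g t d' -> is_derive (fun t => f t - g t) t (d - d').
Proof. apply (@is_derive_minus R_AbsRing R_NormedModule). Qed.

Lemma is_derive_neg (f : R -> R) (t d : R) : is_derive f t d -> is_derive (fun t => - f t) t (- d).
Proof. apply (@is_derive_opp R_AbsRing R_NormedModule). Qed.

Lemma is_derive_mul (f g : R -> R) (t d d' : R) :
  is_derive f t d -> is_derive g t d' -> is_derive (fun t => f t * g t) t (d * g t + f t * d').
Proof.
  intros Hf Hg. apply (is_derive_mult f g); auto. intros; apply Rmult_comm.
Qed.

Lemma is_derive_linear (c t : R) : is_derive (fun t => c * t) t c.
Proof. auto_derive; [trivial | ring]. Qed.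

Lemma derivable_continuous (f : R -> R) (t d : R) : is_derive f t d -> continuous f t.
Proof.
  intros H. apply (@ex_derive_continuous R_AbsRing R_NormedModule). exists d; exact H.
Qed.

Lemma derive_le_decreasing (f df : R -> R) (a b : R) : a <= b ->
  (forall t, a <= t <= b -> is_derive f t (df t)) ->
  (forall t, a <= t <= b -> df t <= 0) -> f b <= f a.
Proof.
  intros Hab Hd Hn.
  destruct (MVT_gen f a b df) as [c [Hc E]].
  - rewrite Rmin_left, Rmax_right by lra. intros t Ht; apply Hd; lra.
  - rewrite Rmin_left, Rmax_right by lra. intros t Ht.
    apply derivable_continuous_pt. exists (df t). apply is_derive_Reals, Hd; lra.
  - rewrite Rmin_left, Rmax_right in Hc by lra. assert (h := Hn c Hc). nra.
Qed.

(** Only the existence of a bounded derivative at each point is asked for, so that the derivative may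
come with data (a remainder, say) that depend on the point. *)
Lemma derive_bound (f K k : R -> R) (a b : R) : a <= b ->
  (forall t, a <= t <= b -> exists v, is_derive f t v /\ Rabs v <= k t) ->
  (forall t, a <= t <= b -> is_derive K t (k t)) -> Rabs (f b - f a) <= K b - K a.
Proof.
  intros Hab Hf HK.
  assert (Hd : forall t, a <= t <= b -> is_derive f t (Derive f t) /\ Rabs (Derive f t) <= k t).
  { intros t Ht. destruct (Hf t Ht) as [v [Hv Hb]].
    replace (Derive f t) with v by (symmetry; apply is_derive_unique, Hv). auto. }
  assert (H1 : f b - K b <= f a - K a).
  { apply (derive_le_decreasing (fun t => f t - K t) (fun t => Derive f t - k t)); auto.
    - intros t Ht; apply is_derive_sub; [apply Hd | apply HK]; exact Ht.
    - intros t Ht. destruct (Hd t Ht) as [_ Hb]. apply Rabs_le_between in Hb. lra. }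
  assert (H2 : - f b - K b <= - f a - K a).
  { apply (derive_le_decreasing (fun t => - f t - K t) (fun t => - Derive f t - k t)); auto.
    - intros t Ht; apply is_derive_sub; [apply is_derive_neg, Hd | apply HK]; exact Ht.
    - intros t Ht. destruct (Hd t Ht) as [_ Hb]. apply Rabs_le_between in Hb. lra. }
  apply Rabs_le; lra.
Qed.

Lemma cosh_mono (x y : R) : 0 <= x <= y -> cosh x <= cosh y.
Proof.
  intros H.
  assert (h : - cosh y <= - cosh x); [|lra].
  apply (derive_le_decreasing (fun y => - cosh y) (fun y => - sinh y)); [lra| |].
  - intros u _. apply is_derive_neg, is_derive_Reals, derivable_pt_lim_cosh.
  - intros u Hu. assert (h := sinh_half_le u). lra.
Qed.

Lemma geometric_small (K eps : R) : 0 <= K -> 0 < eps ->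
  exists N, forall n, (N <= n)%nat -> K * (1 / 2) ^ n < eps.
Proof.
  intros HK He.
  assert (Hp : 0 < eps / (K + 1)) by (apply Rdiv_lt_0_compat; lra).
  destruct (pow_lt_1_zero (1 / 2) ltac:(rewrite Rabs_pos_eq; lra) _ Hp) as [N HN].
  exists N; intros n Hn. specialize (HN n Hn).
  assert (Hq : 0 < (1 / 2) ^ n) by (apply pow_lt; lra).
  rewrite Rabs_pos_eq in HN by lra.
  apply (Rmult_lt_compat_l (K + 1)) in HN; [|lra].
  replace ((K + 1) * (eps / (K + 1))) with eps in HN by (field; lra). lra.
Qed.

Lemma le_of_le_geometric (a K : R) : 0 <= K -> (forall n, a <= K * (1 / 2) ^ n) -> a <= 0.
Proof.
  intros HK H. apply Rnot_lt_le; intros Ha.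
  destruct (geometric_small K a HK Ha) as [n Hn].
  specialize (Hn n (le_n n)). specialize (H n). lra.
Qed.

Lemma lipschitz_IVT (h : R -> R) (L a b : R) : a <= b -> 0 <= L ->
  (forall x y, a <= x <= b -> a <= y <= b -> Rabs (h x - h y) <= L * Rabs (x - y)) ->
  h a <= 0 -> 0 <= h b -> exists x, a <= x <= b /\ h x = 0.
Proof.
  intros Hab HL Hh Ha Hb.
  destruct (Req_dec (h a) 0) as [|Na]; [exists a; split; [lra|auto]|].
  destruct (Req_dec (h b) 0) as [|Nb]; [exists b; split; [lra|auto]|].
  set (cl := fun x => Rmax a (Rmin b x)).
  assert (Hcl : forall x, a <= cl x <= b).
  { intros x. unfold cl, Rmax, Rmin. repeat destruct Rle_dec; lra. }
  assert (Hclid : forall x, a <= x <= b -> cl x = x).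
  { intros x Hx. unfold cl, Rmax, Rmin. repeat destruct Rle_dec; lra. }
  assert (Hcl1 : forall x y, Rabs (cl x - cl y) <= Rabs (x - y)).
  { intros x y. unfold cl, Rmax, Rmin, Rabs. repeat destruct Rle_dec; repeat destruct Rcase_abs; lra. }
  destruct (IVT (fun x => h (cl x)) a b) as [x [Hx Ex]].
  - intros x. intros eps Heps. exists (eps / (L + 1)). split.
    + apply Rdiv_lt_0_compat; lra.
    + intros y [_ Hy]. simpl in *. unfold Rdist in *.
      eapply Rle_lt_trans; [apply Hh; apply Hcl|].
      eapply Rle_lt_trans; [apply Rmult_le_compat_l; [exact HL | apply Hcl1]|].
      apply Rle_lt_trans with ((L + 1) * Rabs (y - x)).
      * apply Rmult_le_compat_r; [apply Rabs_pos | lra].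
      * apply (Rmult_lt_compat_l (L + 1)) in Hy; [|lra].
        replace ((L + 1) * (eps / (L + 1))) with eps in Hy by (field; lra). exact Hy.
  - destruct (Req_dec a b) as [->|]; [lra|lra].
  - rewrite Hclid; lra.
  - rewrite Hclid; lra.
  - exists (cl x). split; [apply Hcl | exact Ex].
Qed.

(** Solving g x y = 0 for y gives a function y = Q x, Lipschitz because g is expanding in y; then f x (Q x)
changes sign between x0 and x1.  Only the signs of f and g on the sides are used, so f may be known
merely up to an error smaller than its size there. *)
Lemma nested_root (f g : R -> R -> R) (x0 x1 r L c : R) : x0 <= x1 -> 0 <= r -> 0 <= L -> 0 < c ->
  (forall x x' y y', x0 <= x <= x1 -> x0 <= x' <= x1 -> Rabs y <= r -> Rabs y' <= r ->
     Rabs (f x y - f x' y') <= L * (Rabs (x - x') + Rabs (y - y')) /\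
     Rabs (g x y - g x' y') <= L * (Rabs (x - x') + Rabs (y - y'))) ->
  (forall x y y', x0 <= x <= x1 -> Rabs y <= r -> Rabs y' <= r ->
     c * Rabs (y - y') <= Rabs (g x y - g x y')) ->
  (forall x, x0 <= x <= x1 -> g x (- r) <= 0 <= g x r) ->
  (forall y, Rabs y <= r -> 0 <= f x0 y) -> (forall y, Rabs y <= r -> f x1 y <= 0) ->
  exists x y, x0 <= x <= x1 /\ Rabs y <= r /\ f x y = 0 /\ g x y = 0.
Proof.
  intros Hx Hr HL Hc HLip Hmono Hg Hf0 Hf1.
  destruct (functional_choice (fun x y => x0 <= x <= x1 -> Rabs y <= r /\ g x y = 0)) as [Q HQ].
  { intros x. destruct (Rle_dec x0 x) as [h0|h0]; [|exists 0; intros; lra].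
    destruct (Rle_dec x x1) as [h1|h1]; [|exists 0; intros; lra].
    destruct (lipschitz_IVT (g x) L (- r) r) as [y [Hy Ey]]; try lra.
    - intros y y' Hy Hy'. destruct (HLip x x y y') as [_ H]; try lra; try (apply Rabs_le; lra).
      rewrite Rminus_eq_0, Rabs_R0, Rplus_0_l in H. exact H.
    - apply Hg; lra.
    - apply Hg; lra.
    - exists y. intros _. split; [apply Rabs_le; lra | exact Ey]. }
  assert (HQL : forall x x', x0 <= x <= x1 -> x0 <= x' <= x1 ->
    c * Rabs (Q x - Q x') <= L * Rabs (x - x')).
  { intros x x' H H'. destruct (HQ x H) as [q1 q2]. destruct (HQ x' H') as [q1' q2'].
    eapply Rle_trans; [apply (Hmono x); auto|].
    replace (g x (Q x) - g x (Q x')) with (g x' (Q x') - g x (Q x')) by (rewrite q2, q2'; ring).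
    destruct (HLip x' x (Q x') (Q x')) as [_ h]; auto.
    rewrite (Rminus_eq_0 (Q x')), Rabs_R0, Rplus_0_r, Rabs_minus_sym in h.
    rewrite Rabs_minus_sym in h. rewrite (Rabs_minus_sym x). exact h. }
  destruct (lipschitz_IVT (fun x => - f x (Q x)) (L * (1 + L / c)) x0 x1) as [x [Hxx Ex]].
  - exact Hx.
  - apply Rmult_le_pos; [lra|]. assert (0 <= L / c) by (apply Rdiv_le_0_compat; lra). lra.
  - intros x x' H H'. destruct (HQ x H) as [q1 q2]. destruct (HQ x' H') as [q1' q2'].
    destruct (HLip x x' (Q x) (Q x')) as [h _]; auto.
    replace (- f x (Q x) - - f x' (Q x')) with (- (f x (Q x) - f x' (Q x'))) by ring.
    rewrite Rabs_Ropp. eapply Rle_trans; [exact h|].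
    rewrite Rmult_assoc. apply Rmult_le_compat_l; [exact HL|].
    rewrite Rmult_plus_distr_r, Rmult_1_l. apply Rplus_le_compat_l.
    apply (Rmult_le_reg_l c); [exact Hc|].
    eapply Rle_trans; [apply HQL; auto|]. apply Req_le. field. lra.
  - destruct (HQ x0 ltac:(lra)) as [q1 _]. specialize (Hf0 _ q1). lra.
  - destruct (HQ x1 ltac:(lra)) as [q1 _]. specialize (Hf1 _ q1). lra.
  - destruct (HQ x Hxx) as [q1 q2]. exists x, (Q x).
    split; [exact Hxx|]. split; [exact q1|]. split; [lra | exact q2].
Qed.

(** The second component is monotone in its variable, and on the sides of the square each component keeps
the sign of its own variable. *)
Lemma near_identity_root (G1 G2 : R -> R -> R) (r : R) : 0 <= r ->
  (forall x y x' y', Rabs x <= r -> Rabs y <= r -> Rabs x' <= r -> Rabs y' <= r ->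
     Rabs (G1 x y - G1 x' y' - (x - x')) <= 1 / 4 * (Rabs (x - x') + Rabs (y - y')) /\
     Rabs (G2 x y - G2 x' y' - (y - y')) <= 1 / 4 * (Rabs (x - x') + Rabs (y - y'))) ->
  Rabs (G1 0 0) <= r / 4 -> Rabs (G2 0 0) <= r / 4 ->
  exists x y, Rabs x <= r /\ Rabs y <= r /\ G1 x y = 0 /\ G2 x y = 0.
Proof.
  intros Hr HL H1 H2.
  assert (A0 : Rabs 0 <= r) by (rewrite Rabs_R0; exact Hr).
  assert (B1 := H1). assert (B2 := H2). apply Rabs_le_between in B1, B2.
  assert (HB : forall x y, Rabs x <= r -> Rabs y <= r ->
    x - 3 / 4 * r <= G1 x y <= x + 3 / 4 * r /\ y - 3 / 4 * r <= G2 x y <= y + 3 / 4 * r).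
  { intros x y Hx Hy. destruct (HL x y 0 0 Hx Hy A0 A0) as [h1 h2].
    rewrite !Rminus_0_r in h1, h2. apply Rabs_le_between in h1, h2. lra. }
  destruct (nested_root (fun x y => - G1 x y) G2 (- r) r r (5 / 4) (3 / 4))
    as [x [y [Hx [Hy [E1 E2]]]]]; try lra.
  - intros x x' y y' Hx Hx' Hy Hy'.
    destruct (HL x y x' y') as [h1 h2]; try (apply Rabs_le; lra); auto.
    assert (hx := Rabs_pos (x - x')). assert (hy := Rabs_pos (y - y')). split.
    + replace (- G1 x y - - G1 x' y') with
        (- (G1 x y - G1 x' y' - (x - x')) + - (x - x')) by ring.
      eapply Rle_trans; [apply Rabs_triang|]. rewrite !Rabs_Ropp. lra.
    + replace (G2 x y - G2 x' y') with ((G2 x y - G2 x' y' - (y - y')) + (y - y')) by ring.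
      eapply Rle_trans; [apply Rabs_triang|]. lra.
  - intros x y y' Hx Hy Hy'. destruct (HL x y x y') as [_ h]; try (apply Rabs_le; lra); auto.
    rewrite (Rminus_eq_0 x), Rabs_R0, Rplus_0_l in h.
    assert (t := Rabs_triang_inv (y - y') (y - y' - (G2 x y - G2 x y'))).
    replace (y - y' - (y - y' - (G2 x y - G2 x y'))) with (G2 x y - G2 x y') in t by ring.
    rewrite Rabs_minus_sym in h. lra.
  - intros x Hx. assert (X : Rabs x <= r) by (apply Rabs_le; lra).
    destruct (HB x r X ltac:(rewrite Rabs_pos_eq; lra)) as [_ h].
    destruct (HB x (- r) X ltac:(rewrite Rabs_Ropp, Rabs_pos_eq; lra)) as [_ h']. lra.
  - intros y Hy. destruct (HB (- r) y ltac:(rewrite Rabs_Ropp, Rabs_pos_eq; lra) Hy). lra.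
  - intros y Hy. destruct (HB r y ltac:(rewrite Rabs_pos_eq; lra) Hy). lra.
  - exists x, y. split; [apply Rabs_le; lra|]. split; [exact Hy|]. split; lra.
Qed.

(** * Polynomial observables *)

(** Vectors are indexed by all natural numbers; the four components are the entries 0 to 3, and entry 4
will carry an explicit dependence on time.  Sup-norm bounds become quantifications over the index. *)
Definition state := nat -> R.

Definition near (d : R) (x y : state) : Prop := forall j, Rabs (x j - y j) <= d.

Definition inbox (M : R) (x : state) : Prop := forall j, Rabs (x j) <= M.

Definition sdiff (x y : state) : state := fun i => x i - y i.

(** A syntax of polynomials: the bounds, Lipschitz constants, linearizations and iterated derivatives along
the flow needed below are then obtained once and for all by structural recursion. *)
Inductive poly : Type :=
  | Cst (c : R)
  | Var (i : nat)
  | Add (P Q : poly)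
  | Mul (P Q : poly).

Fixpoint eval (x : state) (P : poly) : R :=
  match P with
  | Cst c => c
  | Var i => x i
  | Add P Q => eval x P + eval x Q
  | Mul P Q => eval x P * eval x Q
  end.

Fixpoint differential (P : poly) (x h : state) : R :=
  match P with
  | Cst _ => 0
  | Var i => h i
  | Add P Q => differential P x h + differential Q x h
  | Mul P Q => differential P x h * eval x Q + eval x P * differential Q x h
  end.

Lemma eval_bounded (M : R) (P : poly) :
  exists B, 0 <= B /\ forall x, inbox M x -> Rabs (eval x P) <= B.
Proof.
  induction P as [c|i|P [A [HA IHP]] Q [B [HB IHQ]]|P [A [HA IHP]] Q [B [HB IHQ]]]; simpl.
  - exists (Rabs c); split; [apply Rabs_pos | intros; lra].
  - exists (Rabs M); split; [apply Rabs_pos|].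
    intros x Hx; eapply Rle_trans; [apply Hx | apply Rle_abs].
  - exists (A + B); split; [lra|]. intros x Hx; apply Rabs_plus_le; auto.
  - exists (A * B); split; [nra|]. intros x Hx; apply Rabs_mult_le; auto.
Qed.

Lemma differential_bounded (M : R) (P : poly) :
  exists B, 0 <= B /\ forall x h d, inbox M x -> inbox d h -> Rabs (differential P x h) <= B * d.
Proof.
  induction P as [c|i|P [A [HA IHP]] Q [B [HB IHQ]]|P [A [HA IHP]] Q [B [HB IHQ]]]; simpl.
  - exists 0; split; [lra|]. intros; rewrite Rabs_R0; lra.
  - exists 1; split; [lra|]. intros x h d _ Hh; rewrite Rmult_1_l; auto.
  - exists (A + B); split; [lra|]. intros x h d Hx Hh.
    rewrite Rmult_plus_distr_r; apply Rabs_plus_le; auto.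
  - destruct (eval_bounded M P) as [A' [HA' HP]], (eval_bounded M Q) as [B' [HB' HQ]].
    exists (A * B' + A' * B); split; [nra|]. intros x h d Hx Hh.
    replace ((A * B' + A' * B) * d) with (A * d * B' + A' * (B * d)) by ring.
    apply Rabs_plus_le; apply Rabs_mult_le; auto.
Qed.

Lemma eval_lipschitz (M : R) (P : poly) :
  exists L, 0 <= L /\ forall x y d, inbox M x -> inbox M y -> near d x y ->
    Rabs (eval x P - eval y P) <= L * d.
Proof.
  induction P as [c|i|P [A [HA IHP]] Q [B [HB IHQ]]|P [A [HA IHP]] Q [B [HB IHQ]]]; simpl.
  - exists 0; split; [lra|]. intros; rewrite Rminus_eq_0, Rabs_R0; lra.
  - exists 1; split; [lra|]. intros x y d _ _ Hh; rewrite Rmult_1_l; auto.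
  - exists (A + B); split; [lra|]. intros x y d Hx Hy Hd.
    replace (_ - _) with ((eval x P - eval y P) + (eval x Q - eval y Q)) by ring.
    rewrite Rmult_plus_distr_r; apply Rabs_plus_le; auto.
  - destruct (eval_bounded M P) as [A' [HA' HP]], (eval_bounded M Q) as [B' [HB' HQ]].
    exists (A * B' + A' * B); split; [nra|]. intros x y d Hx Hy Hd.
    replace (_ - _) with
      ((eval x P - eval y P) * eval x Q + eval y P * (eval x Q - eval y Q)) by ring.
    replace ((A * B' + A' * B) * d) with (A * d * B' + A' * (B * d)) by ring.
    apply Rabs_plus_le; apply Rabs_mult_le; auto.
Qed.

(** The difference of values is compared with the differential at a third point z, at distance rho of both
x and y: this is the form needed to compare two trajectories by means of the linearization along a
third one. *)
Lemma eval_linearization (M : R) (P : poly) :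
  exists C, 0 <= C /\ forall x y z rho d, inbox M x -> inbox M y -> inbox M z ->
    near rho x z -> near rho y z -> near d x y ->
    Rabs (eval x P - eval y P - differential P z (fun j => x j - y j)) <= C * (rho * d).
Proof.
  induction P as [c|i|P [A [HA IHP]] Q [B [HB IHQ]]|P [A [HA IHP]] Q [B [HB IHQ]]]; simpl.
  - exists 0; split; [lra|]. intros. replace (c - c - 0) with 0 by ring.
    rewrite Rabs_R0; lra.
  - exists 0; split; [lra|]. intros. rewrite Rminus_eq_0, Rabs_R0; lra.
  - exists (A + B); split; [lra|]. intros x y z rho d Hx Hy Hz Hxz Hyz Hd.
    match goal with |- Rabs (_ - _ - (?a + ?b)) <= _ =>
      replace (_ - _) with ((eval x P - eval y P - a) + (eval x Q - eval y Q - b)) by ring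
    end.
    rewrite Rmult_plus_distr_r; apply Rabs_plus_le; auto.
  - destruct (eval_bounded M P) as [A' [HA' HP]], (eval_bounded M Q) as [B' [HB' HQ]].
    destruct (eval_lipschitz M P) as [LP [HLP HlP]], (eval_lipschitz M Q) as [LQ [HLQ HlQ]].
    destruct (differential_bounded M P) as [DP [HDP HdP]], (differential_bounded M Q) as [DQ [HDQ HdQ]].
    exists (A' * B + LP * DQ + B' * A + LQ * DP).
    split; [nra|]. intros x y z rho d Hx Hy Hz Hxz Hyz Hd.
    set (h := fun j => x j - y j).
    assert (Hh : inbox d h) by (intros j; apply Hd).
    replace (_ - _) with
      (eval x P * (eval x Q - eval y Q - differential Q z h) + (eval x P - eval z P) * differential Q z h
       + eval y Q * (eval x P - eval y P - differential P z h)
       + (eval y Q - eval z Q) * differential P z h) by ring.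
    replace ((A' * B + LP * DQ + B' * A + LQ * DP) * (rho * d)) with
      (A' * (B * (rho * d)) + LP * rho * (DQ * d) + B' * (A * (rho * d))
       + LQ * rho * (DP * d)) by ring.
    repeat apply Rabs_plus_le; apply Rabs_mult_le; auto; apply IHP || apply IHQ; auto.
Qed.

Lemma is_derive_eval (x : R -> state) (t : R) (dx : state) (P : poly) :
  (forall i, is_derive (fun s => x s i) t (dx i)) ->
  is_derive (fun s => eval (x s) P) t (differential P (x t) dx).
Proof.
  intros H; induction P as [c|i|P IHP Q IHQ|P IHP Q IHQ]; simpl.
  - apply @is_derive_const.
  - apply H.
  - apply @is_derive_plus; assumption.
  - apply (is_derive_mul (fun s => eval (x s) P) (fun s => eval (x s) Q)); assumption.
Qed.

Lemma continuous_eval (x : R -> state) (t : R) (P : poly) :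
  (forall i, continuous (fun s => x s i) t) -> continuous (fun s => eval (x s) P) t.
Proof.
  intros H; induction P as [c|i|P IHP Q IHQ|P IHP Q IHQ]; simpl.
  - apply continuous_const.
  - apply H.
  - apply @continuous_plus; assumption.
  - apply @continuous_mult; assumption.
Qed.

(** * Global solutions of Lipschitz equations *)

Lemma is_derive_sinh_shift (k t0 s : R) :
  is_derive (fun s => sinh (k * (s - t0))) s (k * cosh (k * (s - t0))).
Proof. unfold sinh, cosh; auto_derive; [trivial | unfold Rminus; field]. Qed.

Lemma is_derive_cosh_shift (k t0 s : R) :
  is_derive (fun s => cosh (k * (s - t0))) s (k * sinh (k * (s - t0))).
Proof. unfold sinh, cosh; auto_derive; [trivial | unfold Rminus; field]. Qed.

Lemma is_derive_integral (g : R -> R) (t0 t : R) :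
  (forall s, continuous g s) -> is_derive (fun t => RInt g t0 t) t (g t).
Proof.
  intros Hg. apply (@is_derive_RInt R_NormedModule) with t0; [|apply Hg].
  exists (mkposreal 1 Rlt_0_1); intros y _.
  apply (@RInt_correct R_CompleteNormedModule), (@ex_RInt_continuous R_CompleteNormedModule); auto.
Qed.

(** The weight cosh (k (t - t0)) loses a factor k when integrated from t0, in both directions of time.
Measured with k twice the Lipschitz constant, Picard's map contracts by 1/2 on the whole line at once. *)
Lemma RInt_cosh_bound (g : R -> R) (k A t0 t : R) : 0 < k -> 0 <= A ->
  (forall s, continuous g s) ->
  (forall s, Rabs (g s) <= A * cosh (k * (s - t0))) ->
  Rabs (RInt g t0 t) <= A / k * cosh (k * (t - t0)).
Proof.
  intros Hk HA Hg Hb.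
  assert (HAk : 0 <= A / k) by (apply Rdiv_le_0_compat; auto).
  assert (E0 : sinh (k * (t0 - t0)) = 0) by (rewrite Rminus_eq_0, Rmult_0_r; apply sinh_0).
  assert (H : forall a b, a <= b -> Rabs (RInt g t0 b - RInt g t0 a)
    <= A / k * sinh (k * (b - t0)) - A / k * sinh (k * (a - t0))).
  { intros a b Hab.
    apply (derive_bound (fun t => RInt g t0 t) (fun s => A / k * sinh (k * (s - t0)))
      (fun s => A * cosh (k * (s - t0)))); [exact Hab| |].
    - intros s _. exists (g s). split; [apply is_derive_integral, Hg | apply Hb].
    - intros s _. eapply is_derive_R.
      + apply (is_derive_scal (fun s => sinh (k * (s - t0)))), is_derive_sinh_shift.
      + field. lra. }
  assert (Hz : RInt g t0 t0 = 0) by exact (RInt_point t0 g).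
  assert (hs := Rabs_sinh_le (k * (t - t0))). apply Rabs_le_between in hs.
  destruct (Rle_dec t0 t) as [Ht|Ht].
  - assert (h := H t0 t Ht). rewrite Hz, E0, Rminus_0_r in h. nra.
  - assert (h := H t t0 ltac:(lra)). rewrite Hz, E0, Rabs_minus_sym, Rminus_0_r in h. nra.
Qed.

Lemma RInt_minus_continuous (f g : R -> R) (a b : R) :
  (forall s, continuous f s) -> (forall s, continuous g s) ->
  RInt (fun s => f s - g s) a b = RInt f a b - RInt g a b.
Proof.
  intros Hf Hg.
  apply (RInt_minus (V := R_CompleteNormedModule) f g);
    apply (@ex_RInt_continuous R_CompleteNormedModule); auto.
Qed.

Lemma geometric_limit (X : nat -> R) (K : R) :
  (forall n, Rabs (X (S n) - X n) <= K * (1 / 2) ^ n) ->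
  exists l, forall n, Rabs (l - X n) <= 2 * K * (1 / 2) ^ n.
Proof.
  intros H.
  assert (HK : 0 <= K) by (specialize (H O); simpl in H; assert (h := Rabs_pos (X 1%nat - X O)); lra).
  assert (Hd : forall n m, Rabs (X (n + m)%nat - X n) <= 2 * K * (1 / 2) ^ n * (1 - (1 / 2) ^ m)).
  { intros n; induction m as [|m IH].
    - rewrite Nat.add_0_r, Rminus_eq_0, Rabs_R0; simpl; lra.
    - rewrite Nat.add_succ_r.
      replace (_ - _) with ((X (n + m)%nat - X n) + (X (S (n + m)) - X (n + m)%nat)) by ring.
      eapply Rle_trans; [apply Rabs_plus_le; [apply IH | apply H]|].
      rewrite pow_add; simpl. apply Req_le; field. }
  assert (Hd' : forall n m, Rabs (X (n + m)%nat - X n) <= 2 * K * (1 / 2) ^ n).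
  { intros n m. eapply Rle_trans; [apply Hd|].
    assert (0 < (1 / 2) ^ m) by (apply pow_lt; lra).
    assert (0 < (1 / 2) ^ n) by (apply pow_lt; lra).
    assert (0 <= 2 * K * (1 / 2) ^ n) by (apply Rmult_le_pos; lra). nra. }
  assert (Hc : ex_finite_lim_seq X).
  { apply ex_lim_seq_cauchy_corr. intros eps.
    destruct (geometric_small (4 * K) eps ltac:(lra) (cond_pos eps)) as [N HN].
    specialize (HN N (le_n N)).
    exists N; intros n m Hn Hm.
    replace n with (N + (n - N))%nat by lia. replace m with (N + (m - N))%nat by lia.
    replace (_ - _) with ((X (N + (n - N))%nat - X N) - (X (N + (m - N))%nat - X N)) by ring.
    eapply Rle_lt_trans; [apply Rabs_triang|]. rewrite Rabs_Ropp.
    assert (h1 := Hd' N (n - N)%nat). assert (h2 := Hd' N (m - N)%nat). lra. }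
  destruct Hc as [l Hl]. exists l; intros n.
  assert (Hl' : is_lim_seq (fun m => Rabs (X (n + m)%nat - X n)) (Rabs (l - X n))).
  { apply (is_lim_seq_abs _ (Finite (l - X n))).
    apply is_lim_seq_minus'; [|apply is_lim_seq_const].
    apply (is_lim_seq_ext (fun m => X (m + n)%nat)); [intros; f_equal; lia|].
    apply is_lim_seq_incr_n, Hl. }
  apply (is_lim_seq_le _ (fun _ => 2 * K * (1 / 2) ^ n) (Rabs (l - X n)) (2 * K * (1 / 2) ^ n)
           (Hd' n) Hl'). apply is_lim_seq_const.
Qed.

Section Picard.

Variables (F : nat -> R -> state -> R) (L C t0 : R) (x0 : state).
Hypothesis L_pos : 0 < L.
Hypothesis C_pos : 0 <= C.
Hypothesis F_lip : forall i s x y d, near d x y -> Rabs (F i s x - F i s y) <= L * d.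
Hypothesis F_bound : forall i s, Rabs (F i s x0) <= C.
Hypothesis F_cont : forall x : R -> state, (forall i t, continuous (fun s => x s i) t) ->
  forall i t, continuous (fun s => F i s (x s)) t.

Fixpoint picard_iter (n : nat) : R -> state :=
  match n with
  | O => fun _ => x0
  | S n => fun t i => x0 i + RInt (fun s => F i s (picard_iter n s)) t0 t
  end.

Lemma picard_iter_continuous (n i : nat) (t : R) : continuous (fun s => picard_iter n s i) t.
Proof.
  revert i t; induction n as [|n IH]; intros i t; simpl.
  - apply continuous_const.
  - apply @continuous_plus; [apply continuous_const|].
    eapply derivable_continuous, is_derive_integral, F_cont, IH.
Qed.

Lemma picard_iter_step (n i : nat) (t : R) :
  Rabs (picard_iter (S n) t i - picard_iter n t i)
    <= C / (2 * L) * cosh (2 * L * (t - t0)) * (1 / 2) ^ n.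
Proof.
  revert i t; induction n as [|n IH]; intros i t.
  - simpl. rewrite Rplus_minus_l, Rmult_1_r. apply RInt_cosh_bound; try lra.
    + apply (F_cont (fun _ => x0)); intros; apply continuous_const.
    + intros s. eapply Rle_trans; [apply F_bound|].
      assert (h := cosh_ge1 (2 * L * (s - t0))); nra.
  - assert (Hc : forall n i s, continuous (fun s => F i s (picard_iter n s)) s)
      by (intros; apply F_cont; intros; apply picard_iter_continuous).
    set (n1 := S n).
    replace (picard_iter (S n1) t i - picard_iter n1 t i) with
      (RInt (fun s => F i s (picard_iter n1 s) - F i s (picard_iter n s)) t0 t).
    2:{ rewrite RInt_minus_continuous by auto. 
        assert (E : forall a b c : R, b - c = a + b - (a + c)) by (intros; ring).
        apply (E (x0 i)). }
    replace (C / (2 * L) * cosh (2 * L * (t - t0)) * (1 / 2) ^ n1) with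
      (L * (C / (2 * L)) * (1 / 2) ^ n / (2 * L) * cosh (2 * L * (t - t0)))
      by (unfold n1; simpl; field; lra).
    assert (Hq : 0 < (1 / 2) ^ n) by (apply pow_lt; lra).
    assert (Hq' : 0 <= C / (2 * L)) by (apply Rdiv_le_0_compat; lra).
    apply RInt_cosh_bound; try lra.
    + apply Rmult_le_pos; [apply Rmult_le_pos|]; lra.
    + intros s. apply @continuous_minus; apply Hc.
    + intros s. eapply Rle_trans; [apply F_lip; intros j; apply (IH j s)|].
      apply Req_le; ring.
Qed.

(** The iterates converge geometrically in the weighted norm, hence uniformly on compact intervals, and the
limit satisfies the integral equation. *)
Lemma picard : exists x : R -> state, (forall i, x t0 i = x0 i) /\
  forall i t, is_derive (fun s => x s i) t (F i t (x t)).
Proof.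
  set (h := fun t => cosh (2 * L * (t - t0))).
  set (K := C / (2 * L)).
  assert (HK : 0 <= K) by (apply Rdiv_le_0_compat; lra).
  assert (Hh : forall t, 1 <= h t) by (intros; apply cosh_ge1).
  assert (Hlim : exists x : R -> state, forall t i n,
             Rabs (x t i - picard_iter n t i) <= 2 * (K * h t) * (1 / 2) ^ n).
  { exists (fun t i => real (Lim_seq (fun n => picard_iter n t i))). intros t i.
    destruct (geometric_limit (fun n => picard_iter n t i) (K * h t)) as [l Hl].
    { intros n; apply picard_iter_step. }
    rewrite (is_lim_seq_unique _ l); [exact Hl|].
    apply is_lim_seq_spec; intros eps.
    assert (HKh : 0 <= K * h t) by (specialize (Hh t); nra).
    destruct (geometric_small (2 * (K * h t)) eps ltac:(lra) (cond_pos eps)) as [N HN].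
    exists N; intros n Hn.
    rewrite Rabs_minus_sym. eapply Rle_lt_trans; [apply Hl | apply HN, Hn]. }
  destruct Hlim as [x Hx].
  assert (Hcx : forall i t, continuous (fun s => x s i) t).
  { intros i t. apply filterlim_locally; intros eps.
    assert (He3 : 0 < eps / 3) by (destruct eps; simpl; lra).
    destruct (geometric_small (2 * K * (h t + 1)) (eps / 3)) as [N HN];
      [specialize (Hh t); nra | exact He3 |].
    specialize (HN N (le_n N)).
    assert (Hq : 0 < (1 / 2) ^ N) by (apply pow_lt; lra).
    assert (Hc1 := picard_iter_continuous N i t).
    assert (Hc2 : continuous h t) by (eapply derivable_continuous, is_derive_cosh_shift).
    apply filterlim_locally with (eps := mkposreal _ He3) in Hc1.
    apply filterlim_locally with (eps := mkposreal 1 Rlt_0_1) in Hc2.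
    generalize (filter_and _ _ Hc1 Hc2). apply filter_imp; intros s [H1 H2].
    unfold ball, AbsRing_ball, abs, minus, plus, opp in *; simpl in *.
    unfold AbsRing_ball, abs, minus, plus, opp in *; simpl in *.
    replace (_ + _) with ((x s i - picard_iter N s i) + (picard_iter N s i + - picard_iter N t i)
      + - (x t i - picard_iter N t i)) by ring.
    assert (hs : h s <= h t + 1) by (apply Rabs_def2 in H2; lra).
    assert (B1 := Hx s i N). assert (B2 := Hx t i N).
    assert (D1 : 2 * (K * h s) * (1 / 2) ^ N < eps / 3).
    { eapply Rle_lt_trans; [|exact HN]. apply Rmult_le_compat_r; [lra|].
      assert (K * h s <= K * (h t + 1)) by (apply Rmult_le_compat_l; lra). lra. }
    assert (D2 : 2 * (K * h t) * (1 / 2) ^ N < eps / 3).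
    { eapply Rle_lt_trans; [|exact HN]. apply Rmult_le_compat_r; [lra|].
      assert (K * h t <= K * (h t + 1)) by (apply Rmult_le_compat_l; lra). lra. }
    eapply Rle_lt_trans; [apply Rabs_triang|].
    rewrite Rabs_Ropp.
    eapply Rle_lt_trans; [apply Rplus_le_compat_r, Rabs_triang|]. lra. }
  assert (Hfc : forall i s, continuous (fun s => F i s (x s)) s) by (apply F_cont, Hcx).
  assert (Hint : forall t i, x t i = x0 i + RInt (fun s => F i s (x s)) t0 t).
  { intros t i. apply Rminus_diag_uniq.
    apply Rabs_le0.
    { apply le_of_le_geometric with (2 * (K * h t)); [specialize (Hh t); nra|].
      intros n.
      assert (Hc : forall s, continuous (fun s => F i s (picard_iter n s)) s)
        by (intros; apply F_cont; intros; apply picard_iter_continuous).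
      assert (Hd : Rabs (RInt (fun s => F i s (x s)) t0 t - RInt (fun s => F i s (picard_iter n s)) t0 t)
        <= L * (2 * K * (1 / 2) ^ n) / (2 * L) * h t).
      { rewrite <- RInt_minus_continuous by auto.
        assert (Hq : 0 < (1 / 2) ^ n) by (apply pow_lt; lra).
        apply RInt_cosh_bound; try lra.
        - apply Rmult_le_pos; [lra|]. apply Rmult_le_pos; lra.
        - intros s. apply @continuous_minus; auto.
        - intros s. eapply Rle_trans; [apply F_lip; intros j; apply (Hx s j n)|].
          apply Req_le; unfold h; ring. }
      assert (Hs := Hx t i (S n)). simpl picard_iter in Hs.
      replace (x t i - _) with
        ((x t i - (x0 i + RInt (fun s => F i s (picard_iter n s)) t0 t)) +
         - (RInt (fun s => F i s (x s)) t0 t - RInt (fun s => F i s (picard_iter n s)) t0 t))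
        by ring.
      eapply Rle_trans; [apply Rabs_triang|]. rewrite Rabs_Ropp.
      eapply Rle_trans; [apply Rplus_le_compat; [apply Hs | apply Hd]|].
      apply Req_le; simpl; field; lra. } }
  exists x; split.
  - intros i. rewrite Hint, RInt_point. apply Rplus_0_r.
  - intros i t.
    apply (is_derive_ext (fun t => x0 i + RInt (fun s => F i s (x s)) t0 t)).
    { intros s; symmetry; apply Hint. }
    replace (F i t (x t)) with (plus 0 (F i t (x t))) by apply Rplus_0_l.
    apply @is_derive_plus; [apply @is_derive_const | apply is_derive_integral, Hfc].
Qed.

End Picard.

(** * Growth of the distance between trajectories *)

Lemma gronwall (S dS K k : R -> R) (a b : R) : a <= b ->
  (forall t, a <= t <= b -> is_derive S t (dS t)) ->
  (forall t, a <= t <= b -> is_derive K t (k t)) ->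
  (forall t, a <= t <= b -> dS t <= k t * S t) -> S b <= S a * exp (K b - K a).
Proof.
  intros Hab HS HK Hle.
  assert (H : S b * exp (- K b) <= S a * exp (- K a)).
  { apply (derive_le_decreasing (fun t => S t * exp (- K t))
             (fun t => (dS t - k t * S t) * exp (- K t))); auto.
    - intros t Ht.
      assert (He : is_derive (fun t => exp (- K t)) t (- k t * exp (- K t))).
      { apply (is_derive_comp exp (fun t => - K t)); [apply is_derive_exp|].
        apply is_derive_neg; auto. }
      replace ((dS t - k t * S t) * exp (- K t)) with
        (dS t * exp (- K t) + S t * (- k t * exp (- K t))) by ring.
      apply (is_derive_mul S (fun t => exp (- K t))); auto.
    - intros t Ht. specialize (Hle t Ht). assert (h := exp_pos (- K t)). nra. }
  unfold Rminus. rewrite Rplus_comm, exp_plus.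
  replace (S b) with (S b * exp (- K b) * exp (K b)).
  2:{ rewrite Rmult_assoc, <- exp_plus, Rplus_opp_l, exp_0; ring. }
  assert (h := exp_pos (K b)). nra.
Qed.

Definition dist2 (x y : state) : R :=
  (x 0%nat - y 0%nat) ^ 2 + (x 1%nat - y 1%nat) ^ 2 +
  (x 2%nat - y 2%nat) ^ 2 + (x 3%nat - y 3%nat) ^ 2.

Lemma lt4_cases (j : nat) : (j = 0 \/ j = 1 \/ j = 2 \/ j = 3 \/ 4 <= j)%nat.
Proof. lia. Qed.

Lemma near_dist2 (x y : state) (r : R) : 0 <= r -> dist2 x y <= r ^ 2 ->
  (forall j, (4 <= j)%nat -> x j = y j) -> near r x y.
Proof.
  intros Hr Hd H4 j. unfold dist2 in Hd.
  assert (h0 := pow2_ge_0 (x 0%nat - y 0%nat)). assert (h1 := pow2_ge_0 (x 1%nat - y 1%nat)).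
  assert (h2 := pow2_ge_0 (x 2%nat - y 2%nat)). assert (h3 := pow2_ge_0 (x 3%nat - y 3%nat)).
  destruct (lt4_cases j) as [->|[->|[->|[->|Hj]]]];
    cycle 4.
  { rewrite H4 by auto. rewrite Rminus_eq_0, Rabs_R0; exact Hr. }
  all: rewrite <- (Rabs_pos_eq r Hr); apply Rsqr_le_abs_0; unfold Rsqr; nra.
Qed.

Lemma near_ge0 (d : R) (x y : state) : near d x y -> 0 <= d.
Proof. intros H; eapply Rle_trans; [apply Rabs_pos | apply (H O)]. Qed.

Lemma dist2_near (x y : state) (d : R) : near d x y -> dist2 x y <= 4 * d ^ 2.
Proof.
  intros H. assert (Hd := near_ge0 _ _ _ H).
  assert (Hs : forall j, (x j - y j) ^ 2 <= d ^ 2).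
  { intros j. rewrite <- (pow2_abs (x j - y j)). apply pow_incr.
    split; [apply Rabs_pos | apply H]. }
  unfold dist2.
  generalize (Hs 0%nat) (Hs 1%nat) (Hs 2%nat) (Hs 3%nat); lra.
Qed.

Lemma near_trans (d d' : R) (x y z : state) : near d x y -> near d' y z -> near (d + d') x z.
Proof.
  intros H H' j. replace (x j - z j) with ((x j - y j) + (y j - z j)) by ring.
  apply Rabs_plus_le; auto.
Qed.

Lemma near_le (d d' : R) (x y : state) : d <= d' -> near d x y -> near d' x y.
Proof. intros H H' j; eapply Rle_trans; [apply H' | exact H]. Qed.

(** Gronwall's inequality for the squared Euclidean distance, which is differentiable, stated for the sup
norm.  Only the products (x_i - y_i) (f_i - g_i) enter: dissipative linear terms contribute nothing,
and a forcing of size rho is allowed. *)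
Lemma trajectories_near (x y f g : R -> state) (K k : R -> R) (a b rho d : R) :
  a <= b -> 0 <= rho ->
  (forall t, a <= t <= b -> forall i, is_derive (fun s => x s i) t (f t i)) ->
  (forall t, a <= t <= b -> forall i, is_derive (fun s => y s i) t (g t i)) ->
  (forall t j, (4 <= j)%nat -> x t j = y t j) ->
  (forall t, a <= t <= b -> is_derive K t (k t)) ->
  (forall t, a <= t <= b -> forall i r, near r (x t) (y t) ->
     (x t i - y t i) * (f t i - g t i) <= k t * (r ^ 2 + rho ^ 2)) ->
  near d (x a) (y a) -> near (2 * (d + rho) * exp (4 * (K b - K a))) (x b) (y b).
Proof.
  intros Hab Hrho Hx Hy H4 HK Hle Hd.
  assert (Hd0 := near_ge0 _ _ _ Hd).
  assert (HS : dist2 (x b) (y b) + rho ^ 2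
    <= (dist2 (x a) (y a) + rho ^ 2) * exp (8 * K b - 8 * K a)).
  { apply (gronwall (fun t => dist2 (x t) (y t) + rho ^ 2)
      (fun t => 2 * (x t 0%nat - y t 0%nat) * (f t 0%nat - g t 0%nat) +
                2 * (x t 1%nat - y t 1%nat) * (f t 1%nat - g t 1%nat) +
                2 * (x t 2%nat - y t 2%nat) * (f t 2%nat - g t 2%nat) +
                2 * (x t 3%nat - y t 3%nat) * (f t 3%nat - g t 3%nat))
      (fun t => 8 * K t) (fun t => 8 * k t)); auto.
    - intros t Ht. unfold dist2.
      assert (Hsq : forall i, is_derive (fun t => (x t i - y t i) ^ 2) t
                (2 * (x t i - y t i) * (f t i - g t i))).
      { intros i.
        assert (D : is_derive (fun t => x t i - y t i) t (f t i - g t i))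
          by (apply is_derive_sub; auto).
        evar_last.
        - apply (is_derive_pow (fun t => x t i - y t i) 2 t _ D).
        - simpl; ring. }
      rewrite <- (Rplus_0_r (_ + _)).
      apply @is_derive_plus; [|apply @is_derive_const].
      repeat apply @is_derive_plus; apply Hsq.
    - intros t Ht. apply (is_derive_scal K); auto.
    - intros t Ht.
      set (S := dist2 (x t) (y t)).
      assert (HS : 0 <= S).
      { unfold S, dist2. generalize (pow2_ge_0 (x t 0%nat - y t 0%nat))
          (pow2_ge_0 (x t 1%nat - y t 1%nat)) (pow2_ge_0 (x t 2%nat - y t 2%nat))
          (pow2_ge_0 (x t 3%nat - y t 3%nat)); lra. }
      assert (E : sqrt S ^ 2 = S) by (apply pow2_sqrt; exact HS).
      assert (Hn : near (sqrt S) (x t) (y t)).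
      { apply near_dist2; auto using sqrt_pos. rewrite E; unfold S; lra. }
      (* the four products add up to at most 4 k (S + rho^2), and the derivative of S is twice their sum *)
      generalize (Hle t Ht 0%nat _ Hn) (Hle t Ht 1%nat _ Hn) (Hle t Ht 2%nat _ Hn)
        (Hle t Ht 3%nat _ Hn). rewrite E. lra. }
  set (E := exp (4 * (K b - K a))) in *.
  assert (HE : exp (8 * K b - 8 * K a) = E * E).
  { unfold E; rewrite <- exp_plus; f_equal; ring. }
  assert (HE0 : 0 < E) by apply exp_pos.
  apply near_dist2; auto.
  - apply Rmult_le_pos; [lra|lra].
  - assert (h := dist2_near _ _ _ Hd). rewrite HE in HS.
    assert (dist2 (x b) (y b) <= (4 * d ^ 2 + rho ^ 2) * (E * E)) by nra.
    replace ((2 * (d + rho) * E) ^ 2) with (4 * (d + rho) ^ 2 * (E * E)) by ring.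
    assert (4 * d ^ 2 + rho ^ 2 <= 4 * (d + rho) ^ 2) by nra.
    assert (0 < E * E) by nra. nra.
Qed.

(** * Clamped polynomial vector fields *)

(** Truncating the components makes a polynomial field globally Lipschitz, hence its flow global, without
any a priori bound; a trajectory that turns out to stay in the box solves the original equation. *)
Definition clamp (M : R) (x : state) : state := fun j => Rmax (- M) (Rmin M (x j)).

(** Entry 4 of the environment holds the current value of an explicit function of time. *)
Definition set4 (x : state) (e : R) : state :=
  fun j => if Nat.eqb j 4 then e else x j.

Lemma clamp_inbox (M : R) (x : state) : 0 <= M -> inbox M (clamp M x).
Proof.
  intros HM j. unfold clamp. apply Rabs_le. split; [apply Rmax_l|].
  apply Rmax_lub; [lra | apply Rmin_l].
Qed.

Lemma clamp_id (M : R) (x : state) : inbox M x -> forall j, clamp M x j = x j.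
Proof.
  intros H j. unfold clamp. specialize (H j). apply Rabs_le_between in H.
  rewrite Rmin_right, Rmax_right by lra. reflexivity.
Qed.

(** Clamping preserves the sign of differences, hence the dissipativity of diagonal terms. *)
Lemma clamp_monotone (M : R) (x y : state) (j : nat) :
  0 <= (x j - y j) * (clamp M x j - clamp M y j).
Proof.
  assert (Hm : forall a b, a <= b -> Rmax (- M) (Rmin M a) <= Rmax (- M) (Rmin M b)).
  { intros a b Hab. unfold Rmax, Rmin. repeat destruct Rle_dec; lra. }
  unfold clamp. destruct (Rle_dec (x j) (y j)) as [H|H].
  - specialize (Hm _ _ H). nra.
  - assert (H' : y j <= x j) by lra. specialize (Hm _ _ H'). nra.
Qed.

Lemma clamp_near (M d : R) (x y : state) : near d x y -> near d (clamp M x) (clamp M y).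
Proof.
  intros H j. specialize (H j). apply Rabs_le_between in H. apply Rabs_le.
  unfold clamp, Rmax, Rmin. repeat destruct Rle_dec; lra.
Qed.

Lemma set4_near (d e : R) (x y : state) : near d x y -> near d (set4 x e) (set4 y e).
Proof.
  intros H j. unfold set4. destruct Nat.eqb; [|apply H].
  rewrite Rminus_eq_0, Rabs_R0. apply (near_ge0 _ _ _ H).
Qed.

Lemma set4_inbox (M e : R) (x : state) : inbox M x -> Rabs e <= M -> inbox M (set4 x e).
Proof. intros H He j. unfold set4. destruct Nat.eqb; auto. Qed.

Lemma continuous_clamp (M : R) (x : R -> state) (j : nat) (t : R) :
  continuous (fun s => x s j) t -> continuous (fun s => clamp M (x s) j) t.
Proof.
  intros H. unfold clamp.
  apply filterlim_locally; intros eps.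
  apply filterlim_locally with (eps := eps) in H.
  revert H; apply filter_imp; intros s Hs.
  unfold ball in *; simpl in *. unfold AbsRing_ball, abs, minus, plus, opp in *; simpl in *.
  eapply Rle_lt_trans; [|exact Hs].
  refine (clamp_near M (Rabs (x s j - x t j)) (fun _ => x s j) (fun _ => x t j) _ j).
  intros i; apply Rle_refl.
Qed.

Lemma uniform_constant (Pr : nat -> R -> Prop) (n : nat) :
  (forall j B B', B <= B' -> Pr j B -> Pr j B') -> (forall j, exists B, 0 <= B /\ Pr j B) ->
  exists B, 0 < B /\ forall j, (j < n)%nat -> Pr j B.
Proof.
  intros Hmono Hex. induction n as [|n [B [HB IH]]].
  - exists 1. split; [lra | lia].
  - destruct (Hex n) as [B' [HB' H]]. exists (B + B'). split; [lra|]. intros j Hj.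
    destruct (Nat.eq_dec j n) as [->|].
    + apply (Hmono n B'); [lra | exact H].
    + apply (Hmono j B); [lra | apply IH; lia].
Qed.

Lemma poly_family_lipschitz (G : nat -> poly) (M : R) :
  (forall i, (4 <= i)%nat -> G i = Cst 0) ->
  exists L, 0 < L /\ forall i x y d, inbox M x -> inbox M y -> near d x y ->
    Rabs (eval x (G i) - eval y (G i)) <= L * d.
Proof.
  intros HG.
  destruct (uniform_constant (fun i L => forall x y d, inbox M x -> inbox M y -> near d x y ->
    Rabs (eval x (G i) - eval y (G i)) <= L * d) 4) as [L [HL H]].
  - intros i L L' HL H x y d Hx Hy Hd. assert (h := near_ge0 _ _ _ Hd).
    specialize (H x y d Hx Hy Hd). nra.
  - intros i. apply eval_lipschitz.
  - exists L. split; [exact HL|]. intros i x y d Hx Hy Hd.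
    destruct (Nat.lt_ge_cases i 4) as [Hi|Hi]; [auto|].
    rewrite HG by auto. simpl. rewrite Rminus_eq_0, Rabs_R0.
    assert (h := near_ge0 _ _ _ Hd). nra.
Qed.

Lemma poly_family_linearization (G : nat -> poly) (M : R) :
  (forall i, (4 <= i)%nat -> G i = Cst 0) ->
  exists C, 0 < C /\ forall i x y z rho d, inbox M x -> inbox M y -> inbox M z ->
    near rho x z -> near rho y z -> near d x y ->
    Rabs (eval x (G i) - eval y (G i) - differential (G i) z (sdiff x y)) <= C * (rho * d).
Proof.
  intros HG.
  assert (Hp : forall rho d (x y z : state), near rho x z -> near d x y -> 0 <= rho * d)
    by (intros; apply Rmult_le_pos; eapply near_ge0; eassumption).
  destruct (uniform_constant (fun i C => forall x y z rho d, inbox M x -> inbox M y -> inbox M z ->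
    near rho x z -> near rho y z -> near d x y ->
    Rabs (eval x (G i) - eval y (G i) - differential (G i) z (sdiff x y)) <= C * (rho * d)) 4)
    as [C [HC H]].
  - intros i C C' HC H x y z rho d Hx Hy Hz Hxz Hyz Hd.
    assert (h := Hp rho d x y z Hxz Hd). eapply Rle_trans; [apply H; eauto|].
    apply Rmult_le_compat_r; lra.
  - intros i. apply eval_linearization.
  - exists C. split; [exact HC|]. intros i x y z rho d Hx Hy Hz Hxz Hyz Hd.
    destruct (Nat.lt_ge_cases i 4) as [Hi|Hi]; [auto|].
    rewrite HG by auto. simpl. rewrite Rminus_eq_0, Rminus_0_r, Rabs_R0.
    apply Rmult_le_pos; [lra | eauto].
Qed.

Definition clamped_field (G : nat -> poly) (e : R -> R) (M : R) (i : nat) (s : R) (x : state) : R :=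
  eval (set4 (clamp M x) (e s)) (G i).

Lemma clamped_flow (G : nat -> poly) (e : R -> R) (M t0 : R) (x0 : state) :
  (forall i, (4 <= i)%nat -> G i = Cst 0) -> 0 <= M ->
  (forall s, continuous e s) -> (forall s, Rabs (e s) <= M) ->
  exists x : R -> state, (forall i, x t0 i = x0 i) /\
    (forall t i, is_derive (fun s => x s i) t (clamped_field G e M i t (x t))) /\
    (forall t i, (4 <= i)%nat -> x t i = x0 i).
Proof.
  intros HG HM Hec Heb.
  destruct (poly_family_lipschitz G M HG) as [L [HL Hlip]].
  assert (Hbd : exists C, 0 <= C /\ forall i s, Rabs (clamped_field G e M i s x0) <= C).
  { destruct (uniform_constant (fun i C => forall x, inbox M x -> Rabs (eval x (G i)) <= C) 4)
      as [C [HC H]].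
    - intros i C C' HC H x Hx. specialize (H x Hx). lra.
    - intros i. apply eval_bounded.
    - exists C. split; [lra|]. intros i s. unfold clamped_field.
      destruct (Nat.lt_ge_cases i 4) as [Hi|Hi].
      + apply H; [exact Hi|]. apply set4_inbox; auto using clamp_inbox.
      + rewrite HG by auto; simpl; rewrite Rabs_R0; lra. }
  destruct Hbd as [C [HC Hbd]].
  destruct (picard (clamped_field G e M) L C t0 x0) as [x [Hx0 Hx]]; auto.
  - intros i s x y d Hd. apply Hlip.
    + apply set4_inbox; auto using clamp_inbox.
    + apply set4_inbox; auto using clamp_inbox.
    + apply set4_near, clamp_near, Hd.
  - intros x Hc i t. apply continuous_eval. intros j. unfold set4.
    destruct Nat.eqb; [apply Hec | apply continuous_clamp, Hc].
  - exists x; split; [auto|split; [auto|]].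
    intros t i Hi. rewrite <- Hx0.
    assert (Hz : forall s, is_derive (fun s => x s i) s 0).
    { intros s. specialize (Hx i s). unfold clamped_field in Hx. rewrite HG in Hx by auto. exact Hx. }
    destruct (Rtotal_order t t0) as [H|[->|H]]; [|reflexivity|].
    + apply (eq_is_derive (V := R_NormedModule) (fun s => x s i)); auto.
    + symmetry. apply (eq_is_derive (V := R_NormedModule) (fun s => x s i)); auto.
Qed.

(** * The system and its time reversal *)

Definition quad (u v a b : R) : state := fun i =>
  match i with 0%nat => u | 1%nat => v | 2%nat => a | 3%nat => b | _ => 0 end.

Definition S_field (i : nat) : poly :=
  match i with
  | 0%nat => Var 1
  | 1%nat => Mul (Cst (-1))
      (Mul (Add (Add (Mul (Var 2) (Var 2)) (Mul (Var 3) (Var 3))) (Cst (- (1 / 4)))) (Var 0))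
  | 2%nat => Add (Mul (Cst (-1)) (Var 2)) (Mul (Mul (Var 0) (Var 0)) (Var 3))
  | 3%nat => Add (Var 3) (Mul (Cst (-1)) (Mul (Mul (Var 0) (Var 0)) (Var 2)))
  | _ => Cst 0
  end.

Lemma S_field_ge4 (i : nat) : (4 <= i)%nat -> S_field i = Cst 0.
Proof. intros H. do 4 (destruct i as [|i]; [lia|]). reflexivity. Qed.

(** Being a solution is stated at a single time, because the trajectories found by shooting solve the
system only on a bounded interval. *)
Definition solves_at (x : R -> state) (t : R) : Prop :=
  forall i, is_derive (fun s => x s i) t (eval (x t) (S_field i)).

(** The value 3 exceeds the size of all orbits in play: the equilibrium and the homoclinic orbit stay
in the box of size 2. *)
Definition csolves_at (x : R -> state) (t : R) : Prop :=
  forall i, is_derive (fun s => x s i) t (eval (clamp 3 (x t)) (S_field i)).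

Definition supp4 (x : R -> state) : Prop := forall t j, (4 <= j)%nat -> x t j = 0.

Definition bounded_solution (x : R -> state) : Prop :=
  (forall t, solves_at x t) /\ (forall t, inbox 3 (x t)) /\ supp4 x.

Lemma eval_agree (x y : state) (P : poly) :
  (forall j, x j = y j) -> eval x P = eval y P.
Proof. intros H; induction P; simpl; auto; congruence. Qed.

Lemma eval_S_field_set4 (x : state) (e : R) (i : nat) :
  eval (set4 x e) (S_field i) = eval x (S_field i).
Proof. destruct i as [|[|[|[|i]]]]; reflexivity. Qed.

Lemma csolves_of_solves (x : R -> state) (t : R) :
  inbox 3 (x t) -> solves_at x t -> csolves_at x t.
Proof.
  intros Hb H i. rewrite (eval_agree _ (x t)); [apply H | apply clamp_id, Hb].
Qed.

Lemma solves_of_csolves (x : R -> state) (t : R) :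
  inbox 3 (x t) -> csolves_at x t -> solves_at x t.
Proof.
  intros Hb H i. rewrite <- (eval_agree (clamp 3 (x t))); [apply H | apply clamp_id, Hb].
Qed.

Lemma csolution_exists (t0 : R) (x0 : state) : (forall j, (4 <= j)%nat -> x0 j = 0) ->
  exists x, (forall i, x t0 i = x0 i) /\ (forall t, csolves_at x t) /\ supp4 x.
Proof.
  intros H4.
  destruct (clamped_flow S_field (fun _ => 0) 3 t0 x0) as [x [H0 [Hx Hj]]].
  - apply S_field_ge4.
  - lra.
  - intros; apply continuous_const.
  - intros; rewrite Rabs_R0; lra.
  - exists x; split; [auto|split].
    + intros t i. specialize (Hx t i). unfold clamped_field in Hx.
      rewrite eval_S_field_set4 in Hx. exact Hx.
    + intros t j H. rewrite Hj; auto.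
Qed.

(** The reversor. *)
Definition flip (x : state) : state := fun i =>
  match i with 0%nat => x 0%nat | 1%nat => - x 1%nat | 2%nat => x 3%nat | 3%nat => x 2%nat
  | _ => x i end.

Lemma flip_flip (x : state) (i : nat) : flip (flip x) i = x i.
Proof. destruct i as [|[|[|[|i]]]]; simpl; ring. Qed.

Lemma flip_near (d : R) (x y : state) : near d x y -> near d (flip x) (flip y).
Proof.
  intros H i. destruct i as [|[|[|[|i]]]]; try apply H. simpl.
  replace (_ - _) with (- (x 1%nat - y 1%nat)) by ring. rewrite Rabs_Ropp; apply H.
Qed.

Lemma clamp_flip (x : state) (i : nat) : clamp 3 (flip x) i = flip (clamp 3 x) i.
Proof.
  destruct i as [|[|[|[|i]]]]; try reflexivity.
  unfold clamp, flip, Rmax, Rmin. repeat destruct Rle_dec; lra.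
Qed.

Lemma flip_S_field (x : state) (i : nat) :
  eval (flip x) (S_field i) = - flip (fun j => eval x (S_field j)) i.
Proof. destruct i as [|[|[|[|i]]]]; simpl; ring. Qed.

Definition reverse (c : R) (x : R -> state) : R -> state := fun t => flip (x (c - t)).

Lemma reverse_csolves (c t : R) (x : R -> state) :
  csolves_at x (c - t) -> csolves_at (reverse c x) t.
Proof.
  intros H i. unfold reverse.
  rewrite (eval_agree _ (flip (clamp 3 (x (c - t))))) by apply clamp_flip.
  rewrite flip_S_field.
  assert (D : forall j, is_derive (fun s => x (c - s) j) t
                (- eval (clamp 3 (x (c - t))) (S_field j))).
  { intros j. evar_last.
    - apply (is_derive_comp (fun s => x s j) (fun s => c - s)); [apply H|].
      apply is_derive_sub; [apply @is_derive_const | apply @is_derive_id].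
    - unfold scal, zero, one; simpl. unfold mult; simpl. ring. }
  destruct i as [|[|[|[|i]]]]; simpl flip; try apply D.
  apply is_derive_neg, D.
Qed.

Lemma reverse_supp4 (c : R) (x : R -> state) : supp4 x -> supp4 (reverse c x).
Proof.
  intros H t j Hj. do 4 (destruct j as [|j]; [lia|]). apply H; exact Hj.
Qed.

(** Continuous dependence backwards in time is the forward statement for the reversed trajectories. *)
Lemma csolves_dependence : exists L, 0 < L /\ forall (x y : R -> state) (a b d : R),
  a <= b -> (forall t, a <= t <= b -> csolves_at x t) ->
  (forall t, a <= t <= b -> csolves_at y t) -> supp4 x -> supp4 y ->
  (near d (x a) (y a) -> near (2 * d * exp (L * (b - a))) (x b) (y b)) /\
  (near d (x b) (y b) -> near (2 * d * exp (L * (b - a))) (x a) (y a)).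
Proof.
  destruct (poly_family_lipschitz S_field 3 S_field_ge4) as [L [HL Hlip]].
  assert (Hfw : forall (x y : R -> state) (a b d : R),
    a <= b -> (forall t, a <= t <= b -> csolves_at x t) ->
    (forall t, a <= t <= b -> csolves_at y t) -> supp4 x -> supp4 y ->
    near d (x a) (y a) -> near (2 * d * exp (4 * L * (b - a))) (x b) (y b)).
  { intros x y a b d Hab Hx Hy Sx Sy Hd.
    assert (h := trajectories_near x y (fun t i => eval (clamp 3 (x t)) (S_field i))
      (fun t i => eval (clamp 3 (y t)) (S_field i)) (fun t => L * t) (fun _ => L) a b 0 d).
    replace (2 * d * exp (4 * L * (b - a))) with
      (2 * (d + 0) * exp (4 * (L * b - L * a))) by (f_equal; [ring | f_equal; ring]).
    apply h; auto; try lra.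
    - intros t j Hj. rewrite Sx, Sy; auto.
    - intros t _. apply is_derive_linear.
    - intros t Ht i r Hr.
      assert (Hr0 := near_ge0 _ _ _ Hr).
      assert (B1 : Rabs (eval (clamp 3 (x t)) (S_field i) - eval (clamp 3 (y t)) (S_field i)) <= L * r).
      { apply Hlip; try (apply clamp_inbox; lra). apply clamp_near, Hr. }
      eapply Rle_trans; [apply Rle_abs|].
      eapply Rle_trans; [apply Rabs_mult_le; [apply Hr | apply B1]|].
      apply Req_le; ring. }
  exists (4 * L); split; [lra|]. intros x y a b d Hab Hx Hy Sx Sy; split.
  - apply Hfw; auto.
  - intros Hd.
    assert (h : near (2 * d * exp (4 * L * (b - a)))
                (reverse (a + b) x b) (reverse (a + b) y b)).
    { apply Hfw; auto using reverse_supp4.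
      - intros t Ht; apply reverse_csolves, Hx; lra.
      - intros t Ht; apply reverse_csolves, Hy; lra.
      - unfold reverse. apply flip_near. replace (a + b - a) with b by ring. exact Hd. }
    unfold reverse in h. replace (a + b - b) with a in h by ring.
    apply flip_near in h. intros j. specialize (h j). rewrite !flip_flip in h. exact h.
Qed.

Lemma csolves_dependence_global : exists L, 0 < L /\ forall (x y : R -> state) (a b d : R),
  (forall t, csolves_at x t) -> (forall t, csolves_at y t) -> supp4 x -> supp4 y ->
  near d (x a) (y a) -> near (2 * d * exp (L * Rabs (b - a))) (x b) (y b).
Proof.
  destruct csolves_dependence as [L [HL H]]. exists L; split; [auto|].
  intros x y a b d Hx Hy Sx Sy Hd. destruct (Rle_dec a b) as [Hab|Hab].
  - rewrite Rabs_pos_eq by lra. apply (H x y a b d); auto.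
  - rewrite Rabs_minus_sym, Rabs_pos_eq by lra. apply (H x y b a d); auto; lra.
Qed.

Lemma csolves_unique (x y : R -> state) (a : R) :
  (forall t, csolves_at x t) -> (forall t, csolves_at y t) -> supp4 x -> supp4 y ->
  (forall i, x a i = y a i) -> forall t i, x t i = y t i.
Proof.
  intros Hx Hy Sx Sy Ha t i. destruct csolves_dependence_global as [L [HL H]].
  assert (h : near 0 (x a) (y a)) by (intros j; rewrite Ha, Rminus_eq_0, Rabs_R0; lra).
  apply (H x y a t 0 Hx Hy Sx Sy) in h. specialize (h i).
  apply Rminus_diag_uniq, Rabs_le0. lra.
Qed.

Definition symmetric (x : state) : Prop := x 1%nat = 0 /\ x 2%nat = x 3%nat.

Lemma symmetric_flip (x : state) : symmetric x -> forall i, flip x i = x i.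
Proof.
  intros [H1 H2] i. destruct i as [|[|[|[|i]]]]; simpl; try congruence; lra.
Qed.

(** A trajectory through a symmetric point coincides with its reflection, by uniqueness. *)
Lemma reverse_symmetric (x : R -> state) (c : R) :
  (forall t, csolves_at x t) -> supp4 x -> symmetric (x c) ->
  forall t i, flip (x (2 * c - t)) i = x t i.
Proof.
  intros Hx Sx Hc. apply (csolves_unique (reverse (2 * c) x) x c); auto using reverse_supp4.
  - intros t; apply reverse_csolves, Hx.
  - intros i. unfold reverse. replace (2 * c - c) with c by ring. apply symmetric_flip, Hc.
Qed.

Lemma periodic_Z (f : R -> R) (P : R) : (forall t, f (t + P) = f t) ->
  forall (n : Z) t, f (t + IZR n * P) = f t.
Proof.
  intros H.
  assert (Hn : forall (n : nat) t, f (t + INR n * P) = f t).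
  { induction n as [|n IH]; intros t.
    - f_equal; simpl; ring.
    - rewrite S_INR. replace (t + (INR n + 1) * P) with ((t + INR n * P) + P) by ring.
      rewrite H; apply IH. }
  intros n t. destruct (Z.le_ge_cases 0 n) as [Hz|Hz].
  - rewrite <- (Z2Nat.id n), <- INR_IZR_INZ by auto. apply Hn.
  - rewrite <- (Hn (Z.to_nat (- n)) (t + IZR n * P)).
    rewrite INR_IZR_INZ, Z2Nat.id by lia. rewrite opp_IZR. f_equal; ring.
Qed.

(** The composition of the reflections at a and at b is the translation by 2 (b - a).  Existence and
uniqueness are those of the clamped equation, which is reversible too; every time is moved into [a, b]
by reflections and translations, so the extension inherits the bounds of w and solves the original
system. *)
Lemma periodic_extension (w : R -> state) (a b : R) : a < b ->
  (forall t, a <= t <= b -> solves_at w t) -> (forall t, a <= t <= b -> inbox 3 (w t)) ->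
  supp4 w -> symmetric (w a) -> symmetric (w b) ->
  exists W, bounded_solution W /\ (forall t i, W (t + 2 * (b - a)) i = W t i) /\
    (forall t i, a <= t <= b -> W t i = w t i).
Proof.
  intros Hab Hw Bw Sw Ha Hb.
  destruct (csolution_exists b (w b) (Sw b)) as [W [W0 [HW SW]]].
  assert (HWw : forall t i, a <= t <= b -> W t i = w t i).
  { intros t i Ht. destruct csolves_dependence as [L [HL H]].
    assert (h : near (2 * 0 * exp (L * (b - t))) (W t) (w t)).
    { apply H; auto; try lra.
      - intros s Hs; apply csolves_of_solves; [apply Bw | apply Hw]; lra.
      - intros j; rewrite W0, Rminus_eq_0, Rabs_R0; lra. }
    specialize (h i). rewrite Rmult_0_r, Rmult_0_l in h.
    apply Rminus_diag_uniq, Rabs_le0, h. }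
  assert (SWa : symmetric (W a)).
  { unfold symmetric. rewrite !HWw by lra. exact Ha. }
  assert (SWb : symmetric (W b)).
  { unfold symmetric. rewrite !HWw by lra. exact Hb. }
  assert (Ra := reverse_symmetric W a HW SW SWa).
  assert (Rb := reverse_symmetric W b HW SW SWb).
  assert (HP : forall t i, W (t + 2 * (b - a)) i = W t i).
  { intros t i. rewrite <- Rb.
    replace (2 * b - (t + 2 * (b - a))) with (2 * a - t) by ring. apply Ra. }
  assert (Bab : forall t, a <= t <= b -> inbox 3 (W t)).
  { intros t Ht j. rewrite HWw by auto. apply Bw; auto. }
  assert (Bflip : forall x, inbox 3 x -> inbox 3 (flip x)).
  { intros x Hx j. destruct j as [|[|[|[|j]]]]; simpl; rewrite ?Rabs_Ropp; apply Hx. }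
  assert (HB : forall t, inbox 3 (W t)).
  { intros t.
    set (P := 2 * (b - a)). assert (HPp : 0 < P) by (unfold P; lra).
    set (n := Int_part ((t - a) / P)).
    destruct (base_Int_part ((t - a) / P)) as [h1 h2]. fold n in h1, h2.
    set (s := t + IZR (- n) * P).
    assert (Hs : a <= s <= a + P).
    { unfold s. rewrite opp_IZR.
      assert (E : (t - a) / P * P = t - a) by (field; lra).
      split; nra. }
    assert (Hst : forall j, W s j = W t j).
    { intros j. unfold s. apply (periodic_Z (fun t => W t j)). intros; apply HP. }
    intros j. rewrite <- Hst. destruct (Rle_dec s b) as [Hsb|Hsb].
    - apply Bab; lra.
    - rewrite <- Rb. apply Bflip, Bab. unfold P in Hs; lra. }
  exists W; split; [split; [|split]|split]; auto.
  intros t; apply solves_of_csolves; auto.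
Qed.

(** * From initial data to Holder convergence *)

(** The derivative along the flow, again a polynomial. *)
Fixpoint lie (P : poly) : poly :=
  match P with
  | Cst _ => Cst 0
  | Var i => S_field i
  | Add P Q => Add (lie P) (lie Q)
  | Mul P Q => Add (Mul (lie P) Q) (Mul P (lie Q))
  end.

Lemma eval_lie (x : state) (P : poly) :
  eval x (lie P) = differential P x (fun i => eval x (S_field i)).
Proof. induction P; simpl; auto; congruence. Qed.

Lemma is_derive_lie (x : R -> state) (P : poly) (t : R) :
  solves_at x t -> is_derive (fun s => eval (x s) P) t (eval (x t) (lie P)).
Proof. intros H. rewrite eval_lie. apply is_derive_eval, H. Qed.

Lemma Lub_Rbar_between (E : R -> Prop) (c : R) : 0 <= c ->
  (exists y, E y /\ 0 <= y) -> (forall y, E y -> y <= c) ->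
  exists N, Lub_Rbar E = Finite N /\ 0 <= N <= c.
Proof.
  intros Hc [y [Ey Hy]] Hle.
  destruct (Lub_Rbar_correct E) as [Hub Hlub].
  specialize (Hub y Ey).
  assert (Hl : Rbar_le (Lub_Rbar E) c) by (apply Hlub; intros z Hz; apply Hle, Hz).
  destruct (Lub_Rbar E) as [N| |]; simpl in *; try contradiction.
  exists N; split; [reflexivity | lra].
Qed.

(** A crude bound that serves for distances below and above 1 alike. *)
Lemma Rpower_le_1_plus (x y : R) : 0 < x -> 0 < y < 1 -> Rpower x y <= 1 + x.
Proof.
  intros Hx Hy. unfold Rpower.
  destruct (Rle_dec x 1) as [H|H].
  - assert (h : ln x <= 0).
    { rewrite <- ln_1. destruct H as [H| ->]; [apply Rlt_le, ln_increasing; lra | lra]. }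
    assert (h' : exp (y * ln x) <= exp 0) by (apply exp_mono; nra). rewrite exp_0 in h'. lra.
  - assert (h : 0 < ln x) by (rewrite <- ln_1; apply ln_increasing; lra).
    assert (h' : exp (y * ln x) <= exp (ln x)) by (apply exp_mono; nra).
    rewrite exp_ln in h'; lra.
Qed.

Lemma sup_norm_bound (r c : R) (f : R -> R) : 0 < r ->
  (forall t, Rabs t <= r -> Rabs (f t) <= c) ->
  exists N, sup_norm r f = Finite N /\ 0 <= N <= c.
Proof.
  intros Hr H.
  assert (H0 : Rabs (f 0) <= c) by (apply H; rewrite Rabs_R0; lra).
  assert (Hp := Rabs_pos (f 0)). apply Lub_Rbar_between; [lra| |].
  - exists (Rabs (f 0)); split; [|auto]. exists 0; rewrite Rabs_R0; split; [lra|auto].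
  - intros y [t [Ht ->]]; auto.
Qed.

Section Tower.

Variables (h : nat -> R -> R) (k : nat) (r c : R).
Hypothesis r_pos : 0 < r.
Hypothesis tower : forall j t, is_derive (h j) t (h (S j) t).

Lemma tower_is_derive_n (j : nat) (t : R) : is_derive_n (h 0%nat) j t (h j t).
Proof.
  revert t; induction j as [|j IH]; intros t; simpl; [reflexivity|].
  apply (is_derive_ext (h j)); [|apply tower].
  intros s; symmetry; apply is_derive_n_unique, IH.
Qed.

Lemma tower_Derive_n (j : nat) (t : R) : Derive_n (h 0%nat) j t = h j t.
Proof. apply is_derive_n_unique, tower_is_derive_n. Qed.

Hypothesis bounded : forall j t, (j <= S k)%nat -> Rabs t <= r -> Rabs (h j t) <= c.

Lemma tower_Ck_norm (j : nat) : (j <= k)%nat ->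
  exists N, Ck_norm j r (h 0%nat) = Finite N /\ 0 <= N <= (INR j + 1) * c.
Proof.
  induction j as [|j IH]; intros Hj.
  - destruct (sup_norm_bound r c (h 0%nat) r_pos) as [N [E HN]].
    { intros; apply bounded; auto; lia. }
    exists N; split; [exact E | simpl; lra].
  - destruct IH as [N [E HN]]; [lia|].
    destruct (sup_norm_bound r c (Derive_n (h 0%nat) (S j)) r_pos) as [N' [E' HN']].
    { intros t Ht. rewrite tower_Derive_n. apply bounded; auto; lia. }
    exists (N + N'); split.
    + change (Rbar_plus (Ck_norm j r (h 0%nat)) (sup_norm r (Derive_n (h 0%nat) (S j)))
        = Finite (N + N')).
      rewrite E, E'. reflexivity.
    + rewrite S_INR. lra.
Qed.

(** The Holder quotient of order alpha is at most the Lipschitz constant times |s - t|^(1 - alpha); so the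
norm of order k, alpha is controlled by the first k + 1 derivatives. *)
Lemma tower_holder_norm (alpha : R) : 0 < alpha < 1 ->
  exists N, holder_norm k alpha r (h 0%nat) = Finite N /\
    0 <= N <= (INR k + 1) * c + c * (1 + 2 * r).
Proof.
  intros Ha.
  assert (Hc : 0 <= c).
  { eapply Rle_trans; [apply Rabs_pos|]. apply (bounded O 0); [lia | rewrite Rabs_R0; lra]. }
  destruct (tower_Ck_norm k (le_n k)) as [N [E HN]].
  assert (Hl : forall s t, Rabs s <= r -> Rabs t <= r -> s < t ->
             Rabs (h k t - h k s) <= c * (t - s)).
  { intros s t Hs Ht Hst.
    replace (c * (t - s)) with (c * t - c * s) by ring.
    apply (derive_bound (h k) (fun t => c * t) (fun _ => c)); [lra| |].
    - intros z Hz. exists (h (S k) z). split; [apply tower|]. apply bounded; [lia|].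
      apply Rabs_le_between in Hs, Ht. apply Rabs_le; lra.
    - intros z _. apply is_derive_linear. }
  assert (Hl' : forall s t, Rabs s <= r -> Rabs t <= r -> s <> t ->
             Rabs (h k s - h k t) <= c * Rabs (s - t)).
  { intros s t Hs Ht Hst. destruct (Rtotal_order s t) as [H|[H|H]]; [|contradiction|].
    - rewrite Rabs_minus_sym, (Rabs_minus_sym s), (Rabs_pos_eq (t - s)) by lra. auto.
    - rewrite (Rabs_pos_eq (s - t)) by lra. auto. }
  destruct (Lub_Rbar_between (fun y => exists s t : R,
      Rabs s <= r /\ Rabs t <= r /\ s <> t /\
      y = Rabs (Derive_n (h 0%nat) k s - Derive_n (h 0%nat) k t) / Rpower (Rabs (s - t)) alpha)
    (c * (1 + 2 * r))) as [N' [E' HN']].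
  - nra.
  - eexists; split.
    + exists 0, r. rewrite Rabs_R0, (Rabs_pos_eq r) by lra.
      split; [lra|split; [lra|split; [lra|reflexivity]]].
    + apply Rle_mult_inv_pos; [apply Rabs_pos | apply exp_pos].
  - intros y [s [t [Hs [Ht [Hst ->]]]]]. rewrite !tower_Derive_n.
    assert (Hd : 0 < Rabs (s - t)) by (apply Rabs_pos_lt; lra).
    assert (Hd2 : Rabs (s - t) <= 2 * r).
    { eapply Rle_trans; [apply Rabs_triang|]. rewrite Rabs_Ropp; lra. }
    assert (HP : 0 < Rpower (Rabs (s - t)) alpha) by apply exp_pos.
    apply Rle_div_l; [exact HP|].
    eapply Rle_trans; [apply Hl'; auto|].
    assert (Es : Rabs (s - t) = Rpower (Rabs (s - t)) (1 - alpha) * Rpower (Rabs (s - t)) alpha).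
    { rewrite <- Rpower_plus. replace (1 - alpha + alpha) with 1 by ring.
      symmetry; apply Rpower_1, Hd. }
    assert (HQ : Rpower (Rabs (s - t)) (1 - alpha) <= 1 + 2 * r).
    { eapply Rle_trans; [apply Rpower_le_1_plus; lra | lra]. }
    rewrite Es at 1. rewrite Rmult_assoc. apply Rmult_le_compat_l; [exact Hc|].
    apply Rmult_le_compat_r; [lra | exact HQ].
  - exists (N + N'). split; [|lra].
    unfold holder_norm, holder_seminorm. rewrite E, E'. reflexivity.
Qed.

End Tower.

Definition lies (P : poly) (j : nat) : poly := Nat.iter j lie P.

Lemma lies_bounded (P : poly) (k : nat) :
  exists B, 0 < B /\ forall j, (j < k)%nat ->
    forall x, inbox 3 x -> Rabs (eval x (lies P j)) <= B.
Proof.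
  apply uniform_constant.
  - intros j B B' HB H x Hx. specialize (H x Hx). lra.
  - intros j. apply eval_bounded.
Qed.

Lemma lies_lipschitz (P : poly) (k : nat) :
  exists B, 0 < B /\ forall j, (j < k)%nat -> forall x y d, inbox 3 x -> inbox 3 y -> near d x y ->
    Rabs (eval x (lies P j) - eval y (lies P j)) <= B * d.
Proof.
  apply uniform_constant.
  - intros j B B' HB H x y d Hx Hy Hd. assert (h := near_ge0 _ _ _ Hd).
    specialize (H x y d Hx Hy Hd). nra.
  - intros j. apply eval_lipschitz.
Qed.

Lemma bounded_solution_C_loc (x : R -> state) (P : poly) (k : nat) (alpha : R) :
  0 < alpha < 1 -> bounded_solution x -> C_loc k alpha (fun t => eval (x t) P).
Proof.
  intros Ha [Hx [Hb _]].
  assert (tw : forall j t, is_derive (fun t => eval (x t) (lies P j)) t (eval (x t) (lies P (S j))))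
    by (intros; apply is_derive_lie, Hx).
  destruct (lies_bounded P (S (S k))) as [B [HB HBd]]. split.
  - intros j t _. destruct j as [|j]; [exact I|].
    assert (h := tower_is_derive_n (fun j t => eval (x t) (lies P j)) tw (S j) t).
    simpl in h. simpl. eexists; exact h.
  - intros r Hr.
    destruct (tower_holder_norm (fun j t => eval (x t) (lies P j)) k r B Hr tw
      (fun j t Hj _ => HBd j (le_n_S _ _ Hj) (x t) (Hb t)) alpha Ha) as [N [E _]].
    change (is_finite (holder_norm k alpha r (fun t => eval (x t) (lies P 0)))).
    rewrite E. reflexivity.
Qed.

(** The iterated derivatives of the two observables are the same polynomials evaluated along the two
trajectories, which stay close on compact intervals by continuous dependence. *)
Lemma observable_C_loc_lim (F : (R -> Prop) -> Prop) (FF : Filter F)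
    (W : R -> R -> state) (w : R -> state) (rho : R -> R) (P : poly) (k : nat) (alpha : R) :
  0 < alpha < 1 -> bounded_solution w ->
  F (fun T => bounded_solution (W T) /\ near (rho T) (W T 0) (w 0)) ->
  (forall eps, 0 < eps -> F (fun T => rho T < eps)) ->
  C_loc_lim F k alpha (fun T t => eval (W T t) P) (fun t => eval (w t) P).
Proof.
  intros Ha Hw HW Hrho. split; [|split].
  - revert HW; apply filter_imp. intros T [H _]. apply bounded_solution_C_loc; auto.
  - apply bounded_solution_C_loc; auto.
  - intros r eps Hr Heps.
    destruct csolves_dependence_global as [L [HL Hdep]].
    destruct (lies_lipschitz P (S (S k))) as [B [HB Hlip]].
    set (A := B * (2 * exp (L * r))).
    assert (HE : 0 < exp (L * r)) by apply exp_pos.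
    assert (HA : 0 <= A) by (unfold A; nra).
    set (Q := (INR k + 1) * A + A * (1 + 2 * r)).
    assert (HQ : 0 <= Q).
    { unfold Q. assert (0 <= INR k) by apply pos_INR. nra. }
    assert (Hp : 0 < eps / (Q + 1)) by (apply Rdiv_lt_0_compat; lra).
    generalize (filter_and _ _ HW (Hrho _ Hp)). apply filter_imp.
    intros T [[[HT [BT ST]] HTd] HTr]. destruct Hw as [Hw [Bw Sw]].
    assert (Hd0 := near_ge0 _ _ _ HTd).
    set (hh := fun j t => eval (W T t) (lies P j) - eval (w t) (lies P j)).
    assert (tw : forall j t, is_derive (hh j) t (hh (S j) t)).
    { intros j t. apply is_derive_sub; apply is_derive_lie; auto. }
    destruct (tower_holder_norm hh k r (A * rho T) Hr tw) with (alpha := alpha)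
      as [N [E HN]]; auto.
    + intros j t Hj Ht.
      assert (Hn : near (2 * rho T * exp (L * r)) (W T t) (w t)).
      { eapply near_le; [|apply (Hdep (W T) w 0 t (rho T))]; auto.
        - apply Rmult_le_compat_l; [lra|].
          apply exp_mono. rewrite Rminus_0_r. nra.
        - intros s; apply csolves_of_solves; auto.
        - intros s; apply csolves_of_solves; auto. }
      eapply Rle_trans; [apply (Hlip j (le_n_S _ _ Hj) _ _ _ (BT t) (Bw t) Hn)|].
      apply Req_le; unfold A; ring.
    + change (Rbar_lt (holder_norm k alpha r (hh 0%nat)) eps). rewrite E. simpl.
      apply Rle_lt_trans with (Q * rho T).
      { destruct HN as [_ HN]. eapply Rle_trans; [exact HN|]. apply Req_le; unfold Q; ring. }
      apply (Rmult_lt_compat_l (Q + 1)) in HTr; [|lra].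
      replace ((Q + 1) * (eps / (Q + 1))) with eps in HTr by (field; lra). nra.
Qed.

Lemma bounded_solution_ext (x y : R -> state) :
  (forall t i, x t i = y t i) -> bounded_solution x -> bounded_solution y.
Proof.
  intros E [Hs [Hb H4]]. split; [|split].
  - intros t i. apply (is_derive_ext (fun s => x s i)); [intros; apply E|].
    rewrite <- (eval_agree (x t) (y t)); [apply Hs | apply E].
  - intros t i. rewrite <- E. apply Hb.
  - intros t j Hj. rewrite <- E. apply H4, Hj.
Qed.

Lemma family_lim_of_initial_data (F : (R -> Prop) -> Prop) (FF : Filter F)
    (W : R -> R -> state) (w : R -> state) (rho : R -> R) (alpha beta : R) :
  0 < alpha < 1 -> 0 < beta < 1 -> bounded_solution w ->
  F (fun T => bounded_solution (W T) /\ near (rho T) (W T 0) (w 0)) ->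
  (forall eps, 0 < eps -> F (fun T => rho T < eps)) ->
  family_lim F alpha beta (fun T t => W T t 0%nat) (fun T t => W T t 1%nat)
    (fun T t => W T t 2%nat) (fun T t => W T t 3%nat)
    (fun t => w t 0%nat) (fun t => w t 1%nat) (fun t => w t 2%nat) (fun t => w t 3%nat).
Proof.
  intros Ha Hb Hw HW Hr.
  assert (L : forall i k g, 0 < g < 1 -> C_loc_lim F k g (fun T t => W T t i) (fun t => w t i))
    by (intros i k g Hg; apply (observable_C_loc_lim F FF W w rho (Var i) k g); auto).
  split; [|split; [|split]]; apply L; assumption.
Qed.

Lemma solution_of_bounded (x : R -> state) : bounded_solution x ->
  solution (fun t => x t 0%nat) (fun t => x t 1%nat) (fun t => x t 2%nat) (fun t => x t 3%nat).
Proof.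
  intros [H _] t. generalize (H t 0%nat) (H t 1%nat) (H t 2%nat) (H t 3%nat).
  unfold eval, S_field. intros H0 H1 H2 H3. split; [exact H0|]. split; [|split].
  - evar_last; [exact H1 | ring].
  - evar_last; [exact H2 | ring].
  - evar_last; [exact H3 | ring].
Qed.

(** * The homoclinic orbit in scaled coordinates *)

(** The small parameter of the scaling.  Its fourth power is exp t, and the rates 1/2 and 1 of the
origin become its second and fourth powers. *)
Definition ee (t : R) : R := exp (t / 4).

(** With r = exp t, this is (1 + r^2)^(-1/2): the homoclinic orbit is a polynomial in ee and sg, so
that identities along it reduce to algebra modulo sg^2 (1 + ee^8) = 1. *)
Definition sg (t : R) : R := / sqrt (1 + ee t ^ 8).

Lemma ee_pos (t : R) : 0 < ee t.
Proof. apply exp_pos. Qed.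

Lemma sg_pos (t : R) : 0 < sg t.
Proof.
  apply Rinv_0_lt_compat, sqrt_lt_R0. assert (h := pow_lt _ 8 (ee_pos t)). lra.
Qed.

Lemma sg_sq (t : R) : sg t ^ 2 * (1 + ee t ^ 8) = 1.
Proof.
  unfold sg. assert (h := pow_lt _ 8 (ee_pos t)).
  rewrite pow_inv, pow2_sqrt by lra. apply Rinv_l; lra.
Qed.

Lemma is_derive_ee (t : R) : is_derive ee t (ee t / 4).
Proof. unfold ee; auto_derive; [trivial | unfold Rdiv; ring]. Qed.

Lemma is_derive_sg (t : R) : is_derive sg t (- ee t ^ 8 * sg t ^ 3).
Proof.
  assert (h := pow_lt _ 8 (ee_pos t)).
  assert (D : is_derive (fun t => 1 + ee t ^ 8) t (2 * ee t ^ 8)).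
  { evar_last.
    - apply @is_derive_plus; [apply @is_derive_const|].
      apply is_derive_pow, is_derive_ee.
    - unfold plus, zero; simpl; field. }
  assert (D2 : is_derive sg t (- (2 * ee t ^ 8 / (2 * sqrt (1 + ee t ^ 8)))
    / sqrt (1 + ee t ^ 8) ^ 2)).
  { apply (is_derive_inv (fun t => sqrt (1 + ee t ^ 8))); [|apply Rgt_not_eq, sqrt_lt_R0; lra].
    apply (is_derive_sqrt (fun t => 1 + ee t ^ 8)); [exact D | lra]. }
  evar_last; [exact D2|]. unfold sg. field. apply Rgt_not_eq, sqrt_lt_R0; lra.
Qed.

Definition hom (t : R) : state :=
  quad (sqrt 3 * (ee t ^ 2 * sg t)) (sqrt 3 / 2 * (ee t ^ 2 * sg t ^ 3 * (1 - ee t ^ 8)))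
     (sqrt 3 * (ee t ^ 8 * sg t ^ 3)) (sqrt 3 * (ee t ^ 4 * sg t ^ 3)).

Lemma is_derive_monomial (m n : nat) (t : R) :
  is_derive (fun t => ee t ^ m * sg t ^ n) t
    (INR m / 4 * (ee t ^ m * sg t ^ n) - INR n * (ee t ^ 8 * sg t ^ 2) * (ee t ^ m * sg t ^ n)).
Proof.
  assert (He := ee_pos t). assert (Hs := sg_pos t).
  evar_last.
  - apply (is_derive_mul (fun t => ee t ^ m) (fun t => sg t ^ n)).
    + apply is_derive_pow, is_derive_ee.
    + apply is_derive_pow, is_derive_sg.
  - destruct m as [|m], n as [|n]; cbn [pred pow]; change (INR 0) with 0; field.
Qed.

(** The scaled variables y_0, ..., y_3 are defined by v + u/2 = e^2 y_0, b = e^4 y_1, v - u/2 = e y_2,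
a = e^3 y_3.  Then u = e (e y_0 - y_2), and this is u / e. *)
Definition Yq : poly := Add (Mul (Var 4) (Var 0)) (Mul (Cst (-1)) (Var 2)).

(** This is (a^2 + b^2) / e^6. *)
Definition Yx : poly :=
  Add (Mul (Var 3) (Var 3)) (Mul (Mul (Var 4) (Var 4)) (Mul (Var 1) (Var 1))).

Definition Ye2 : poly := Mul (Var 4) (Var 4).

(** The factor e that every nonlinear term retains after the scaling is left out here and put back in the
field.  For the growing components y_0 and y_1 the scaling exponents 2 and 4 are forced by the
rates; the exponents 1 and 3 of the decaying ones are small enough for their initial values in the
fixed plane to be O(e), and large enough for this factor e to survive in every equation. *)
Definition Ynonlin (i : nat) : poly :=
  match i with
  | 0%nat => Mul (Cst (-1)) (Mul (Mul Ye2 Ye2) (Mul Yx Yq))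
  | 1%nat => Mul (Cst (-1)) (Mul (Mul Yq Yq) (Var 3))
  | 2%nat => Mul (Cst (-1)) (Mul (Mul (Var 4) (Mul Ye2 Ye2)) (Mul Yx Yq))
  | 3%nat => Mul Ye2 (Mul (Mul Yq Yq) (Var 1))
  | _ => Cst 0
  end.

(** The decay rate of a component plus its scaling rate: 1/2 + 1/4 and 1 + 3/4. *)
Definition Yrate (i : nat) : R :=
  match i with 2%nat => 3 / 4 | 3%nat => 7 / 4 | _ => 0 end.

Definition Yfield (i : nat) : poly :=
  if Nat.ltb i 4 then Add (Mul (Cst (- Yrate i)) (Var i)) (Mul (Var 4) (Ynonlin i)) else Cst 0.

Definition yhom (t : R) : state :=
  quad (sqrt 3 * sg t ^ 3) (sqrt 3 * sg t ^ 3)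
     (- (sqrt 3 * (ee t ^ 9 * sg t ^ 3))) (sqrt 3 * (ee t ^ 5 * sg t ^ 3)).

Lemma yhom_derive (t : R) (i : nat) :
  is_derive (fun s => yhom s i) t (eval (set4 (yhom t) (ee t)) (Yfield i)).
Proof.
  assert (hc : sqrt 3 ^ 2 = 3) by (apply pow2_sqrt; lra).
  assert (hs := sg_sq t).
  assert (hw : sg t ^ 2 * ee t ^ 8 = 1 - sg t ^ 2) by lra.
  assert (D : forall c m n, is_derive (fun t => c * (ee t ^ m * sg t ^ n)) t
    (c * (INR m / 4 * (ee t ^ m * sg t ^ n)
      - INR n * (ee t ^ 8 * sg t ^ 2) * (ee t ^ m * sg t ^ n)))).
  { intros; apply (is_derive_scal (fun t => ee t ^ m * sg t ^ n)), is_derive_monomial. }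
  destruct i as [|[|[|[|i]]]]; unfold yhom, quad.
  - apply (is_derive_ext (fun t => sqrt 3 * (ee t ^ 0 * sg t ^ 3)));
      [intros; simpl; f_equal; apply Rmult_1_l|].
    eapply is_derive_R; [apply (D (sqrt 3) 0%nat 3%nat)|].
    unfold set4, yhom, quad; simpl; field [hc hw].
  - apply (is_derive_ext (fun t => sqrt 3 * (ee t ^ 0 * sg t ^ 3)));
      [intros; simpl; f_equal; apply Rmult_1_l|].
    eapply is_derive_R; [apply (D (sqrt 3) 0%nat 3%nat)|].
    unfold set4, yhom, quad; simpl; field [hc hw].
  - apply (is_derive_ext (fun t => - sqrt 3 * (ee t ^ 9 * sg t ^ 3)));
      [intros; apply Ropp_mult_distr_l_reverse|].
    eapply is_derive_R; [apply (D (- sqrt 3) 9%nat 3%nat)|].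
    unfold set4, yhom, quad; simpl; field [hc hw].
  - eapply is_derive_R; [apply (D (sqrt 3) 5%nat 3%nat)|].
    unfold set4, yhom, quad; simpl; field [hc hw].
  - apply @is_derive_const.
Qed.

Definition unscale (e : R) (y : state) : state :=
  quad (e ^ 2 * y 0%nat - e * y 2%nat) ((e ^ 2 * y 0%nat + e * y 2%nat) / 2)
     (e ^ 3 * y 3%nat) (e ^ 4 * y 1%nat).

Lemma unscale_near (e d : R) (x y : state) : 0 <= e <= 1 -> near d x y ->
  near (2 * d) (unscale e x) (unscale e y).
Proof.
  intros He Hd. assert (Hd0 := near_ge0 _ _ _ Hd).
  assert (P : forall n i, Rabs (e ^ n * (x i - y i)) <= d).
  { intros n i. assert (0 <= e ^ n <= 1) by (apply pow_unit; lra).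
    rewrite Rabs_mult, (Rabs_pos_eq (e ^ n)) by lra.
    rewrite <- (Rmult_1_l d). apply Rmult_le_compat; try lra; [apply Rabs_pos | apply Hd]. }
  intros i; destruct i as [|[|[|[|i]]]]; unfold unscale, quad.
  - replace (_ - _) with (e ^ 2 * (x 0%nat - y 0%nat) - e ^ 1 * (x 2%nat - y 2%nat)) by ring.
    eapply Rle_trans; [apply Rabs_triang|]. rewrite Rabs_Ropp.
    assert (h1 := P 2%nat 0%nat). assert (h2 := P 1%nat 2%nat). lra.
  - replace (_ - _) with ((e ^ 2 * (x 0%nat - y 0%nat) + e ^ 1 * (x 2%nat - y 2%nat)) / 2) by field.
    unfold Rdiv. rewrite Rabs_mult, (Rabs_pos_eq (/ 2)) by lra.
    assert (h := Rabs_triang (e ^ 2 * (x 0%nat - y 0%nat)) (e ^ 1 * (x 2%nat - y 2%nat))).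
    assert (h1 := P 2%nat 0%nat). assert (h2 := P 1%nat 2%nat). lra.
  - rewrite <- Rmult_minus_distr_l. assert (h1 := P 3%nat 3%nat). lra.
  - rewrite <- Rmult_minus_distr_l. assert (h1 := P 4%nat 1%nat). lra.
  - rewrite Rminus_0_r, Rabs_R0. lra.
Qed.

Lemma unscale_yhom (t : R) (i : nat) : unscale (ee t) (yhom t) i = hom t i.
Proof.
  assert (hs := sg_sq t).
  assert (hw : sg t ^ 2 * ee t ^ 8 = 1 - sg t ^ 2) by lra.
  destruct i as [|[|[|[|i]]]]; unfold unscale, yhom, hom, quad; field [hw].
Qed.

(** The scaled field was obtained from this change of variables; what is left to check is an identity between
polynomials. *)
Lemma unscale_solves (y : R -> state) (t : R) :
  (forall i, is_derive (fun s => y s i) t (eval (set4 (y t) (ee t)) (Yfield i))) ->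
  solves_at (fun t => unscale (ee t) (y t)) t.
Proof.
  intros Hy.
  assert (M : forall n i, is_derive (fun s => ee s ^ n * y s i) t
    (INR n / 4 * ee t ^ n * y t i + ee t ^ n * eval (set4 (y t) (ee t)) (Yfield i))).
  { intros n i. eapply is_derive_R.
    - apply (is_derive_mul (fun s => ee s ^ n) (fun s => y s i)); [|apply Hy].
      apply is_derive_pow, is_derive_ee.
    - simpl. destruct n as [|n]; cbn [pred pow]; change (INR 0) with 0; field. }
  assert (X : forall (f g : R -> R) d d', (forall s, f s = g s) -> is_derive f t d -> d = d' ->
    is_derive g t d') by (intros f g d d' Hfg Hf <-; apply (is_derive_ext f); auto).
  intros i; destruct i as [|[|[|[|i]]]]; unfold unscale.
  - eapply (X (fun s => ee s ^ 2 * y s 0%nat - ee s ^ 1 * y s 2%nat)); [intros; simpl; ring| |].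
    + apply is_derive_sub; apply M.
    + unfold set4. simpl. field.
  - eapply (X (fun s => / 2 * (ee s ^ 2 * y s 0%nat + ee s ^ 1 * y s 2%nat)));
      [intros; simpl; field| |].
    + apply (is_derive_scal (fun s => ee s ^ 2 * y s 0%nat + ee s ^ 1 * y s 2%nat)).
      apply (@is_derive_plus R_AbsRing R_NormedModule); apply M.
    + change plus with Rplus. unfold set4. simpl. field.
  - eapply is_derive_R; [apply M|]. unfold set4. simpl. field.
  - eapply is_derive_R; [apply M|]. unfold set4. simpl. field.
  - exact (is_derive_const (V := R_NormedModule) 0 t).
Qed.

Lemma hom_solves (t : R) : solves_at hom t.
Proof.
  intros i. apply (is_derive_ext (fun s => unscale (ee s) (yhom s) i));
    [intros; apply unscale_yhom|].
  rewrite <- (eval_agree (unscale (ee t) (yhom t)) (hom t)) by apply unscale_yhom.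
  apply unscale_solves. intros j. apply yhom_derive.
Qed.

Lemma ee_neg (t : R) : ee (- t) = / ee t.
Proof. unfold ee. rewrite <- exp_Ropp. f_equal. field. Qed.

Lemma sg_neg (t : R) : sg (- t) = ee t ^ 4 * sg t.
Proof.
  assert (he := ee_pos t). assert (hs := sg_pos t). assert (hs' := sg_pos (- t)).
  assert (h1 := sg_sq t). assert (h2 := sg_sq (- t)). rewrite ee_neg in h2.
  apply Rsqr_inj; [lra | apply Rmult_le_pos; [apply pow_le|]; lra|].
  unfold Rsqr. assert (h8 : 0 < ee t ^ 8) by (apply pow_lt; lra).
  apply (Rmult_eq_reg_r (1 + (/ ee t) ^ 8)).
  2:{ assert (0 < (/ ee t) ^ 8) by (apply pow_lt, Rinv_0_lt_compat; lra). lra. }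
  transitivity (sg (- t) ^ 2 * (1 + (/ ee t) ^ 8)); [ring|].
  rewrite h2. transitivity (sg t ^ 2 * (1 + ee t ^ 8)); [lra|]. field. lra.
Qed.

Lemma hom_neg (t : R) (i : nat) : hom (- t) i = flip (hom t) i.
Proof.
  assert (he := ee_pos t). unfold hom.
  destruct i as [|[|[|[|i]]]]; simpl; rewrite ?sg_neg, ?ee_neg; field; lra.
Qed.

Lemma cosh_ee (t : R) : 2 * cosh t * ee t ^ 4 = 1 + ee t ^ 8.
Proof.
  assert (he := ee_pos t).
  assert (E : exp t = ee t ^ 4).
  { unfold ee. simpl. rewrite Rmult_1_r, <- !exp_plus. f_equal; field. }
  unfold cosh. rewrite exp_Ropp, E. field. lra.
Qed.

(** Both sides are positive and have the same square, 1 / cosh t. *)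
Lemma Rpower_cosh (t : R) : Rpower (cosh t) (- (1 / 2)) = sqrt 2 * (ee t ^ 2 * sg t).
Proof.
  assert (he := ee_pos t). assert (hs := sg_pos t).
  assert (hc : 0 < cosh t) by (assert (h := cosh_ge1 t); lra).
  assert (h2 : 0 < sqrt 2) by (apply sqrt_lt_R0; lra).
  apply Rsqr_inj.
  - apply Rlt_le, exp_pos.
  - apply Rmult_le_pos; [lra|]. apply Rmult_le_pos; [apply pow_le|]; lra.
  - unfold Rsqr. rewrite <- Rpower_plus.
    replace (- (1 / 2) + - (1 / 2)) with (- (1)) by field.
    rewrite Rpower_Ropp, Rpower_1 by auto.
    apply (Rmult_eq_reg_r (cosh t)); [|lra]. rewrite Rinv_l by lra.
    replace (sqrt 2 * (ee t ^ 2 * sg t) * (sqrt 2 * (ee t ^ 2 * sg t)) * cosh t) with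
      (sqrt 2 * sqrt 2 / 2 * (sg t ^ 2 * (2 * cosh t * ee t ^ 4))) by field.
    rewrite cosh_ee, sg_sq, sqrt_def by lra. field.
Qed.

Lemma Rpower_cosh3 (t : R) :
  Rpower (cosh t) (- (3 / 2)) = 2 * sqrt 2 * (ee t ^ 6 * sg t ^ 3).
Proof.
  replace (- (3 / 2)) with (- (1 / 2) + - (1 / 2) + - (1 / 2)) by field.
  rewrite !Rpower_plus, Rpower_cosh.
  replace (_ * _ * _) with (sqrt 2 * sqrt 2 * sqrt 2 * (ee t ^ 6 * sg t ^ 3)) by ring.
  rewrite sqrt_def by lra. ring.
Qed.

Lemma u0_hom (t : R) : u0 t = hom t 0%nat.
Proof.
  unfold u0, hom, quad. rewrite Rpower_cosh.
  rewrite <- Rmult_assoc, <- sqrt_mult by lra. f_equal. f_equal. field.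
Qed.

Lemma ee_sq (t : R) : exp (t / 2) = ee t ^ 2.
Proof. unfold ee. simpl. rewrite Rmult_1_r, <- exp_plus. f_equal; field. Qed.

Lemma a0_hom (t : R) : a0 t = hom t 2%nat.
Proof.
  assert (h2 : 0 < sqrt 2) by (apply sqrt_lt_R0; lra).
  unfold a0, hom, quad. rewrite Rpower_cosh3, ee_sq. field. lra.
Qed.

Lemma b0_hom (t : R) : b0 t = hom t 3%nat.
Proof.
  assert (h2 : 0 < sqrt 2) by (apply sqrt_lt_R0; lra). assert (he := ee_pos t).
  unfold b0, hom, quad. rewrite exp_Ropp, Rpower_cosh3, ee_sq. field. lra.
Qed.

Lemma Derive_u0_hom (t : R) : Derive u0 t = hom t 1%nat.
Proof.
  apply is_derive_unique. apply (is_derive_ext (fun s => hom s 0%nat)).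
  - intros; symmetry; apply u0_hom.
  - apply (hom_solves t 0%nat).
Qed.

Lemma sqrt3_bound : 1 < sqrt 3 < 2.
Proof.
  assert (h0 := sqrt_pos 3). assert (h : sqrt 3 * sqrt 3 = 3) by (apply sqrt_def; lra).
  split; nra.
Qed.

Lemma sg_le1 (t : R) : sg t <= 1.
Proof.
  assert (hs := sg_pos t). assert (h := sg_sq t). assert (h8 := pow_lt _ 8 (ee_pos t)). nra.
Qed.

Lemma ee_le1 (t : R) : t <= 0 -> ee t <= 1.
Proof.
  intros H. unfold ee. rewrite <- exp_0. apply exp_mono. lra.
Qed.

(** Every component carries at least a factor ee^2; a single one is enough below. *)
Lemma hom_small (t : R) (i : nat) : t <= 0 -> Rabs (hom t i) <= 2 * ee t.
Proof.
  intros Ht. assert (he := ee_pos t). assert (he1 := ee_le1 t Ht).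
  assert (hs := sg_pos t). assert (hs1 := sg_le1 t). assert (h3 := sqrt3_bound).
  assert (P : forall m n, 0 <= ee t ^ S m * sg t ^ n <= ee t).
  { intros m n. simpl.
    assert (h := pow_unit (ee t) m). assert (h' := pow_unit (sg t) n).
    rewrite Rmult_assoc. split; [apply Rmult_le_pos; [lra | apply Rmult_le_pos; lra]|].
    rewrite <- (Rmult_1_r (ee t)) at 3. apply Rmult_le_compat_l; [lra|].
    rewrite <- (Rmult_1_r 1). apply Rmult_le_compat; lra. }
  assert (Hmul : forall X E, 0 <= X <= E -> sqrt 3 * X <= 2 * E) by (intros; nra).
  destruct i as [|[|[|[|i]]]]; unfold hom, quad.
  - rewrite Rabs_mult, (Rabs_pos_eq (sqrt 3)) by lra.
    specialize (P 1%nat 1%nat). rewrite pow_1 in P. rewrite Rabs_pos_eq by lra. apply Hmul; lra.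
  - rewrite Rabs_mult, (Rabs_pos_eq (sqrt 3 / 2)) by lra.
    assert (h1 := P 1%nat 3%nat).
    assert (h2 : 0 < ee t ^ 8 <= 1).
    { split; [apply pow_lt; lra | apply pow_unit; lra]. }
    rewrite Rabs_pos_eq by (apply Rmult_le_pos; lra).
    set (X := ee t ^ 2 * sg t ^ 3) in *. set (y := ee t ^ 8) in *.
    assert (hXy : 0 <= X * y) by (apply Rmult_le_pos; lra).
    assert (hX : 0 <= X * (1 - y)) by (apply Rmult_le_pos; lra).
    assert (sqrt 3 / 2 * (X * (1 - y)) <= 1 * (X * (1 - y)))
      by (apply Rmult_le_compat_r; lra).
    lra.
  - rewrite Rabs_mult, (Rabs_pos_eq (sqrt 3)) by lra.
    specialize (P 7%nat 3%nat). rewrite Rabs_pos_eq by lra. apply Hmul; lra.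
  - rewrite Rabs_mult, (Rabs_pos_eq (sqrt 3)) by lra.
    specialize (P 3%nat 3%nat). rewrite Rabs_pos_eq by lra. apply Hmul; lra.
  - rewrite Rabs_R0. lra.
Qed.

Lemma hom_decay (t : R) (i : nat) : Rabs (hom t i) <= 2 * exp (- (Rabs t / 4)).
Proof.
  assert (Hneg : forall t i, t <= 0 -> Rabs (hom t i) <= 2 * exp (- (Rabs t / 4))).
  { intros s j Hs. rewrite (Rabs_left1 s) by lra.
    replace (- (- s / 4)) with (s / 4) by field. apply hom_small, Hs. }
  destruct (Rle_dec t 0) as [H|H]; [auto|].
  assert (E : forall j, Rabs (hom t j) = Rabs (flip (hom (- t)) j)).
  { intros j. rewrite <- hom_neg, Ropp_involutive. reflexivity. }
  assert (F : forall j, Rabs (hom (- t) j) <= 2 * exp (- (Rabs t / 4)))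
    by (intros j; rewrite <- (Rabs_Ropp t); apply Hneg; lra).
  rewrite E. destruct i as [|[|[|[|i]]]]; cbn [flip]; rewrite ?Rabs_Ropp; apply F.
Qed.

Lemma hom_bounded_solution : bounded_solution hom.
Proof.
  split; [apply hom_solves|split].
  - intros t i. eapply Rle_trans; [apply hom_decay|].
    assert (h : exp (- (Rabs t / 4)) <= exp 0) by (apply exp_mono; assert (h := Rabs_pos t); lra).
    rewrite exp_0 in h. lra.
  - intros t j Hj. destruct j as [|[|[|[|j]]]]; try lia. reflexivity.
Qed.

Lemma hom_lim (i : nat) (e : Rbar) : e = m_infty \/ e = p_infty ->
  is_lim (fun t => hom t i) e 0.
Proof.
  intros He.
  assert (Habs : is_lim (fun t => - (Rabs t / 4)) e m_infty).
  { destruct He as [-> | ->].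
    - apply is_lim_ext_loc with (fun t => / 4 * t).
      + exists 0. intros t Ht. rewrite Rabs_left by lra. field.
      + evar_last; [apply is_lim_scal_l, is_lim_id|].
        simpl. destruct Rle_dec; [|lra]. destruct Rle_lt_or_eq_dec; [reflexivity|lra].
    - apply is_lim_ext_loc with (fun t => - / 4 * t).
      + exists 0. intros t Ht. rewrite Rabs_pos_eq by lra. field.
      + evar_last; [apply is_lim_scal_l, is_lim_id|].
        simpl. destruct Rle_dec as [h|h]; [exfalso|reflexivity].
        assert (h4 : 0 < / 4) by lra. apply (Rlt_not_le _ _ h4), Ropp_le_cancel.
        rewrite Ropp_0. exact h. }
  assert (Hexp : is_lim (fun t => 2 * exp (- (Rabs t / 4))) e 0).
  { evar_last.
    - apply is_lim_scal_l. apply (is_lim_comp exp (fun t => - (Rabs t / 4)) e 0 m_infty).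
      + apply is_lim_exp_m.
      + exact Habs.
      + destruct He as [-> | ->]; exists 0; intros; discriminate.
    - simpl. f_equal; ring. }
  apply (is_lim_le_le_loc (fun t => - (2 * exp (- (Rabs t / 4)))) (fun t => 2 * exp (- (Rabs t / 4)))).
  - destruct He as [-> | ->]; exists 0; intros t _; apply Rabs_le_between, hom_decay.
  - evar_last; [apply is_lim_opp, Hexp|]. simpl. f_equal; ring.
  - exact Hexp.
Qed.

Lemma profile_hom (t : R) (i : nat) : quad (u0 t) (Derive u0 t) (a0 t) (b0 t) i = hom t i.
Proof.
  rewrite u0_hom, Derive_u0_hom, a0_hom, b0_hom. destruct i as [|[|[|[|i]]]]; reflexivity.
Qed.

Lemma homoclinic_profile : homoclinic u0 (Derive u0) a0 b0.
Proof.
  assert (E := fun t i => eq_sym (profile_hom t i)).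
  assert (L : forall e, e = m_infty \/ e = p_infty -> tends_to_origin u0 (Derive u0) a0 b0 e).
  { intros e He. split; [|split; [|split]].
    - exact (is_lim_ext _ _ _ _ (fun t => E t 0%nat) (hom_lim 0 e He)).
    - exact (is_lim_ext _ _ _ _ (fun t => E t 1%nat) (hom_lim 1 e He)).
    - exact (is_lim_ext _ _ _ _ (fun t => E t 2%nat) (hom_lim 2 e He)).
    - exact (is_lim_ext _ _ _ _ (fun t => E t 3%nat) (hom_lim 3 e He)). }
  split; [|split; [|split]]; auto.
  - apply (solution_of_bounded (fun t => quad (u0 t) (Derive u0 t) (a0 t) (b0 t))).
    exact (bounded_solution_ext _ _ E hom_bounded_solution).
  - intros H. destruct (H 0) as [H0 _]. unfold u0 in H0.
    assert (0 < sqrt (3 / 2)) by (apply sqrt_lt_R0; lra).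
    assert (0 < Rpower (cosh 0) (- (1 / 2))) by apply exp_pos. nra.
Qed.

(** * Adjoint modes along the homoclinic orbit *)

Definition dot4 (x y : state) : R :=
  x 0%nat * y 0%nat + x 1%nat * y 1%nat + x 2%nat * y 2%nat + x 3%nat * y 3%nat.

(** The pairing with the variational solution of the system given by u = u0 f with f = F / sin psi, in
scaled coordinates and up to a constant; F and D stand for F(psi) and its derivative, e and g for
ee and sg.  With the increment of (a^2 + b^2) / 2 written
G / cosh^2, the linearization along the orbit reads L f = - 2 G, L G = - (9/2) f, where L is the
radial Laplacian of the three-sphere; so f and G = (3/2) s f are eigenfunctions of L of eigenvalue -3 s
with s = 1 or s = -1, which means F'' = - (1 + 3 s) F. *)
Definition adjoint (s F D e g : R) : state :=
  quad (g * (- F + 2 * e ^ 4 * D))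
     (- s * (g * (F * (1 + 3 * e ^ 8) / 2 - e ^ 4 * D)))
     (- (e ^ 3 * g * (e ^ 4 * F + 2 * D)))
     (s * (e ^ 3 * g * (F * (3 + e ^ 8) / 2 + e ^ 4 * D))).

(** The vector [adjoint] solves the adjoint of the linearized scaled equation; the identity is tested against an
arbitrary increment d, which avoids writing the transposed matrix. *)
Lemma adjoint_derive (s : R) (fF fD : R -> R) (t : R) (d : state) : s ^ 2 = 1 ->
  is_derive fF t (2 * (ee t ^ 4 * sg t ^ 2) * fD t) ->
  is_derive fD t ((- 1 - 3 * s) * (2 * (ee t ^ 4 * sg t ^ 2)) * fF t) ->
  exists dx : state,
    (forall i, is_derive (fun t => adjoint s (fF t) (fD t) (ee t) (sg t) i) t (dx i)) /\
    dot4 dx d = dot4 (adjoint s (fF t) (fD t) (ee t) (sg t)) (fun i =>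
      Yrate i * d i - ee t * differential (Ynonlin i) (set4 (yhom t) (ee t)) (set4 d 0)).
Proof.
  intros h1 HF HD.
  assert (hc : sqrt 3 ^ 2 = 3) by (apply pow2_sqrt; lra).
  assert (hs := sg_sq t).
  assert (hw : sg t ^ 2 * ee t ^ 8 = 1 - sg t ^ 2) by lra.
  assert (He := is_derive_ee t). assert (Hg := is_derive_sg t).
  set (e := ee t) in *. set (g := sg t) in *. set (c := sqrt 3) in *.
  set (dF := 2 * (e ^ 4 * g ^ 2) * fD t) in *.
  set (dD := (-1 - 3 * s) * (2 * (e ^ 4 * g ^ 2)) * fF t) in *.
  set (dg := - e ^ 8 * g ^ 3) in *.
  exists (quad
    (dg * (- fF t + 2 * e ^ 4 * fD t) + g * (- dF + 2 * (e ^ 4 * fD t + e ^ 4 * dD)))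
    (- s * (dg * (fF t * (1 + 3 * e ^ 8) / 2 - e ^ 4 * fD t)
      + g * (dF * (1 + 3 * e ^ 8) / 2 + fF t * (6 * e ^ 8) / 2 - e ^ 4 * fD t - e ^ 4 * dD)))
    (- (3 / 4 * e ^ 3 * g * (e ^ 4 * fF t + 2 * fD t) + e ^ 3 * dg * (e ^ 4 * fF t + 2 * fD t)
      + e ^ 3 * g * (e ^ 4 * fF t + e ^ 4 * dF + 2 * dD)))
    (s * (3 / 4 * e ^ 3 * g * (fF t * (3 + e ^ 8) / 2 + e ^ 4 * fD t)
      + e ^ 3 * dg * (fF t * (3 + e ^ 8) / 2 + e ^ 4 * fD t)
      + e ^ 3 * g * (dF * (3 + e ^ 8) / 2 + fF t * (2 * e ^ 8) / 2
          + e ^ 4 * fD t + e ^ 4 * dD)))).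
  split.
  - assert (EF : Derive fF t = dF) by (apply is_derive_unique, HF).
    assert (ED : Derive fD t = dD) by (apply is_derive_unique, HD).
    assert (Ee : Derive ee t = e / 4) by (apply is_derive_unique, He).
    assert (Eg : Derive sg t = dg) by (apply is_derive_unique, Hg).
    assert (XF : ex_derive fF t) by (eexists; exact HF).
    assert (XD : ex_derive fD t) by (eexists; exact HD).
    assert (Xe : ex_derive ee t) by (eexists; exact He).
    assert (Xg : ex_derive sg t) by (eexists; exact Hg).
    intros i; destruct i as [|[|[|[|i]]]]; unfold adjoint, quad; [| | | |apply @is_derive_const];
      (auto_derive; [repeat split; assumption|
       change (Derive (fun x => fF x) t) with (Derive fF t);
       change (Derive (fun x => fD x) t) with (Derive fD t);
       change (Derive (fun x => ee x) t) with (Derive ee t);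
       change (Derive (fun x => sg x) t) with (Derive sg t);
       rewrite ?EF, ?ED, ?Ee, ?Eg; fold e; fold g; field]).
  - unfold dot4, adjoint, set4, yhom, quad; simpl. fold e g c. unfold dF, dD, dg.
    (* both sides are polynomials in the quantities named above, to be compared modulo the relations hc, hw, h1 *)
    field [hc hw h1].
Qed.

(** The angle on the three-sphere from which the conformal factor 1 / cosh t arises: its sine is 1 / cosh t. *)
Definition psi (t : R) : R := 2 * atan (ee t ^ 4).

Lemma is_derive_psi (t : R) : is_derive psi t (2 * (ee t ^ 4 * sg t ^ 2)).
Proof.
  assert (he := ee_pos t). assert (hs := sg_sq t). assert (hg := sg_pos t).
  assert (E : sg t ^ 2 = / (1 + ee t ^ 8)).
  { assert (h8 := pow_lt _ 8 he). apply (Rmult_eq_reg_r (1 + ee t ^ 8)); [|lra].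
    rewrite hs, Rinv_l; lra. }
  assert (D4 : is_derive (fun t => ee t ^ 4) t (ee t ^ 4)).
  { eapply is_derive_R; [apply is_derive_pow, is_derive_ee|]. simpl; field. }
  assert (Da : forall x, is_derive atan x (/ (1 + x ^ 2))).
  { intros x. apply is_derive_Reals, derivable_pt_lim_atan. }
  eapply is_derive_R.
  - apply (is_derive_scal (fun t => atan (ee t ^ 4))).
    apply (is_derive_comp atan (fun t => ee t ^ 4)); [apply Da | apply D4].
  - rewrite E. transitivity (2 * (ee t ^ 4 * / (1 + (ee t ^ 4) ^ 2))); [reflexivity|].
    do 3 f_equal. ring.
Qed.

Lemma atan_le (x : R) : 0 <= x -> 0 <= atan x <= x.
Proof.
  intros Hx. split.
  - rewrite <- atan_0. destruct (Req_dec x 0) as [->|]; [lra|].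
    apply Rlt_le, atan_increasing; lra.
  - assert (h := derive_le_decreasing (fun x => atan x - x) (fun x => / (1 + x ^ 2) - 1) 0 x Hx).
    cbv beta in h. rewrite atan_0 in h.
    assert (atan x - x <= 0 - 0); [|lra]. apply h.
    + intros t _. apply is_derive_sub; [|apply @is_derive_id].
      apply is_derive_Reals, derivable_pt_lim_atan.
    + intros t _. assert (hq := pow2_ge_0 t).
      assert (/ (1 + t ^ 2) <= / 1) by (apply Rinv_le_contravar; lra).
      rewrite Rinv_1 in *. lra.
Qed.

Lemma psi_bounds (t : R) : t <= 0 -> 0 <= psi t <= PI / 2 /\ psi t <= 2 * ee t ^ 4.
Proof.
  intros Ht. assert (he := ee_pos t). assert (he1 := ee_le1 t Ht).
  assert (h4 : 0 <= ee t ^ 4 <= 1) by (apply pow_unit; lra).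
  unfold psi. assert (h := atan_le _ (proj1 h4)). split; [|lra]. split; [lra|].
  assert (atan (ee t ^ 4) <= PI / 4); [|lra]. rewrite <- atan_1.
  destruct (Req_dec (ee t ^ 4) 1) as [->|]; [lra|]. apply Rlt_le, atan_increasing; lra.
Qed.

Lemma ee_0 : ee 0 = 1.
Proof. unfold ee. replace (0 / 4) with 0 by field. apply exp_0. Qed.

Lemma psi_0 : psi 0 = PI / 2.
Proof. unfold psi. rewrite ee_0, pow1, atan_1. field. Qed.

(** The value at pi/2 of the derivative vanishes for the symmetric modes, for which the pairing at time 0
sees only the two defects of symmetry v and a - b; the non-vanishing value at 0 makes the pairing detect the
growing components at time - oo. *)
Definition mode (s : R) (Phi dPhi : R -> R) : Prop :=
  s ^ 2 = 1 /\
  (forall x, is_derive Phi x (dPhi x)) /\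
  (forall x, is_derive dPhi x ((- 1 - 3 * s) * Phi x)) /\
  Phi 0 = 1 /\ Phi (PI / 2) <> 0 /\ dPhi (PI / 2) = 0 /\
  (forall x, 0 <= x <= PI / 2 -> Rabs (Phi x) <= 1 /\ Rabs (dPhi x) <= 2).

Lemma mode_cos : mode 1 (fun x => cos (2 * x)) (fun x => - 2 * sin (2 * x)).
Proof.
  assert (hp : 2 * (PI / 2) = PI) by field.
  split; [ring|]. split; [|split; [|split; [|split; [|split]]]].
  - intros x. auto_derive; [trivial | ring].
  - intros x. auto_derive; [trivial | ring].
  - rewrite Rmult_0_r. apply cos_0.
  - rewrite hp, cos_PI. lra.
  - rewrite hp, sin_PI. ring.
  - intros x _. split.
    + apply Rabs_le, COS_bound.
    + rewrite Rabs_mult, (Rabs_left (- 2)) by lra.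
      assert (Rabs (sin (2 * x)) <= 1) by apply Rabs_le, SIN_bound. lra.
Qed.

Lemma mode_cosh : mode (- 1)
  (fun x => cosh (sqrt 2 * (x - PI / 2)) / cosh (sqrt 2 * (PI / 2)))
  (fun x => sqrt 2 * sinh (sqrt 2 * (x - PI / 2)) / cosh (sqrt 2 * (PI / 2))).
Proof.
  assert (h2 : sqrt 2 * sqrt 2 = 2) by (apply sqrt_def; lra).
  assert (h20 : 0 < sqrt 2 < 2) by (assert (h := sqrt_lt_R0 2 ltac:(lra)); split; nra).
  assert (hpi := PI_RGT_0).
  set (C := cosh (sqrt 2 * (PI / 2))).
  assert (hC : 1 <= C) by apply cosh_ge1.
  assert (hneg : forall y, cosh (- y) = cosh y).
  { intros y. unfold cosh. rewrite Ropp_involutive. f_equal; ring. }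
  assert (Dc := is_derive_cosh_shift (sqrt 2) (PI / 2)).
  assert (Ds := is_derive_sinh_shift (sqrt 2) (PI / 2)).
  split; [ring|]. split; [|split; [|split; [|split; [|split]]]].
  - intros x. eapply is_derive_R.
    + apply (is_derive_ext (fun x => / C * cosh (sqrt 2 * (x - PI / 2)))).
      * intros; apply Rmult_comm.
      * apply (is_derive_scal (fun x => cosh (sqrt 2 * (x - PI / 2)))), Dc.
    + field. lra.
  - intros x. eapply is_derive_R.
    + apply (is_derive_ext (fun x => (sqrt 2 * / C) * sinh (sqrt 2 * (x - PI / 2)))).
      * intros y. unfold Rdiv. rewrite !Rmult_assoc. f_equal. apply Rmult_comm.
      * apply (is_derive_scal (fun x => sinh (sqrt 2 * (x - PI / 2)))), Ds.
    + transitivity (sqrt 2 * sqrt 2 / C * cosh (sqrt 2 * (x - PI / 2))); [field; lra|].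
      rewrite h2. field. lra.
  - replace (sqrt 2 * (0 - PI / 2)) with (- (sqrt 2 * (PI / 2))) by ring.
    rewrite hneg. unfold C. apply Rinv_r. fold C. lra.
  - replace (sqrt 2 * (PI / 2 - PI / 2)) with 0 by ring. rewrite cosh_0.
    apply Rgt_not_eq, Rdiv_lt_0_compat; lra.
  - replace (sqrt 2 * (PI / 2 - PI / 2)) with 0 by ring. rewrite sinh_0. field. lra.
  - intros x Hx.
    assert (hc : cosh (sqrt 2 * (x - PI / 2)) <= C).
    { rewrite <- hneg. apply cosh_mono. split; nra. }
    assert (hc1 := cosh_ge1 (sqrt 2 * (x - PI / 2))).
    assert (hs := Rabs_sinh_le (sqrt 2 * (x - PI / 2))).
    split.
    + rewrite Rabs_pos_eq by (apply Rdiv_le_0_compat; lra).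
      apply Rle_div_l; lra.
    + unfold Rdiv. rewrite Rabs_mult, (Rabs_pos_eq (/ C))
        by (apply Rlt_le, Rinv_0_lt_compat; lra).
      apply Rle_div_l; [lra|]. rewrite Rabs_mult, (Rabs_pos_eq (sqrt 2)) by lra.
      nra.
Qed.

Section Mode.

Variables (s : R) (Phi dPhi : R -> R).
Hypothesis is_mode : mode s Phi dPhi.

Definition mode_adjoint (t : R) : state := adjoint s (Phi (psi t)) (dPhi (psi t)) (ee t) (sg t).

Lemma mode_adjoint_derive (t : R) (d : state) : exists dx : state,
  (forall i, is_derive (fun t => mode_adjoint t i) t (dx i)) /\
  dot4 dx d = dot4 (mode_adjoint t) (fun i =>
      Yrate i * d i - ee t * differential (Ynonlin i) (set4 (yhom t) (ee t)) (set4 d 0)).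
Proof.
  destruct is_mode as [h1 [HF [HD _]]].
  apply (adjoint_derive s (fun t => Phi (psi t)) (fun t => dPhi (psi t)) t d h1).
  - apply (is_derive_comp Phi psi); [apply HF | apply is_derive_psi].
  - eapply is_derive_R.
    + apply (is_derive_comp dPhi psi); [apply HD | apply is_derive_psi].
    + unfold scal; simpl; unfold mult; simpl. ring.
Qed.

(** As t tends to - oo the adjoint vectors converge to linear forms that involve the two growing
components only, and are independent for s = 1 and s = -1. *)
Lemma mode_adjoint_limit (t : R) : t <= 0 -> near (9 * ee t) (mode_adjoint t) (quad (- 1) (- s / 2) 0 0).
Proof.
  intros Ht. destruct is_mode as [h1 [HF [HD [H0 [_ [_ Hb]]]]]].
  destruct (psi_bounds t Ht) as [hp hp4]. destruct (Hb _ hp) as [bF bD].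
  assert (he := ee_pos t). assert (he1 := ee_le1 t Ht).
  assert (hg := sg_pos t). assert (hg1 := sg_le1 t).
  assert (hsq := sg_sq t).
  assert (bF1 : Rabs (Phi (psi t) - 1) <= 4 * ee t ^ 4).
  { rewrite <- H0 at 1. eapply Rle_trans.
    - apply (derive_bound Phi (fun x => 2 * x) (fun _ => 2) 0 (psi t)); [lra| |].
      + intros x Hx. exists (dPhi x). split; [apply HF | apply Hb; lra].
      + intros x _. apply is_derive_linear.
    - lra. }
  assert (bs : Rabs s <= 1).
  { apply Rabs_le. split; nra. }
  set (F := Phi (psi t)) in *. set (D := dPhi (psi t)) in *.
  set (e := ee t) in *. set (g := sg t) in *.
  assert (p8 : e ^ 8 = e ^ 4 * e ^ 4) by ring.
  assert (p4 : e ^ 4 = e * e ^ 3) by ring. assert (p3 : e ^ 3 = e * e ^ 2) by ring.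
  assert (h2 : 0 <= e ^ 2 <= 1) by (split; nra).
  assert (h3 : 0 <= e ^ 3 <= e) by (rewrite p3; split; nra).
  assert (h4 : 0 <= e ^ 4 <= e) by (rewrite p4; split; nra).
  assert (h41 : e ^ 4 <= 1) by lra.
  assert (h8 : 0 <= e ^ 8 <= e ^ 4) by (rewrite p8; split; nra).
  assert (hg2 : 1 - e ^ 4 <= g).
  { assert (g ^ 2 <= g) by nra. assert (1 - e ^ 8 <= g ^ 2) by nra. lra. }
  apply Rabs_le_between in bF, bD, bF1, bs.
  assert (hgF : -(5 * e ^ 4) <= g * F - 1 <= 5 * e ^ 4) by (split; nra).
  assert (hgD : - 2 <= g * D <= 2) by (split; nra).
  assert (hgD4 : - (2 * e ^ 4) <= e ^ 4 * (g * D) <= 2 * e ^ 4) by (split; nra).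
  assert (hgF1 : - 1 <= g * F <= 1) by (split; nra).
  assert (hs : s = 1 \/ s = - 1).
  { assert ((s - 1) * (s + 1) = 0) by lra.
    apply Rmult_integral in H. destruct H; [left|right]; lra. }
  assert (h8gF : - e ^ 8 <= e ^ 8 * (g * F) <= e ^ 8) by (split; nra).
  intros i. destruct i as [|[|[|[|i]]]]; unfold mode_adjoint, adjoint, quad; fold F D e g.
  - replace (_ - _) with (- (g * F - 1) + 2 * (e ^ 4 * (g * D))) by ring.
    apply Rabs_le; lra.
  - replace (_ - _) with (- s * ((g * F - 1) / 2 + 3 / 2 * (e ^ 8 * (g * F)) - e ^ 4 * (g * D)))
      by field.
    destruct hs as [-> | ->]; apply Rabs_le; lra.
  - replace (_ - _) with (e ^ 3 * (- (e ^ 4 * (g * F)) - 2 * (g * D))) by ring.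
    assert (-5 <= - (e ^ 4 * (g * F)) - 2 * (g * D) <= 5) by (split; nra).
    apply Rabs_le; split; nra.
  - replace (_ - _) with (s * (e ^ 3 * (3 / 2 * (g * F) + e ^ 8 * (g * F) / 2 + e ^ 4 * (g * D))))
      by field.
    assert (-5 <= 3 / 2 * (g * F) + e ^ 8 * (g * F) / 2 + e ^ 4 * (g * D) <= 5) by (split; nra).
    destruct hs as [-> | ->]; apply Rabs_le; split; nra.
  - rewrite Rminus_eq_0, Rabs_R0. lra.
Qed.

Lemma mode_adjoint_bounded (t : R) (i : nat) : t <= 0 -> Rabs (mode_adjoint t i) <= 10.
Proof.
  intros Ht. assert (h := mode_adjoint_limit t Ht i). assert (he1 := ee_le1 t Ht).
  assert (bs : Rabs (quad (- 1) (- s / 2) 0 0 i) <= 1).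
  { destruct is_mode as [h1 _].
    assert (-1 <= s <= 1) by (split; nra).
    destruct i as [|[|[|[|i]]]]; simpl; apply Rabs_le; lra. }
  replace (mode_adjoint t i) with ((mode_adjoint t i - quad (- 1) (- s / 2) 0 0 i) + quad (- 1) (- s / 2) 0 0 i)
    by ring.
  eapply Rle_trans; [apply Rabs_plus_le; [exact h | exact bs]|]. lra.
Qed.

(** Up to a non-zero factor this is v - s (a - b), as y_0 + y_2 = 2 v and y_1 - y_3 = b - a at time 0. *)
Lemma mode_adjoint_center (y : state) : dot4 (mode_adjoint 0) y =
  - (sg 0 * Phi (PI / 2)) * ((y 0%nat + y 2%nat) + 2 * s * (y 1%nat - y 3%nat)).
Proof.
  destruct is_mode as [_ [_ [_ [_ [_ [Hd _]]]]]].
  unfold dot4, mode_adjoint, adjoint, quad. rewrite psi_0, Hd, ee_0. field.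
Qed.

End Mode.

(** * Shooting from the saddle *)

Lemma differential_agree (P : poly) (x h k : state) :
  (forall j, h j = k j) -> differential P x h = differential P x k.
Proof. intros H; induction P; simpl; auto; congruence. Qed.

Lemma is_derive_dot4 (x y : R -> state) (dx dy : state) (t : R) :
  (forall i, is_derive (fun t => x t i) t (dx i)) ->
  (forall i, is_derive (fun t => y t i) t (dy i)) ->
  is_derive (fun t => dot4 (x t) (y t)) t (dot4 dx (y t) + dot4 (x t) dy).
Proof.
  intros Hx Hy.
  assert (H : forall i, is_derive (fun t => x t i * y t i) t (dx i * y t i + x t i * dy i))
    by (intros i; apply (is_derive_mul (fun t => x t i) (fun t => y t i)); auto).
  unfold dot4. eapply is_derive_R.
  - exact (is_derive_plus _ _ _ _ _ (is_derive_plus _ _ _ _ _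
      (is_derive_plus _ _ _ _ _ (H 0%nat) (H 1%nat)) (H 2%nat)) (H 3%nat)).
  - change plus with Rplus. simpl. ring.
Qed.

Lemma dot4_bound (x y : state) (a d : R) : inbox a x -> inbox d y -> Rabs (dot4 x y) <= 4 * (a * d).
Proof.
  intros Hx Hy. unfold dot4.
  replace (4 * (a * d)) with (a * d + a * d + a * d + a * d) by ring.
  repeat apply Rabs_plus_le; apply Rabs_mult_le; auto.
Qed.

Definition Ysolves (y : R -> state) (t : R) : Prop :=
  forall i, is_derive (fun s => y s i) t (eval (set4 (clamp 3 (y t)) (ee t)) (Yfield i)).

Lemma Yfield_eval (x : state) (e : R) (i : nat) : (i < 4)%nat ->
  eval (set4 x e) (Yfield i) = - Yrate i * x i + e * eval (set4 x e) (Ynonlin i).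
Proof.
  intros Hi. destruct i as [|[|[|[|i]]]]; [reflexivity..|lia].
Qed.

Lemma Yfield_ge4 (i : nat) : (4 <= i)%nat -> Yfield i = Cst 0.
Proof.
  intros Hi. unfold Yfield. destruct (Nat.ltb_spec i 4); [lia | reflexivity].
Qed.

Lemma Ynonlin_ge4 (i : nat) : (4 <= i)%nat -> Ynonlin i = Cst 0.
Proof. intros Hi. destruct i as [|[|[|[|i]]]]; try lia. reflexivity. Qed.

Lemma Yrate_ge0 (i : nat) : 0 <= Yrate i.
Proof. destruct i as [|[|[|[|i]]]]; simpl; lra. Qed.

Lemma Yflow_exists (T : R) (y0 : state) : (forall j, (4 <= j)%nat -> y0 j = 0) ->
  exists y, (forall i, y (- T) i = y0 i) /\ (forall t, t <= 0 -> Ysolves y t) /\ supp4 y.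
Proof.
  intros H4.
  assert (Hin : forall t, t <= 0 -> clamp 1 (fun _ => ee t) 0%nat = ee t).
  { intros t Ht. apply (clamp_id 1 (fun _ => ee t)). intros _.
    assert (h := ee_pos t). assert (h1 := ee_le1 t Ht). rewrite Rabs_pos_eq; lra. }
  destruct (clamped_flow Yfield (fun s => clamp 1 (fun _ => ee s) 0%nat) 3 (- T) y0)
    as [y [Hy0 [Hy Hj]]].
  - apply Yfield_ge4.
  - lra.
  - intros s. apply (continuous_clamp 1 (fun s _ => ee s) 0 s).
    eapply derivable_continuous, is_derive_ee.
  - intros s. eapply Rle_trans; [apply clamp_inbox; lra | lra].
  - exists y; split; [auto|split].
    + intros t Ht i. specialize (Hy t i). unfold clamped_field in Hy.
      rewrite Hin in Hy by exact Ht. exact Hy.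
    + intros t j Hjj. rewrite Hj; auto.
Qed.

(** The bound is uniform in T because the Lipschitz constant of the field at time t is proportional to
ee t, whose integral over (-oo, 0] is finite; the damping only helps. *)
Lemma Yflow_near : exists C, 1 <= C /\ forall (y z : R -> state) (T d : R), 0 <= T ->
  (forall t, t <= 0 -> Ysolves y t) -> (forall t, t <= 0 -> Ysolves z t) ->
  supp4 y -> supp4 z -> near d (y (- T)) (z (- T)) ->
  forall t, - T <= t <= 0 -> near (C * d) (y t) (z t).
Proof.
  destruct (poly_family_lipschitz Ynonlin 3 Ynonlin_ge4) as [L [HL Hlip]].
  exists (2 * exp (16 * L)). split.
  { assert (h := exp_ineq1_le (16 * L)). lra. }
  intros y z T d HT Hy Hz Sy Sz Hd t Ht.
  assert (Hd0 := near_ge0 _ _ _ Hd).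
  assert (h : near (2 * (d + 0) * exp (4 * (4 * L * ee t - 4 * L * ee (- T)))) (y t) (z t)).
  { apply (trajectories_near y z
      (fun t i => eval (set4 (clamp 3 (y t)) (ee t)) (Yfield i))
      (fun t i => eval (set4 (clamp 3 (z t)) (ee t)) (Yfield i))
      (fun t => 4 * L * ee t) (fun t => L * ee t) (- T) t 0 d); auto; try lra.
    - intros s Hs i; apply Hy; lra.
    - intros s Hs i; apply Hz; lra.
    - intros s j Hj. rewrite Sy, Sz; auto.
    - intros s _. eapply is_derive_R; [apply is_derive_scal, is_derive_ee | field].
    - intros s Hs i r Hr.
      assert (Hr0 := near_ge0 _ _ _ Hr).
      assert (he := ee_pos s). assert (he1 : ee s <= 1) by (apply ee_le1; lra).
      destruct (Nat.lt_ge_cases i 4) as [Hi|Hi].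
      2:{ rewrite Yfield_ge4 by auto. simpl. rewrite Rminus_eq_0, Rmult_0_r.
          apply Rmult_le_pos; nra. }
      rewrite !Yfield_eval by auto.
      set (P := eval (set4 (clamp 3 (y s)) (ee s)) (Ynonlin i)).
      set (Q := eval (set4 (clamp 3 (z s)) (ee s)) (Ynonlin i)).
      assert (HPQ : Rabs (P - Q) <= L * r).
      { apply Hlip.
        - apply set4_inbox; [apply clamp_inbox; lra | rewrite Rabs_pos_eq; lra].
        - apply set4_inbox; [apply clamp_inbox; lra | rewrite Rabs_pos_eq; lra].
        - apply set4_near, clamp_near, Hr. }
      assert (Hm := clamp_monotone 3 (y s) (z s) i). assert (HR := Yrate_ge0 i).
      assert (B1 : (y s i - z s i) * (P - Q) <= r * (L * r)).
      { eapply Rle_trans; [apply Rle_abs|]. apply Rabs_mult_le; [apply Hr | exact HPQ]. }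
      assert (0 <= Yrate i * ((y s i - z s i) * (clamp 3 (y s) i - clamp 3 (z s) i)))
        by (apply Rmult_le_pos; auto).
      assert (ee s * ((y s i - z s i) * (P - Q)) <= ee s * (r * (L * r)))
        by (apply Rmult_le_compat_l; lra).
      lra. }
  eapply near_le; [|exact h].
  assert (he := ee_pos t). assert (he1 : ee t <= 1) by (apply ee_le1; lra).
  assert (heT := ee_pos (- T)).
  replace (2 * exp (16 * L) * d) with (2 * (d + 0) * exp (16 * L)) by ring.
  apply Rmult_le_compat_l; [lra|].
  apply exp_mono. nra.
Qed.

Lemma yhom_bounded (t : R) : t <= 0 -> inbox 2 (yhom t).
Proof.
  intros Ht. assert (he := ee_pos t). assert (he1 := ee_le1 t Ht).
  assert (hg := sg_pos t). assert (hg1 := sg_le1 t). assert (h3 := sqrt3_bound).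
  assert (hg3 : 0 <= sg t ^ 3 <= 1) by (apply pow_unit; lra).
  assert (P : forall m, 0 <= ee t ^ m * sg t ^ 3 <= 1).
  { intros m. assert (0 <= ee t ^ m <= 1) by (apply pow_unit; lra).
    split; [apply Rmult_le_pos; lra|]. rewrite <- (Rmult_1_r 1). apply Rmult_le_compat; lra. }
  assert (Q : forall x, 0 <= x <= 1 -> Rabs (sqrt 3 * x) <= 2).
  { intros x Hx. apply Rabs_le. split; nra. }
  intros i; destruct i as [|[|[|[|i]]]]; unfold yhom, quad; rewrite ?Rabs_Ropp; try (apply Q; auto).
  rewrite Rabs_R0; lra.
Qed.

Lemma yhom_Ysolves (t : R) : t <= 0 -> Ysolves yhom t.
Proof.
  intros Ht i. assert (hb := yhom_bounded t Ht).
  rewrite (eval_agree _ (set4 (yhom t) (ee t))); [apply yhom_derive|].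
  intros j. unfold set4. destruct Nat.eqb; [reflexivity|]. apply clamp_id.
  intros k. specialize (hb k). lra.
Qed.

Lemma yhom_supp4 : supp4 yhom.
Proof. intros t j Hj. destruct j as [|[|[|[|j]]]]; try lia. reflexivity. Qed.

(** Along the two trajectories the derivative of the pairing reduces to the linearization error, which is
bounded by a multiple of ee t * rho * d, with rho the distance to the homoclinic orbit. *)
Lemma pairing_estimate : exists A, 0 <= A /\
  forall s Phi dPhi (y z : R -> state) (T rho d : R), mode s Phi dPhi -> 0 <= T -> rho <= 1 ->
  (forall t, t <= 0 -> Ysolves y t) -> (forall t, t <= 0 -> Ysolves z t) ->
  supp4 y -> supp4 z ->
  (forall t, - T <= t <= 0 -> near rho (y t) (yhom t)) ->
  (forall t, - T <= t <= 0 -> near rho (z t) (yhom t)) ->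
  near d (y (- T)) (z (- T)) ->
  Rabs (dot4 (mode_adjoint s Phi dPhi 0) (sdiff (y 0) (z 0))
    - dot4 (mode_adjoint s Phi dPhi (- T)) (sdiff (y (- T)) (z (- T)))) <= A * (rho * d).
Proof.
  destruct Yflow_near as [C1 [HC1 Hnear]].
  destruct (poly_family_linearization Ynonlin 3 Ynonlin_ge4) as [K1 [HK1 Hlin]].
  exists (160 * K1 * C1). split; [apply Rmult_le_pos; lra|].
  intros s Phi dPhi y z T rho d Hm HT Hrho Hy Hz Sy Sz Ny Nz Hd.
  set (K := 4 * (10 * (K1 * (rho * (C1 * d))))).
  assert (Hd0 := near_ge0 _ _ _ Hd).
  assert (Hrho0 : 0 <= rho) by (apply (near_ge0 _ (y 0) (yhom 0)), Ny; lra).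
  assert (HK : 0 <= K).
  { unfold K. do 3 (apply Rmult_le_pos; [lra|]). apply Rmult_le_pos; [lra|]. apply Rmult_le_pos; lra. }
  assert (Hb3 : forall t x, t <= 0 -> near rho x (yhom t) -> inbox 3 x).
  { intros t x Ht Hx j. replace (x j) with ((x j - yhom t j) + yhom t j) by ring.
    eapply Rle_trans; [apply Rabs_plus_le; [apply Hx | apply (yhom_bounded t Ht)]|]. lra. }
  assert (Hun : forall x t, t <= 0 -> inbox 3 (x t) -> Ysolves x t -> forall i,
    is_derive (fun s => x s i) t (eval (set4 (x t) (ee t)) (Yfield i))).
  { intros x t Ht Hx Hs i. rewrite (eval_agree _ (set4 (clamp 3 (x t)) (ee t))); [apply Hs|].
    intros j. unfold set4. destruct Nat.eqb; [reflexivity|]. symmetry; apply clamp_id, Hx. }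
  assert (Hder : forall t, - T <= t <= 0 -> exists D,
    is_derive (fun t => dot4 (mode_adjoint s Phi dPhi t) (sdiff (y t) (z t))) t D /\
    Rabs D <= K * ee t).
  { intros t Ht.
    destruct (mode_adjoint_derive s Phi dPhi Hm t (sdiff (y t) (z t))) as [dx [Hdx Edx]].
    exists (dot4 dx (sdiff (y t) (z t)) + dot4 (mode_adjoint s Phi dPhi t)
      (fun i => eval (set4 (y t) (ee t)) (Yfield i) - eval (set4 (z t) (ee t)) (Yfield i))).
    assert (By : inbox 3 (y t)) by (apply (Hb3 t); [lra | apply Ny; lra]).
    assert (Bz : inbox 3 (z t)) by (apply (Hb3 t); [lra | apply Nz; lra]).
    assert (Bh : inbox 3 (yhom t)).
    { intros j. assert (h := yhom_bounded t ltac:(lra) j). lra. }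
    split.
    - apply is_derive_dot4; [exact Hdx|].
      intros i. apply is_derive_sub; apply Hun; auto; try lra;
        [apply Hy | apply Hz]; lra.
    - rewrite Edx.
      assert (he := ee_pos t). assert (he1 : ee t <= 1) by (apply ee_le1; lra).
      assert (Be : Rabs (ee t) <= 3) by (rewrite Rabs_pos_eq; lra).
      assert (Hn := Hnear y z T d HT Hy Hz Sy Sz Hd t Ht).
      set (r := fun i => eval (set4 (y t) (ee t)) (Ynonlin i) - eval (set4 (z t) (ee t)) (Ynonlin i)
        - differential (Ynonlin i) (set4 (yhom t) (ee t)) (set4 (sdiff (y t) (z t)) 0)).
      assert (Hr : inbox (K1 * (rho * (C1 * d))) r).
      { intros i. unfold r.
        rewrite (differential_agree _ _ (set4 (sdiff (y t) (z t)) 0)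
          (sdiff (set4 (y t) (ee t)) (set4 (z t) (ee t)))).
        - apply Hlin; try (apply set4_inbox; auto); apply set4_near; auto.
        - intros j. unfold set4, sdiff. destruct Nat.eqb; ring. }
      assert (Hmb : inbox 10 (mode_adjoint s Phi dPhi t))
        by (intros i; apply (mode_adjoint_bounded s Phi dPhi Hm t i); lra).
      (* the linear terms cancel because the mode solves the adjoint equation *)
      assert (E : dot4 (mode_adjoint s Phi dPhi t) (fun i => Yrate i * sdiff (y t) (z t) i
          - ee t * differential (Ynonlin i) (set4 (yhom t) (ee t)) (set4 (sdiff (y t) (z t)) 0))
        + dot4 (mode_adjoint s Phi dPhi t)
          (fun i => eval (set4 (y t) (ee t)) (Yfield i) - eval (set4 (z t) (ee t)) (Yfield i))
        = dot4 (mode_adjoint s Phi dPhi t) r * ee t).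
      { unfold dot4. rewrite !Yfield_eval by lia. unfold r, sdiff. ring. }
      rewrite E, Rabs_mult, (Rabs_pos_eq (ee t)) by lra.
      apply Rmult_le_compat_r; [lra | apply dot4_bound; auto]. }
  apply Rle_trans with (4 * K * ee 0 - 4 * K * ee (- T)).
  - apply (derive_bound (fun t => dot4 (mode_adjoint s Phi dPhi t) (sdiff (y t) (z t)))
      (fun t => 4 * K * ee t) (fun t => K * ee t)); [lra | exact Hder |].
    intros t _. eapply is_derive_R; [apply is_derive_scal, is_derive_ee | field].
  - rewrite ee_0. assert (h := ee_pos (- T)).
    assert (0 <= K * ee (- T)) by (apply Rmult_le_pos; lra). unfold K in *. lra.
Qed.

(** The points v = 0, a = b in scaled coordinates, E being the value of ee at the initial time.  The first
and second entries are the limits sqrt 3 of the homoclinic orbit shifted by mu = (m1 + m2) / 2 and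
nu = m1 - m2, so that m1 = mu + nu / 2 and m2 = mu - nu / 2 are what the two modes measure. *)
Definition launch (E m1 m2 : R) : state :=
  quad (sqrt 3 + (m1 + m2) / 2) (sqrt 3 + (m1 - m2))
     (- (E * (sqrt 3 + (m1 + m2) / 2))) (E * (sqrt 3 + (m1 - m2))).

Lemma launch_near (E m1 m2 n1 n2 : R) : 0 <= E <= 1 ->
  near (Rabs (m1 - n1) + Rabs (m2 - n2)) (launch E m1 m2) (launch E n1 n2).
Proof.
  intros HE.
  set (a := m1 - n1). set (b := m2 - n2).
  assert (Ha := Rabs_pos a). assert (Hb := Rabs_pos b).
  assert (H1 : Rabs ((a + b) / 2) <= Rabs a + Rabs b).
  { unfold Rdiv. rewrite Rabs_mult, (Rabs_pos_eq (/ 2)) by lra.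
    assert (h := Rabs_triang a b). lra. }
  assert (H2 : Rabs (a - b) <= Rabs a + Rabs b).
  { eapply Rle_trans; [apply Rabs_triang|]. rewrite Rabs_Ropp; lra. }
  assert (HE' : forall x, Rabs x <= Rabs a + Rabs b -> Rabs (E * x) <= Rabs a + Rabs b).
  { intros x Hx. rewrite Rabs_mult, (Rabs_pos_eq E) by lra.
    assert (h := Rabs_pos x). nra. }
  intros i; destruct i as [|[|[|[|i]]]]; unfold launch, quad.
  - replace (_ - _) with ((a + b) / 2) by (unfold a, b; field). exact H1.
  - replace (_ - _) with (a - b) by (unfold a, b; field). exact H2.
  - replace (_ - _) with (- (E * ((a + b) / 2))) by (unfold a, b; field).
    rewrite Rabs_Ropp. apply HE', H1.
  - replace (_ - _) with (E * (a - b)) by (unfold a, b; field). apply HE', H2.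
  - rewrite Rminus_0_r, Rabs_R0. lra.
Qed.

Lemma launch_yhom (T : R) : 0 <= T -> near (6 * ee (- T)) (launch (ee (- T)) 0 0) (yhom (- T)).
Proof.
  intros HT. assert (he := ee_pos (- T)). assert (he1 : ee (- T) <= 1) by (apply ee_le1; lra).
  assert (hg := sg_pos (- T)). assert (hg1 := sg_le1 (- T)). assert (hsq := sg_sq (- T)).
  assert (h3 := sqrt3_bound).
  set (e := ee (- T)) in *. set (g := sg (- T)) in *. set (c := sqrt 3) in *.
  assert (h4 : 0 <= e ^ 4 <= 1) by (apply pow_unit; lra).
  assert (h8 : 0 <= e ^ 8 <= e).
  { replace (e ^ 8) with (e * e ^ 7) by ring.
    assert (0 <= e ^ 7 <= 1) by (apply pow_unit; lra).
    split; [apply Rmult_le_pos; lra|]. apply Rle_trans with (e * 1); [|lra].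
    apply Rmult_le_compat_l; lra. }
  assert (hg2 : 1 - e <= g).
  { assert (g ^ 2 <= g) by nra. assert (1 - e ^ 8 <= g ^ 2).
    { assert (0 <= g ^ 2 <= 1) by (split; nra). nra. } lra. }
  assert (hg3 : 0 <= g ^ 3 <= 1) by (apply pow_unit; lra).
  assert (hg3' : 1 - g ^ 3 <= 3 * e).
  { replace (1 - g ^ 3) with ((1 - g) * (1 + g + g ^ 2)) by ring.
    assert (0 <= 1 + g + g ^ 2 <= 3) by (split; nra).
    apply Rle_trans with ((1 - g) * 3); [apply Rmult_le_compat_l; lra | lra]. }
  assert (hP : forall x, 0 <= x <= 1 -> 0 <= e * (1 - x * g ^ 3) <= e).
  { intros x Hx. assert (0 <= x * g ^ 3 <= 1).
    { split; [apply Rmult_le_pos; lra|]. rewrite <- (Rmult_1_r 1). apply Rmult_le_compat; lra. }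
    split; [apply Rmult_le_pos; lra|]. apply Rle_trans with (e * 1); [|lra].
    apply Rmult_le_compat_l; lra. }
  intros i; destruct i as [|[|[|[|i]]]]; unfold launch, yhom, quad; fold e g c.
  - replace (_ - _) with (c * (1 - g ^ 3)) by field. rewrite Rabs_pos_eq; nra.
  - replace (_ - _) with (c * (1 - g ^ 3)) by field. rewrite Rabs_pos_eq; nra.
  - replace (_ - _) with (- (c * (e * (1 - e ^ 8 * g ^ 3)))) by field. rewrite Rabs_Ropp.
    specialize (hP (e ^ 8) ltac:(lra)). rewrite Rabs_pos_eq; nra.
  - replace (_ - _) with (c * (e * (1 - e ^ 4 * g ^ 3))) by field.
    specialize (hP (e ^ 4) h4). rewrite Rabs_pos_eq; nra.
  - rewrite Rminus_0_r, Rabs_R0. lra.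
Qed.

(** Applied to the increments (m1 + m2) / 2 and m1 - m2 of the growing components, the limit form of
[mode_adjoint_limit] gives - m1 for s = 1 and - m2 for s = -1. *)
Lemma mode_adjoint_launch (s : R) (Phi dPhi : R -> R) (T m1 m2 n1 n2 : R) :
  mode s Phi dPhi -> 0 <= T ->
  Rabs (dot4 (mode_adjoint s Phi dPhi (- T)) (sdiff (launch (ee (- T)) m1 m2) (launch (ee (- T)) n1 n2))
    + (if Rle_dec 0 s then m1 - n1 else m2 - n2))
  <= 36 * ee (- T) * (Rabs (m1 - n1) + Rabs (m2 - n2)).
Proof.
  intros Hm HT.
  assert (he := ee_pos (- T)). assert (he1 : ee (- T) <= 1) by (apply ee_le1; lra).
  assert (Hl := mode_adjoint_limit s Phi dPhi Hm (- T) ltac:(lra)).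
  assert (Hn := launch_near (ee (- T)) m1 m2 n1 n2 ltac:(lra)).
  set (x := mode_adjoint s Phi dPhi (- T)) in *. set (E := ee (- T)) in *.
  set (d := sdiff (launch E m1 m2) (launch E n1 n2)).
  assert (hs : s = 1 \/ s = - 1).
  { destruct Hm as [h1 _]. assert (H : (s - 1) * (s + 1) = 0) by lra.
    apply Rmult_integral in H. destruct H; [left|right]; lra. }
  replace (dot4 x d + _) with (dot4 (fun i => x i - quad (- 1) (- s / 2) 0 0 i) d).
  - replace (36 * E * _) with (4 * (9 * E * (Rabs (m1 - n1) + Rabs (m2 - n2)))) by ring.
    apply dot4_bound; [exact Hl | exact Hn].
  - destruct hs as [-> | ->]; destruct Rle_dec; try lra; unfold dot4, d, sdiff, launch, quad; field.
Qed.

(** The two pairings at time 0, as functions of m1 and m2, form a map close to the identity whose value at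
the origin is O(E) because the homoclinic orbit itself is symmetric. *)
Lemma shooting : exists K eta, 0 < K /\ 0 < eta /\ forall T, 0 <= T -> ee (- T) <= eta ->
  exists (y : R -> state) (mu nu : R), (forall t, t <= 0 -> Ysolves y t) /\ supp4 y /\
    (forall t, - T <= t <= 0 -> near (K * ee (- T)) (y t) (yhom t)) /\
    (y 0 0%nat + y 0 2%nat = 0) /\ y 0 1%nat = y 0 3%nat /\
    (forall i, y (- T) i = quad mu nu (- (ee (- T) * mu)) (ee (- T) * nu) i).
Proof.
  destruct Yflow_near as [C1 [HC1 Hnear]].
  destruct pairing_estimate as [A [HA Hpair]].
  (* R0 E is the radius of the square in which the root is found, K E the resulting distance to the
     homoclinic orbit; R0 is four times the bound on the value of the map at the origin, divided by E *)
  set (R0 := 960 + 24 * A). set (K := C1 * (6 + 2 * R0)).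
  assert (HR0 : 0 < R0) by (unfold R0; lra).
  assert (HK : 0 < K) by (unfold K; apply Rmult_lt_0_compat; lra).
  set (B := 4 * (A * K + 36) + K).
  assert (HAK : 0 <= A * K) by (apply Rmult_le_pos; lra).
  assert (HB : 0 < B) by (unfold B; lra).
  exists K, (/ B). split; [exact HK|]. split; [apply Rinv_0_lt_compat, HB|].
  intros T HT Heta.
  assert (he := ee_pos (- T)). assert (he1 : ee (- T) <= 1) by (apply ee_le1; lra).
  set (E := ee (- T)) in *.
  assert (HBE : B * E <= 1).
  { apply (Rmult_le_compat_l B) in Heta; [|lra]. rewrite Rinv_r in Heta by lra. exact Heta. }
  assert (HKE : 0 <= K * E) by (apply Rmult_le_pos; lra).
  assert (HAKE : 0 <= A * (K * E)) by (apply Rmult_le_pos; lra).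
  assert (Hr1 : K * E <= 1) by (unfold B in HBE; lra).
  assert (Hr2 : A * (K * E) + 36 * E <= 1 / 4) by (unfold B in HBE; lra).
  destruct (functional_choice (fun (m : R * R) (y : R -> state) =>
    (forall i, y (- T) i = launch E (fst m) (snd m) i) /\ (forall t, t <= 0 -> Ysolves y t) /\
    supp4 y)) as [Y HY].
  { intros m. apply Yflow_exists. intros j Hj. destruct j as [|[|[|[|j]]]]; try lia. reflexivity. }
  set (r := R0 * E). assert (Hr : 0 < r) by (unfold r; apply Rmult_lt_0_compat; lra).
  assert (Hclose : forall m1 m2, Rabs m1 <= r -> Rabs m2 <= r -> forall t, - T <= t <= 0 ->
    near (K * E) (Y (m1, m2) t) (yhom t)).
  { intros m1 m2 H1 H2 t Ht. destruct (HY (m1, m2)) as [Yi [Ys Y4]].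
    replace (K * E) with (C1 * (2 * r + 6 * E)) by (unfold K, r; ring).
    apply (Hnear _ _ T); auto using yhom_Ysolves, yhom_supp4.
    intros j. rewrite Yi. simpl fst; simpl snd.
    assert (hn := near_trans _ _ _ _ _ (launch_near E m1 m2 0 0 ltac:(lra)) (launch_yhom T HT)).
    eapply Rle_trans; [apply hn|]. fold E. rewrite !Rminus_0_r. lra. }
  (* the sign makes the linear part + m1 for s = 1 and + m2 for s = -1 *)
  set (Gs := fun s Phi dPhi (x y : R) => - dot4 (mode_adjoint s Phi dPhi 0) (Y (x, y) 0)).
  assert (HG : forall s Phi dPhi, mode s Phi dPhi -> forall x y x' y',
    Rabs x <= r -> Rabs y <= r -> Rabs x' <= r -> Rabs y' <= r ->
    Rabs (Gs s Phi dPhi x y - Gs s Phi dPhi x' y' - (if Rle_dec 0 s then x - x' else y - y'))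
      <= 1 / 4 * (Rabs (x - x') + Rabs (y - y'))).
  { intros s Phi dPhi Hm x y x' y' Hx Hy Hx' Hy'.
    destruct (HY (x, y)) as [Yi [Ys Y4]]. destruct (HY (x', y')) as [Yi' [Ys' Y4']].
    simpl fst in *; simpl snd in *.
    set (d := Rabs (x - x') + Rabs (y - y')).
    assert (Hd : near d (Y (x, y) (- T)) (Y (x', y') (- T))).
    { intros j. rewrite Yi, Yi'. apply launch_near; lra. }
    assert (P := Hpair s Phi dPhi _ _ T (K * E) d Hm HT Hr1 Ys Ys' Y4 Y4'
      (Hclose x y Hx Hy) (Hclose x' y' Hx' Hy') Hd).
    assert (Q := mode_adjoint_launch s Phi dPhi T x y x' y' Hm HT). fold E in Q. fold d in Q.
    set (X := dot4 (mode_adjoint s Phi dPhi 0) (sdiff (Y (x, y) 0) (Y (x', y') 0))) in *.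
    replace (dot4 (mode_adjoint s Phi dPhi (- T)) (sdiff (Y (x, y) (- T)) (Y (x', y') (- T)))) with
      (dot4 (mode_adjoint s Phi dPhi (- T)) (sdiff (launch E x y) (launch E x' y'))) in P
      by (unfold dot4, sdiff; rewrite !Yi, !Yi'; reflexivity).
    set (Z := dot4 (mode_adjoint s Phi dPhi (- T)) (sdiff (launch E x y) (launch E x' y'))) in *.
    replace (Gs s Phi dPhi x y - Gs s Phi dPhi x' y') with (- X)
      by (unfold Gs, X, dot4, sdiff; ring).
    set (w := if Rle_dec 0 s then x - x' else y - y') in *.
    replace (- X - w) with (- (X - Z) + - (Z + w)) by ring.
    assert (hd : 0 <= d) by apply (near_ge0 _ _ _ Hd).
    eapply Rle_trans; [apply Rabs_triang|]. rewrite !Rabs_Ropp.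
    apply Rle_trans with ((A * (K * E) + 36 * E) * d); [lra|].
    apply Rmult_le_compat_r; lra. }
  assert (HG0 : forall s Phi dPhi, mode s Phi dPhi -> Rabs (Gs s Phi dPhi 0 0) <= r / 4).
  { intros s Phi dPhi Hm. destruct (HY (0, 0)) as [Yi [Ys Y4]]. simpl fst in *; simpl snd in *.
    assert (H00 : Rabs 0 <= r) by (rewrite Rabs_R0; lra).
    assert (Hd : near (6 * E) (Y (0, 0) (- T)) (yhom (- T))).
    { intros j. rewrite Yi. apply launch_yhom, HT. }
    assert (P := Hpair s Phi dPhi _ _ T (K * E) (6 * E) Hm HT Hr1 Ys yhom_Ysolves Y4 yhom_supp4
      (Hclose 0 0 H00 H00)).
    assert (P' : Rabs (dot4 (mode_adjoint s Phi dPhi 0) (sdiff (Y (0, 0) 0) (yhom 0)) -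
      dot4 (mode_adjoint s Phi dPhi (- T)) (sdiff (Y (0, 0) (- T)) (yhom (- T)))) <= A * (K * E * (6 * E))).
    { apply P; auto. intros t _ j. rewrite Rminus_eq_0, Rabs_R0. exact HKE. }
    assert (Q : Rabs (dot4 (mode_adjoint s Phi dPhi (- T)) (sdiff (Y (0, 0) (- T)) (yhom (- T))))
      <= 4 * (10 * (6 * E))).
    { apply dot4_bound; [|exact Hd]. intros j. apply (mode_adjoint_bounded s Phi dPhi Hm). lra. }
    assert (Z : dot4 (mode_adjoint s Phi dPhi 0) (yhom 0) = 0).
    { rewrite (mode_adjoint_center s Phi dPhi Hm). unfold yhom, quad. rewrite ee_0. ring. }
    assert (E1 : Gs s Phi dPhi 0 0 = - dot4 (mode_adjoint s Phi dPhi 0) (sdiff (Y (0, 0) 0) (yhom 0))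
       - dot4 (mode_adjoint s Phi dPhi 0) (yhom 0)) by (unfold Gs, dot4, sdiff; ring).
    rewrite E1, Z, Rminus_0_r, Rabs_Ropp.
    set (U := dot4 (mode_adjoint s Phi dPhi 0) _) in *. set (V := dot4 (mode_adjoint s Phi dPhi (- T)) _) in *.
    replace U with ((U - V) + V) by ring.
    eapply Rle_trans; [apply Rabs_triang|].
    assert (A * (K * E * (6 * E)) <= A * (1 * (6 * E))).
    { apply Rmult_le_compat_l; [lra|]. apply Rmult_le_compat_r; lra. }
    unfold r, R0. lra. }
  destruct (near_identity_root
    (Gs 1 (fun x => cos (2 * x)) (fun x => - 2 * sin (2 * x)))
    (Gs (- 1) (fun x => cosh (sqrt 2 * (x - PI / 2)) / cosh (sqrt 2 * (PI / 2)))
      (fun x => sqrt 2 * sinh (sqrt 2 * (x - PI / 2)) / cosh (sqrt 2 * (PI / 2)))) r)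
    as [x [y [Hx [Hy [Z1 Z2]]]]].
  - lra.
  - intros x y x' y' Hx Hy Hx' Hy'.
    assert (h1 := HG _ _ _ mode_cos x y x' y' Hx Hy Hx' Hy').
    assert (h2 := HG _ _ _ mode_cosh x y x' y' Hx Hy Hx' Hy').
    destruct (Rle_dec 0 1); [|lra]. destruct (Rle_dec 0 (- 1)); [lra|]. split; assumption.
  - apply HG0, mode_cos.
  - apply HG0, mode_cosh.
  - destruct (HY (x, y)) as [Yi [Ys Y4]]. simpl fst in *; simpl snd in *.
    exists (Y (x, y)), (sqrt 3 + (x + y) / 2), (sqrt 3 + (x - y)).
    split; [exact Ys|]. split; [exact Y4|]. split; [apply Hclose; auto|].
    unfold Gs in Z1, Z2. rewrite (mode_adjoint_center _ _ _ mode_cos) in Z1.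
    rewrite (mode_adjoint_center _ _ _ mode_cosh) in Z2.
    assert (N1 : sg 0 * cos (2 * (PI / 2)) <> 0).
    { apply Rmult_integral_contrapositive_currified; [apply Rgt_not_eq, sg_pos | apply mode_cos]. }
    assert (N2 : sg 0 * (cosh (sqrt 2 * (PI / 2 - PI / 2)) / cosh (sqrt 2 * (PI / 2))) <> 0).
    { apply Rmult_integral_contrapositive_currified; [apply Rgt_not_eq, sg_pos | apply mode_cosh]. }
    set (w := Y (x, y) 0) in *.
    assert (W1 : w 0%nat + w 2%nat + 2 * 1 * (w 1%nat - w 3%nat) = 0).
    { apply (Rmult_eq_reg_l _ _ _) with (2 := N1). lra. }
    assert (W2 : w 0%nat + w 2%nat + 2 * - 1 * (w 1%nat - w 3%nat) = 0).
    { apply (Rmult_eq_reg_l _ _ _) with (2 := N2). lra. }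
    split; [lra|]. split; [lra|]. exact Yi.
Qed.

(** The trajectory found by shooting on [-T, 0] is symmetric at both ends.  It is not constant since its
first component is at least 1/2 at time 0 and small at time -T. *)
Lemma periodic_near_homoclinic : exists K T2, 0 < K /\ 0 < T2 /\ forall T, T2 < T ->
  exists W, bounded_solution W /\ (forall t i, W (t + 2 * T) i = W t i) /\
    near (K * ee (- T)) (W 0) (hom 0) /\ W 0 0%nat <> W (- T) 0%nat.
Proof.
  destruct shooting as [K [eta [HK [Heta Hshoot]]]].
  set (m := Rmin eta (/ (100 * (K + 1)))).
  assert (Hm : 0 < m).
  { apply Rmin_glb_lt; [exact Heta|]. apply Rinv_0_lt_compat; lra. }
  exists (2 * K), (Rmax 1 (- 4 * ln m)).
  split; [lra|]. split; [apply Rlt_le_trans with 1; [lra | apply Rmax_l]|].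
  intros T HT.
  assert (HT1 : 1 < T) by (eapply Rle_lt_trans; [apply Rmax_l | exact HT]).
  assert (HTm : - 4 * ln m < T) by (eapply Rle_lt_trans; [apply Rmax_r | exact HT]).
  assert (Hem : ee (- T) <= m).
  { unfold ee. rewrite <- (exp_ln m) by exact Hm. apply Rlt_le, exp_increasing. lra. }
  assert (he := ee_pos (- T)). set (E := ee (- T)) in *.
  assert (HE1 : E <= eta) by (eapply Rle_trans; [exact Hem | apply Rmin_l]).
  assert (HE2 : E * (100 * (K + 1)) <= 1).
  { assert (h : E <= / (100 * (K + 1))) by (eapply Rle_trans; [exact Hem | apply Rmin_r]).
    apply (Rmult_le_compat_r (100 * (K + 1))) in h; [|lra]. rewrite Rinv_l in h by lra. exact h. }
  assert (HKE : 0 <= K * E) by (apply Rmult_le_pos; lra).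
  destruct (Hshoot T ltac:(lra) HE1) as [y [mu [nu [Ys [Y4 [Yn_ [Z1 [Z2 Yi]]]]]]]].
  fold E in Yn_, Yi.
  set (w := fun t => unscale (ee t) (y t)).
  assert (Hee : forall t, t <= 0 -> 0 <= ee t <= 1).
  { intros t Ht. assert (h := ee_pos t). assert (h1 := ee_le1 t Ht). lra. }
  assert (Hw : forall t, - T <= t <= 0 -> near (2 * (K * E)) (w t) (hom t)).
  { intros t Ht j. rewrite <- unscale_yhom. apply unscale_near; [apply Hee; lra | auto]. }
  assert (By : forall t, - T <= t <= 0 -> inbox 3 (y t)).
  { intros t Ht j. replace (y t j) with ((y t j - yhom t j) + yhom t j) by ring.
    eapply Rle_trans; [apply Rabs_plus_le; [apply (Yn_ t Ht) | apply (yhom_bounded t); lra]|]. lra. }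
  destruct (periodic_extension w (- T) 0) as [W [HW [HP Hag]]].
  - lra.
  - intros t Ht. apply unscale_solves. intros i.
    rewrite (eval_agree _ (set4 (clamp 3 (y t)) (ee t))); [apply Ys; lra|].
    intros j. unfold set4. destruct Nat.eqb; [reflexivity|]. symmetry; apply clamp_id, By, Ht.
  - intros t Ht j. replace (w t j) with ((w t j - hom t j) + hom t j) by ring.
    eapply Rle_trans; [apply Rabs_plus_le; [apply (Hw t Ht) | apply hom_small; lra]|].
    assert (h := Hee t ltac:(lra)). lra.
  - intros t j Hj. destruct j as [|[|[|[|j]]]]; try lia. reflexivity.
  - unfold symmetric, w, unscale, quad. rewrite !Yi. unfold quad. fold E. split; field.
  - unfold symmetric, w, unscale, quad. rewrite ee_0, Z2. split; [|ring].
    transitivity ((y 0 0%nat + y 0 2%nat) / 2); [field | rewrite Z1; field].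
  - exists W. split; [exact HW|]. split; [|split].
    + intros t i. rewrite <- (HP t i). f_equal; ring.
    + intros j. rewrite Hag by lra. replace (2 * K * E) with (2 * (K * E)) by ring.
      apply Hw; lra.
    + rewrite !Hag by lra.
      assert (h0 := Hw 0 ltac:(lra) 0%nat). assert (h1 := Hw (- T) ltac:(lra) 0%nat).
      assert (h2 := hom_small (- T) 0 ltac:(lra)). fold E in h2.
      assert (h3 : 1 <= hom 0 0%nat).
      { unfold hom, quad. rewrite ee_0. assert (hs := sg_sq 0). rewrite ee_0 in hs.
        assert (hg := sg_pos 0). assert (hc : sqrt 3 * sqrt 3 = 3) by (apply sqrt_def; lra).
        assert (hc1 := sqrt3_bound). apply Rnot_lt_le. intros Hlt.
        assert (sqrt 3 * sg 0 < 1) by nra.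
        assert ((sqrt 3 * sg 0) * (sqrt 3 * sg 0) < 1).
        { assert (0 < sqrt 3 * sg 0) by nra. nra. }
        nra. }
      apply Rabs_le_between in h0, h1, h2. lra.
Qed.

(** * Normal coordinates at the equilibrium *)

(** The frequency at the equilibrium; all constants below lie in the field generated by it. *)
Definition lam : R := Rpower 2 (1 / 4).

Lemma lam_pos : 0 < lam.
Proof. apply exp_pos. Qed.

Lemma lam4 : lam ^ 4 = 2.
Proof.
  unfold lam. rewrite <- Rpower_pow by apply exp_pos. rewrite Rpower_mult.
  replace (1 / 4 * INR 4) with 1 by (simpl; field). apply Rpower_1; lra.
Qed.

Lemma lam_bounds : 1 <= lam <= 2.
Proof.
  assert (h := lam_pos). assert (h4 := lam4).
  split; apply Rnot_lt_le; intros Hlt.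
  - assert (lam ^ 2 < 1) by nra. assert (0 < lam ^ 2) by nra.
    assert (lam ^ 4 = lam ^ 2 * lam ^ 2) by ring. nra.
  - assert (4 < lam ^ 2) by nra. assert (lam ^ 4 = lam ^ 2 * lam ^ 2) by ring. nra.
Qed.

Lemma sqrt2_lam : sqrt 2 = lam ^ 2.
Proof.
  assert (h4 := lam4). apply sqrt_lem_1; [lra | apply pow_le, Rlt_le, lam_pos |].
  rewrite <- h4. ring.
Qed.

Lemma T0_lam : T0 * lam = 2 * PI.
Proof.
  unfold T0, lam. replace (Rpower 2 (3 / 4) * PI * Rpower 2 (1 / 4)) with
    (Rpower 2 (3 / 4) * Rpower 2 (1 / 4) * PI) by ring.
  rewrite <- Rpower_plus. replace (3 / 4 + 1 / 4) with 1 by field.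
  rewrite Rpower_1; lra.
Qed.

Definition equil : state := quad 1 0 (lam ^ 2 / 4) (lam ^ 2 / 4).

Lemma equil_solves (t : R) : solves_at (fun _ => equil) t.
Proof.
  assert (h4 := lam4).
  intros i. apply (is_derive_R _ t 0); [exact (is_derive_const (V := R_NormedModule) (equil i) t)|].
  destruct i as [|[|[|[|i]]]]; unfold equil, quad; simpl; try ring.
  field [h4].
Qed.

Lemma equil_bounded_solution : bounded_solution (fun _ => equil).
Proof.
  assert (h := lam_bounds). split; [apply equil_solves|split].
  - intros _ i. destruct i as [|[|[|[|i]]]]; unfold equil, quad; apply Rabs_le; nra.
  - intros t j Hj. destruct j as [|[|[|[|j]]]]; try lia. reflexivity.
Qed.

(** Coordinates of a displacement from the equilibrium: (cP, cM) spans the plane of the oscillator, (cQ, cN)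
that of the saddle.  A state has v = 0 and a = b exactly when cM and cN vanish. *)
Definition cP (x : state) : R := x 0%nat + (x 2%nat + x 3%nat) / 2.

Definition cM (x : state) : R := x 1%nat - (x 2%nat - x 3%nat).

Definition cQ (x : state) : R := x 0%nat - (x 2%nat + x 3%nat) / 2.

Definition cN (x : state) : R := x 1%nat + (x 2%nat - x 3%nat).

Definition ofPMQN (p m q n : R) : state :=
  quad ((p + q) / 2) ((m + n) / 2) (((p - q) + (n - m) / 2) / 2) (((p - q) - (n - m) / 2) / 2).

Definition equil_lin (h : state) : state := fun i => differential (S_field i) equil h.

Lemma equil_lin_normal (h : state) :
  cP (equil_lin h) = cM h /\ cM (equil_lin h) = - lam ^ 2 * cP h /\
  cQ (equil_lin h) = cN h /\ cN (equil_lin h) = lam ^ 2 * cQ h.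
Proof.
  assert (h4 := lam4).
  unfold cP, cM, cQ, cN, equil_lin, equil, quad; simpl. repeat split; field [h4].
Qed.

(** * A second-order approximate periodic solution *)

Declare Scope poly_scope.
Delimit Scope poly_scope with P.
Notation "x + y" := (Add x y) : poly_scope.
Notation "x * y" := (Mul x y) : poly_scope.
Notation "# c" := (Cst c) (at level 1) : poly_scope.

(** Coefficients of the second-order terms: they solve the two linear systems, for the constant term and
for the second harmonic, that make the residual vanish to second order. *)
Definition al0 := - (3 / 8) - lam ^ 2 / 2.

Definition al2 := lam ^ 2 / 4 + 1 / 4.

Definition be0 := 7 / 40 - lam ^ 2 / 10.

Definition be2 := - (1 / 10) - lam ^ 2 / 20.

Definition muM := - lam / 4 - lam ^ 3 / 2.

Definition nuN := - lam / 20 + lam ^ 3 / 10.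

Notation vE := (Var 0). Notation vK := (Var 1). Notation vC := (Var 2). Notation vS := (Var 3).

Section Polys.

Local Open Scope poly_scope.

(** The displacement to first and second order, divided by the amplitude e and by its square: phi for u - 1,
sig for a + b minus its value lam^2 / 2 at the equilibrium, del for a - b.  The variables are the
amplitude e, the number k such that the frequency is lam (1 - k e^2), and the cosine and the sine
of the angle. *)
Definition phi1 : poly := #(1 / 2)%R * vC.

Definition phi2 : poly := #((al0 + be0) / 2)%R + #((al2 + be2) / 2)%R * (vC * vC).

Definition sig1 : poly := vC.

Definition sig2 : poly := #(al0 - be0)%R + #(al2 - be2)%R * (vC * vC).

Definition del1 : poly := #(lam / 2)%R * vS.

Definition del2 : poly := #((nuN - muM) / 2)%R * (vC * vS).

Definition phi12 : poly := phi1 + vE * phi2.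

Definition sig12 : poly := sig1 + vE * sig2.

Definition del12 : poly := del1 + vE * del2.

(** The terms of order three and more, divided by e^3, of (phi + phi^2 / 2) del, where phi, sig, del are now the
full displacements: the nonlinearity of - (cP)' and of (cQ)'. *)
Definition cub_p : poly :=
  phi1 * del2 + phi2 * del1 + vE * (phi2 * del2) + #(1 / 2)%R * (phi12 * phi12 * del12).

(** The same for (sig^2 + del^2) / 2 + (lam^2 / 2) sig phi + (sig^2 + del^2) phi / 2, the nonlinearity of - v'. *)
Definition cub_v : poly :=
  sig1 * sig2 + del1 * del2 + #(1 / 2)%R * (vE * (sig2 * sig2 + del2 * del2))
  + #(lam ^ 2 / 2)%R * (sig1 * phi2 + sig2 * phi1 + vE * (sig2 * phi2))
  + #(1 / 2)%R * ((sig12 * sig12 + del12 * del12) * phi12).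

(** The same for (lam^2 / 2) phi^2 + 2 phi sig + phi^2 sig, the nonlinearity of (a - b)'. *)
Definition cub_d : poly :=
  #(lam ^ 2 / 2)%R * (#2%R * (phi1 * phi2) + vE * (phi2 * phi2))
  + #2%R * (phi1 * sig2 + phi2 * sig1 + vE * (phi2 * sig2)) + phi12 * phi12 * sig12.

Definition res_p : poly := cub_p + vK * (#lam * vS + #(2 * lam * al2)%R * (vE * (vC * vS))).

Definition res_m : poly := cub_v + cub_d
  + vK * (#(lam ^ 2)%R * vC + #(- lam * muM)%R * (vE * (vC * vC + #(-1)%R * (vS * vS)))).

Definition res_q : poly := #(-1)%R * cub_p + vK * (#(2 * lam * be2)%R * (vE * (vC * vS))).

Definition res_n : poly := cub_v + #(-1)%R * cub_d
  + vK * (#(- lam * nuN)%R * (vE * (vC * vC + #(-1)%R * (vS * vS)))).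

(** The residual, divided by e^3, as seen by the oscillator mode. *)
Definition res_osc : poly := vC * res_m + #lam * ((#1%R + #(-1)%R * (vK * (vE * vE))) * (vS * res_p)).

End Polys.

Definition approx_env (e k c s : R) : state := quad e k c s.

Definition approx_disp (e c s : R) : state :=
  ofPMQN (e * c + e ^ 2 * (al0 + al2 * c ^ 2)) (- lam * e * s + muM * e ^ 2 * (c * s))
         (e ^ 2 * (be0 + be2 * c ^ 2)) (nuN * e ^ 2 * (c * s)).

Definition approx_disp' (e c s : R) : state :=
  ofPMQN (- e * s - 2 * al2 * e ^ 2 * (c * s)) (- lam * e * c + muM * e ^ 2 * (c ^ 2 - s ^ 2))
         (- 2 * be2 * e ^ 2 * (c * s)) (nuN * e ^ 2 * (c ^ 2 - s ^ 2)).

Definition approx (e c s : R) : state := fun i => equil i + approx_disp e c s i.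

Definition residual (e k c s : R) : state := fun i =>
  lam * (1 - k * e ^ 2) * approx_disp' e c s i - eval (approx e c s) (S_field i).

(** The first and second orders of the residual cancel, by the choice of the coefficients. *)
Lemma residual_normal (e k c s : R) : c ^ 2 + s ^ 2 = 1 ->
  cP (residual e k c s) = e ^ 3 * eval (approx_env e k c s) res_p /\
  cM (residual e k c s) = e ^ 3 * eval (approx_env e k c s) res_m /\
  cQ (residual e k c s) = e ^ 3 * eval (approx_env e k c s) res_q /\
  cN (residual e k c s) = e ^ 3 * eval (approx_env e k c s) res_n.
Proof.
  intros h. assert (h4 := lam4). assert (hs : s ^ 2 = 1 - c ^ 2) by lra.
  unfold cP, cM, cQ, cN, residual, approx, approx_disp, approx_disp', ofPMQN, equil, approx_env, quad,
    res_p, res_m, res_q, res_n, cub_p, cub_v, cub_d, phi12, sig12, del12, phi1, phi2, sig1, sig2, del1, del2,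
    al0, al2, be0, be2, muM, nuN.
  simpl eval. repeat split; field [h4 hs].
Qed.

(** The coefficient of the amplitude dependence of the frequency, lam (1 - cstar e^2) to second order. *)
Definition cstar : R := 9 / 20 + 19 * lam ^ 2 / 80.

(** The mean of this trigonometric polynomial over a period is lam^2 (k - cstar): this is where cstar comes
from. *)
Lemma res_osc_leading (k c s : R) : c ^ 2 + s ^ 2 = 1 ->
  eval (approx_env 0 k c s) res_osc = k * lam ^ 2 + (- (3 / 10) - lam ^ 2 / 20)
    + (- (11 / 10) - 53 / 40 * lam ^ 2) * c ^ 2 + (1 + 7 / 10 * lam ^ 2) * c ^ 4.
Proof.
  intros h. assert (h4 := lam4). assert (hs : s ^ 2 = 1 - c ^ 2) by lra.
  unfold approx_env, quad, res_osc,
    res_p, res_m, res_q, res_n, cub_p, cub_v, cub_d, phi12, sig12, del12, phi1, phi2, sig1, sig2, del1, del2,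
    al0, al2, be0, be2, muM, nuN.
  simpl eval. field [h4 hs].
Qed.

Lemma approx_env_inbox (e k c s : R) : 0 <= e <= 1 -> 0 <= k <= 2 -> c ^ 2 + s ^ 2 = 1 ->
  inbox 3 (approx_env e k c s).
Proof.
  intros He Hk H i. destruct i as [|[|[|[|i]]]]; unfold approx_env, quad; apply Rabs_le; nra.
Qed.

Lemma normal_bound (x : state) (a b c d : R) : (forall j, (4 <= j)%nat -> x j = 0) ->
  Rabs (cP x) <= a -> Rabs (cM x) <= b -> Rabs (cQ x) <= c -> Rabs (cN x) <= d ->
  inbox (a + b + c + d) x.
Proof.
  intros H4 Ha Hb Hc Hd.
  assert (pa := Rle_trans _ _ _ (Rabs_pos _) Ha). assert (pb := Rle_trans _ _ _ (Rabs_pos _) Hb).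
  assert (pc := Rle_trans _ _ _ (Rabs_pos _) Hc). assert (pd := Rle_trans _ _ _ (Rabs_pos _) Hd).
  apply Rabs_le_between in Ha, Hb, Hc, Hd. unfold cP, cM, cQ, cN in *.
  intros i. destruct i as [|[|[|[|i]]]]; [apply Rabs_le; lra ..|].
  rewrite H4 by lia. rewrite Rabs_R0. lra.
Qed.

Lemma normal_le (x : state) (d : R) : inbox d x ->
  Rabs (cP x) <= 2 * d /\ Rabs (cM x) <= 3 * d /\ Rabs (cQ x) <= 2 * d /\ Rabs (cN x) <= 3 * d.
Proof.
  intros H. assert (h0 := H 0%nat). assert (h1 := H 1%nat). assert (h2 := H 2%nat).
  assert (h3 := H 3%nat). apply Rabs_le_between in h0, h1, h2, h3.
  unfold cP, cM, cQ, cN. repeat split; apply Rabs_le; lra.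
Qed.

Lemma residual_bound : exists C, 0 <= C /\ forall e k c s, 0 <= e <= 1 -> 0 <= k <= 2 ->
  c ^ 2 + s ^ 2 = 1 -> inbox (C * e ^ 3) (residual e k c s).
Proof.
  destruct (eval_bounded 3 res_p) as [A [HA BA]]. destruct (eval_bounded 3 res_m) as [B [HB BB]].
  destruct (eval_bounded 3 res_q) as [C [HC BC]]. destruct (eval_bounded 3 res_n) as [D [HD BD]].
  exists (A + B + C + D). split; [lra|]. intros e k c s He Hk Hcs.
  destruct (residual_normal e k c s Hcs) as [EP [EM [EQ EN]]].
  assert (Hb := approx_env_inbox e k c s He Hk Hcs).
  assert (He3 : 0 <= e ^ 3) by (apply pow_le; lra).
  replace ((A + B + C + D) * e ^ 3) with (e ^ 3 * A + e ^ 3 * B + e ^ 3 * C + e ^ 3 * D) by ring.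
  apply normal_bound.
  - intros j Hj. destruct j as [|[|[|[|j]]]]; try lia. unfold residual, approx_disp', ofPMQN, quad. simpl. ring.
  - rewrite EP, Rabs_mult, (Rabs_pos_eq (e ^ 3)) by auto. apply Rmult_le_compat_l; auto.
  - rewrite EM, Rabs_mult, (Rabs_pos_eq (e ^ 3)) by auto. apply Rmult_le_compat_l; auto.
  - rewrite EQ, Rabs_mult, (Rabs_pos_eq (e ^ 3)) by auto. apply Rmult_le_compat_l; auto.
  - rewrite EN, Rabs_mult, (Rabs_pos_eq (e ^ 3)) by auto. apply Rmult_le_compat_l; auto.
Qed.

Lemma ofPMQN_normal (p m q n : R) : cP (ofPMQN p m q n) = p /\ cM (ofPMQN p m q n) = m /\
  cQ (ofPMQN p m q n) = q /\ cN (ofPMQN p m q n) = n.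
Proof. unfold cP, cM, cQ, cN, ofPMQN, quad. repeat split; field. Qed.

Lemma approx_disp_bound : exists C, 0 <= C /\ forall e c s, 0 <= e <= 1 -> c ^ 2 + s ^ 2 = 1 ->
  inbox (C * e) (approx_disp e c s).
Proof.
  assert (hl := lam_bounds).
  exists ((1 + (Rabs al0 + Rabs al2)) + (2 + Rabs muM) + (Rabs be0 + Rabs be2) + Rabs nuN).
  assert (p1 := Rabs_pos al0). assert (p2 := Rabs_pos al2). assert (p3 := Rabs_pos be0).
  assert (p4 := Rabs_pos be2). assert (p5 := Rabs_pos muM). assert (p6 := Rabs_pos nuN).
  split; [lra|]. intros e c s He Hcs.
  assert (hc : Rabs c <= 1) by (apply Rabs_le; nra).
  assert (hs : Rabs s <= 1) by (apply Rabs_le; nra).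
  assert (hc2 : Rabs (c ^ 2) <= 1) by (apply Rabs_le; nra).
  assert (he : Rabs e <= e) by (rewrite Rabs_pos_eq; lra).
  assert (he2 : Rabs (e ^ 2) <= e) by (rewrite Rabs_pos_eq; nra).
  assert (hcs : Rabs (c * s) <= 1) by (rewrite <- (Rmult_1_r 1); apply Rabs_mult_le; auto).
  assert (hL : Rabs (- lam) <= 2) by (rewrite Rabs_Ropp, Rabs_pos_eq; lra).
  rewrite !Rmult_plus_distr_r.
  destruct (ofPMQN_normal (e * c + e ^ 2 * (al0 + al2 * c ^ 2)) (- lam * e * s + muM * e ^ 2 * (c * s))
         (e ^ 2 * (be0 + be2 * c ^ 2)) (nuN * e ^ 2 * (c * s))) as [EP [EM [EQ EN]]].
  fold (approx_disp e c s) in EP, EM, EQ, EN.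
  assert (Hg : forall a b, Rabs (e ^ 2 * (a + b * c ^ 2)) <= Rabs a * e + Rabs b * e).
  { intros a b. replace (Rabs a * e + Rabs b * e) with (e * (Rabs a + Rabs b * 1)) by ring.
    apply Rabs_mult_le; [exact he2|]. apply Rabs_plus_le; [lra|].
    apply Rabs_mult_le; [lra | exact hc2]. }
  assert (Hh : forall a, Rabs (a * e ^ 2 * (c * s)) <= Rabs a * e).
  { intros a. rewrite <- (Rmult_1_r (Rabs a * e)). apply Rabs_mult_le; [|exact hcs].
    apply Rabs_mult_le; [lra | exact he2]. }
  apply normal_bound.
  - intros j Hj. destruct j as [|[|[|[|j]]]]; try lia. reflexivity.
  - rewrite EP. apply Rabs_plus_le; [|apply Hg].
    rewrite Rmult_comm. apply Rabs_mult_le; auto.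
  - rewrite EM. apply Rabs_plus_le; [|apply Hh].
    rewrite <- (Rmult_1_r (2 * e)). apply Rabs_mult_le; [|exact hs]. apply Rabs_mult_le; auto.
  - rewrite EQ. apply Hg.
  - rewrite EN. apply Hh.
Qed.

Definition freq (e k : R) : R := lam * (1 - k * e ^ 2).

Definition approx_at (e k : R) (t : R) : state := approx e (cos (freq e k * t)) (sin (freq e k * t)).

Definition residual_at (e k : R) (t : R) : state := residual e k (cos (freq e k * t)) (sin (freq e k * t)).

Lemma cos_sin_sq (x : R) : cos x ^ 2 + sin x ^ 2 = 1.
Proof. assert (h := sin2_cos2 x). unfold Rsqr in h. lra. Qed.

Lemma approx_at_derive (e k t : R) (i : nat) :
  is_derive (fun t => approx_at e k t i) t (eval (approx_at e k t) (S_field i) + residual_at e k t i).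
Proof.
  unfold residual_at, residual. fold (approx_at e k t). fold (freq e k).
  apply (is_derive_R _ t (freq e k * approx_disp' e (cos (freq e k * t)) (sin (freq e k * t)) i)); [|ring].
  destruct i as [|[|[|[|i]]]]; unfold approx_at, approx, approx_disp, approx_disp', ofPMQN, quad, equil, quad;
    [..|rewrite Rmult_0_r; exact (is_derive_const (V := R_NormedModule) (0 + 0) t)];
    auto_derive; trivial; field.
Qed.

(** * Pairing with the oscillating and the hyperbolic mode *)

Definition close_pair (rho d : R) (x z : state) : Prop :=
  inbox 3 x /\ inbox 3 z /\ near rho x equil /\ near rho z equil /\ near d x z.

Lemma difference_derive : exists C, 0 <= C /\ forall (x z r : R -> state) (t rho d : R),
  (forall i, is_derive (fun s => x s i) t (eval (x t) (S_field i))) ->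
  (forall i, is_derive (fun s => z s i) t (eval (z t) (S_field i) + r t i)) ->
  close_pair rho d (x t) (z t) ->
  exists g : state, inbox (C * (rho * d)) g /\
    forall i, is_derive (fun s => sdiff (x s) (z s) i) t
      (equil_lin (sdiff (x t) (z t)) i + g i - r t i).
Proof.
  destruct (poly_family_linearization S_field 3 S_field_ge4) as [C [HC Hlin]].
  exists C. split; [lra|].
  intros x z r t rho d Hx Hz [Bx [Bz [Nx [Nz Nd]]]].
  assert (Beq : inbox 3 equil) by apply (proj1 (proj2 equil_bounded_solution) 0).
  exists (fun i => eval (x t) (S_field i) - eval (z t) (S_field i) - equil_lin (sdiff (x t) (z t)) i).
  split.
  - intros i. apply Hlin; auto.
  - intros i. eapply is_derive_R.
    + apply is_derive_sub; [apply Hx | apply Hz].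
    + ring.
Qed.

Lemma is_derive_combination (x : R -> state) (dx : state) (t : R) :
  (forall i, is_derive (fun s => x s i) t (dx i)) ->
  is_derive (fun s => cP (x s)) t (cP dx) /\ is_derive (fun s => cM (x s)) t (cM dx) /\
  is_derive (fun s => cQ (x s)) t (cQ dx) /\ is_derive (fun s => cN (x s)) t (cN dx).
Proof.
  intros H.
  assert (G : forall v : state, is_derive (fun s => dot4 v (x s)) t (dot4 v dx)).
  { intros v. eapply is_derive_R.
    - apply (is_derive_dot4 (fun _ => v) x (fun _ => 0) dx t); [|exact H].
      intros i. exact (is_derive_const (V := R_NormedModule) (v i) t).
    - unfold dot4. ring. }
  assert (X : forall (f : state -> R) v, (forall y, f y = dot4 v y) ->
    is_derive (fun s => f (x s)) t (f dx)).
  { intros f v E. rewrite E. apply (is_derive_ext (fun s => dot4 v (x s))); [|apply G].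
    intros s; symmetry; apply E. }
  split; [|split; [|split]].
  - apply (X cP (quad 1 0 (1 / 2) (1 / 2))). intros y. unfold cP, dot4, quad. field.
  - apply (X cM (quad 0 1 (- 1) 1)). intros y. unfold cM, dot4, quad. field.
  - apply (X cQ (quad 1 0 (- (1 / 2)) (- (1 / 2)))). intros y. unfold cQ, dot4, quad. field.
  - apply (X cN (quad 0 1 1 (- 1))). intros y. unfold cN, dot4, quad. field.
Qed.

(** The pairing with cosh (lam (tau - t)) and lam sinh (lam (tau - t)) is constant along the linear saddle;
at t = tau it is the component cN of the difference.  The nonlinear terms contribute rho d, the
forcing r of the second trajectory contributes rr. *)
Lemma hyperbolic_pairing : exists H, 0 <= H /\ forall (x z r : R -> state) (tau rho d rr : R),
  0 <= tau <= 8 ->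
  (forall t, 0 <= t <= tau -> solves_at x t) ->
  (forall t, 0 <= t <= tau -> forall i,
     is_derive (fun s => z s i) t (eval (z t) (S_field i) + r t i)) ->
  (forall t, 0 <= t <= tau -> close_pair rho d (x t) (z t)) ->
  (forall t, 0 <= t <= tau -> inbox rr (r t)) ->
  Rabs (cN (sdiff (x tau) (z tau)) - (cosh (lam * tau) * cN (sdiff (x 0) (z 0))
     + lam * sinh (lam * tau) * cQ (sdiff (x 0) (z 0)))) <= H * (rho * d + rr).
Proof.
  destruct difference_derive as [C [HC Hdd]].
  assert (hl := lam_bounds).
  set (Ch := cosh (8 * lam)).
  assert (hCh : 1 <= Ch) by apply cosh_ge1.
  exists (8 * ((3 + 2 * 2) * (Ch * (C + 1)))). split.
  { apply Rmult_le_pos; [lra|]. apply Rmult_le_pos; [lra|]. apply Rmult_le_pos; lra. }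
  intros x z r tau rho d rr Htau Hx Hz Hcl Hr.
  set (D := fun t => sdiff (x t) (z t)).
  set (zeta := fun t => cosh (lam * (tau - t)) * cN (D t) + lam * sinh (lam * (tau - t)) * cQ (D t)).
  assert (Hrd : 0 <= rho * d).
  { destruct (Hcl 0) as [_ [_ [Nx [_ Nd]]]]; [lra|].
    apply Rmult_le_pos; eapply near_ge0; eassumption. }
  assert (Hrr : 0 <= rr).
  { eapply Rle_trans; [apply Rabs_pos|]. apply (Hr 0 ltac:(lra) O). }
  set (B := (3 + 2 * 2) * (Ch * (C + 1)) * (rho * d + rr)).
  assert (Hder : forall t, 0 <= t <= tau -> exists v, is_derive zeta t v /\ Rabs v <= B).
  { intros t Ht.
    destruct (Hdd x z r t rho d (Hx t Ht) (Hz t Ht) (Hcl t Ht)) as [g [Hg HD]].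
    set (h := fun i => g i - r t i).
    assert (Hh : inbox ((C + 1) * (rho * d + rr)) h).
    { intros i. unfold h. eapply Rle_trans; [apply Rabs_triang|]. rewrite Rabs_Ropp.
      specialize (Hg i). assert (hr := Hr t Ht i).
      assert (0 <= C * rr) by (apply Rmult_le_pos; lra). lra. }
    destruct (is_derive_combination D (fun i => equil_lin (D t) i + h i) t) as [_ [_ [HQ HN]]].
    { intros i. eapply is_derive_R; [apply HD|]. unfold h, D. ring. }
    destruct (equil_lin_normal (D t)) as [_ [_ [LQ LN]]].
    destruct (normal_le h _ Hh) as [_ [_ [BQ BN]]].
    exists (cosh (lam * (tau - t)) * cN h + lam * sinh (lam * (tau - t)) * cQ h). split.
    - assert (XQ : is_derive (fun s => cQ (D s)) t (cN (D t) + cQ h)).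
      { eapply is_derive_R; [exact HQ|]. rewrite <- LQ. unfold cQ. field. }
      assert (XN : is_derive (fun s => cN (D s)) t (lam ^ 2 * cQ (D t) + cN h)).
      { eapply is_derive_R; [exact HN|]. rewrite <- LN. unfold cN. field. }
      assert (Dc : is_derive (fun t => cosh (lam * (tau - t))) t (- lam * sinh (lam * (tau - t)))).
      { unfold cosh, sinh. auto_derive; [trivial|]. unfold Rminus. field. }
      assert (Ds : is_derive (fun t => sinh (lam * (tau - t))) t (- lam * cosh (lam * (tau - t)))).
      { unfold cosh, sinh. auto_derive; [trivial|]. unfold Rminus. field. }
      apply (is_derive_R _ t
        ((- lam * sinh (lam * (tau - t)) * cN (D t) + cosh (lam * (tau - t)) * (lam ^ 2 * cQ (D t) + cN h))
        + lam * (- lam * cosh (lam * (tau - t)) * cQ (D t) + sinh (lam * (tau - t)) * (cN (D t) + cQ h))));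
        [|ring].
      apply (is_derive_ext (fun t => cosh (lam * (tau - t)) * cN (D t)
        + lam * (sinh (lam * (tau - t)) * cQ (D t)))).
      { intros u. unfold zeta. apply Rplus_eq_compat_l. symmetry; apply Rmult_assoc. }
      apply @is_derive_plus.
      + apply (is_derive_mul (fun t => cosh (lam * (tau - t))) (fun t => cN (D t))); assumption.
      + apply (is_derive_scal (fun t => sinh (lam * (tau - t)) * cQ (D t))).
        apply (is_derive_mul (fun t => sinh (lam * (tau - t))) (fun t => cQ (D t))); assumption.
    - assert (hc : cosh (lam * (tau - t)) <= Ch) by (apply cosh_mono; split; nra).
      assert (hc1 := cosh_ge1 (lam * (tau - t))).
      assert (hs := Rabs_sinh_le (lam * (tau - t))).
      unfold B.
      replace ((3 + 2 * 2) * (Ch * (C + 1)) * (rho * d + rr)) with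
        (Ch * (3 * ((C + 1) * (rho * d + rr))) + 2 * Ch * (2 * ((C + 1) * (rho * d + rr)))) by ring.
      apply Rabs_plus_le; apply Rabs_mult_le; auto.
      + rewrite Rabs_pos_eq; lra.
      + apply Rabs_mult_le; [rewrite Rabs_pos_eq; lra | lra]. }
  assert (Hend : Rabs (zeta tau - zeta 0) <= B * tau - B * 0).
  { apply (derive_bound zeta (fun t => B * t) (fun _ => B)); [lra | exact Hder |].
    intros t _. apply is_derive_linear. }
  assert (E : zeta tau = cN (D tau)).
  { unfold zeta. rewrite Rminus_eq_0, Rmult_0_r, cosh_0, sinh_0. ring. }
  rewrite E in Hend. unfold zeta in Hend. rewrite !Rminus_0_r in Hend.
  eapply Rle_trans; [exact Hend|].
  assert (HB : 0 <= B).
  { unfold B. apply Rmult_le_pos; [|lra]. apply Rmult_le_pos; [lra|]. apply Rmult_le_pos; lra. }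
  assert (B * tau <= B * 8) by (apply Rmult_le_compat_l; lra).
  unfold B in *. lra.
Qed.

Lemma cM_minus (x y : state) : cM (fun i => x i - y i) = cM x - cM y.
Proof. unfold cM. ring. Qed.

Lemma cP_minus (x y : state) : cP (fun i => x i - y i) = cP x - cP y.
Proof. unfold cP. field. Qed.

Lemma cN_minus (x y : state) : cN (fun i => x i - y i) = cN x - cN y.
Proof. unfold cN. ring. Qed.

Lemma lam2_bounds : 1 <= lam ^ 2 <= 3 / 2.
Proof.
  assert (h := lam_bounds). assert (h4 := lam4).
  replace (lam ^ 4) with (lam ^ 2 * lam ^ 2) in h4 by ring. split; nra.
Qed.

Lemma freq_bounds (e k : R) : 0 <= k * e ^ 2 <= 1 / 2 -> 1 / 2 <= freq e k <= 2 /\ freq e k <= lam.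
Proof. intros H. assert (h := lam_bounds). unfold freq. repeat split; nra. Qed.

Lemma half_period_bounds (e k : R) : 0 <= k * e ^ 2 <= 1 / 2 ->
  0 <= PI / freq e k <= 8 /\ PI <= PI / freq e k * lam.
Proof.
  intros H. destruct (freq_bounds e k H) as [[h1 h2] h3]. assert (hl := lam_bounds).
  assert (hp := PI_RGT_0). assert (hp4 := PI_4).
  split; [split|].
  - apply Rlt_le, Rdiv_lt_0_compat; lra.
  - apply Rle_div_l; lra.
  - apply Rle_trans with (PI / freq e k * freq e k).
    + apply Req_le. field. lra.
    + apply Rmult_le_compat_l; [|exact h3]. apply Rlt_le, Rdiv_lt_0_compat; lra.
Qed.

(** The pairing with the mode (cos, O sin) of frequency O = freq e k is nearly constant along the linear
oscillator, of frequency lam, and equals - cM at the half period.  Its derivative is minus the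
oscillator part of the residual, up to terms of order four. *)
Lemma elliptic_pairing : exists H, 0 <= H /\ forall (e k : R) (x : R -> state) (rho d : R),
  0 < e <= 1 -> 0 <= k <= 2 -> k * e ^ 2 <= 1 / 2 ->
  let tau := PI / freq e k in
  (forall t, 0 <= t <= tau -> solves_at x t) ->
  (forall t, 0 <= t <= tau -> close_pair rho d (x t) (approx_at e k t)) ->
  cM (sdiff (x 0) (approx_at e k 0)) = 0 ->
  Rabs (cM (sdiff (x tau) (approx_at e k tau)) - e ^ 3 * (tau * lam ^ 2 * (k - cstar)))
    <= H * (rho * d + e ^ 2 * d + e ^ 4).
Proof.
  destruct difference_derive as [C [HC Hdd]].
  destruct (eval_lipschitz 3 res_osc) as [L [HL Hlip]].
  assert (hl := lam_bounds). assert (hl2 := lam2_bounds). assert (h4 := lam4).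
  exists (8 * (7 * C + 32 + L)). split; [lra|].
  intros e k x rho d He Hk Hke tau Hx Hcl H0.
  assert (Hke0 : 0 <= k * e ^ 2) by (apply Rmult_le_pos; [lra | apply pow_le; lra]).
  destruct (freq_bounds e k (conj Hke0 Hke)) as [[hO1 hO2] hO3].
  destruct (half_period_bounds e k (conj Hke0 Hke)) as [Htau _]. fold tau in Htau.
  set (O := freq e k) in *.
  set (D := fun t => sdiff (x t) (approx_at e k t)).
  set (b2 := - (3 / 10) - lam ^ 2 / 20). set (b := - (11 / 10) - 53 / 40 * lam ^ 2).
  set (a4 := 1 + 7 / 10 * lam ^ 2).
  (* a primitive of the leading part of the residual; over a half period only its mean survives *)
  set (Gam := fun t => (k * lam ^ 2 + b2) * t + b / 2 * (t + cos (O * t) * sin (O * t) / O)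
    + a4 * (3 / 8 * (t + cos (O * t) * sin (O * t) / O) + cos (O * t) ^ 3 * sin (O * t) / (4 * O))).
  assert (DG : forall t, is_derive Gam t (eval (approx_env 0 k (cos (O * t)) (sin (O * t))) res_osc)).
  { intros t. rewrite (res_osc_leading k _ _ (cos_sin_sq _)). fold b2 b a4.
    assert (hs : sin (O * t) ^ 2 = 1 - cos (O * t) ^ 2) by (assert (h := cos_sin_sq (O * t)); lra).
    unfold Gam. auto_derive; [repeat split; lra|].
    set (cc := cos (O * t)) in *. set (ss := sin (O * t)) in *.
    field [hs]. lra. }
  destruct (Hcl 0 ltac:(lra)) as [_ [_ [Nx0 [_ Nd0]]]].
  assert (hd0 := near_ge0 _ _ _ Nd0). assert (hrho0 := near_ge0 _ _ _ Nx0).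
  assert (hrd : 0 <= rho * d) by (apply Rmult_le_pos; lra).
  assert (he2 : 0 <= e ^ 2) by (apply pow_le; lra).
  assert (he2d : 0 <= e ^ 2 * d) by (apply Rmult_le_pos; lra).
  assert (he4 : 0 <= e ^ 4) by (apply pow_le; lra).
  assert (he3 : 0 <= e ^ 3) by (apply pow_le; lra).
  set (B := (7 * C + 32 + L) * (rho * d + e ^ 2 * d + e ^ 4)).
  set (eta := fun t => (cos (O * t) * cM (D t) + O * (sin (O * t) * cP (D t))) + e ^ 3 * Gam t).
  assert (Hder : forall t, 0 <= t <= tau -> exists v, is_derive eta t v /\ Rabs v <= B).
  { intros t Ht.
    destruct (Hdd x (approx_at e k) (residual_at e k) t rho d (Hx t Ht) (approx_at_derive e k t) (Hcl t Ht))
      as [g [Hg HD]].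
    destruct (is_derive_combination D _ t HD) as [HP [HM [_ _]]].
    fold (D t) in HP, HM. fold O in HP, HM.
    destruct (equil_lin_normal (D t)) as [LP [LM _]].
    destruct (residual_normal e k (cos (O * t)) (sin (O * t)) (cos_sin_sq _)) as [RP [RM _]].
    destruct (normal_le g _ Hg) as [BP [BM _]].
    set (cc := cos (O * t)) in *. set (ss := sin (O * t)) in *.
    set (S1 := eval (approx_env e k cc ss) res_osc). set (S0 := eval (approx_env 0 k cc ss) res_osc).
    exists ((O ^ 2 - lam ^ 2) * (cc * cP (D t)) + cc * cM g + O * (ss * cP g) + e ^ 3 * - (S1 - S0)).
    split.
    - assert (HP' : is_derive (fun s => cP (D s)) t (cM (D t) + cP g - e ^ 3 * eval (approx_env e k cc ss) res_p)).
      { eapply is_derive_R; [exact HP|]. rewrite <- LP, <- RP. unfold cP, residual_at. fold O cc ss. field. }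
      assert (HM' : is_derive (fun s => cM (D s)) t
        (- lam ^ 2 * cP (D t) + cM g - e ^ 3 * eval (approx_env e k cc ss) res_m)).
      { eapply is_derive_R; [exact HM|]. rewrite <- LM, <- RM. unfold cM, residual_at. fold O cc ss. field. }
      assert (Dc : is_derive (fun t => cos (O * t)) t (- O * ss)).
      { auto_derive; [trivial|]. unfold ss. ring. }
      assert (Ds : is_derive (fun t => sin (O * t)) t (O * cc)).
      { auto_derive; [trivial|]. unfold cc. ring. }
      apply (is_derive_R _ t
        (((- O * ss * cM (D t) + cc * (- lam ^ 2 * cP (D t) + cM g - e ^ 3 * eval (approx_env e k cc ss) res_m))
        + O * (O * cc * cP (D t) + ss * (cM (D t) + cP g - e ^ 3 * eval (approx_env e k cc ss) res_p)))
        + e ^ 3 * S0)).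
      2:{ unfold S1, res_osc. simpl eval. unfold O, freq. cbn [approx_env quad]. ring. }
      apply @is_derive_plus; [apply @is_derive_plus|].
      + apply (is_derive_mul (fun t => cos (O * t)) (fun t => cM (D t))); assumption.
      + apply (is_derive_scal (fun t => sin (O * t) * cP (D t))).
        apply (is_derive_mul (fun t => sin (O * t)) (fun t => cP (D t))); assumption.
      + apply (is_derive_scal Gam), DG.
    - assert (hc : Rabs cc <= 1) by apply Rabs_le, COS_bound.
      assert (hs : Rabs ss <= 1) by apply Rabs_le, SIN_bound.
      assert (hO : Rabs (O ^ 2 - lam ^ 2) <= 16 * e ^ 2).
      { replace (O ^ 2 - lam ^ 2) with (- (lam ^ 2 * (k * e ^ 2) * (2 - k * e ^ 2)))
          by (unfold O, freq; ring).
        rewrite Rabs_Ropp, Rabs_pos_eq by (apply Rmult_le_pos; [apply Rmult_le_pos|]; lra).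
        assert (k * e ^ 2 <= 2 * e ^ 2) by (apply Rmult_le_compat_r; lra).
        assert (lam ^ 2 * (k * e ^ 2) <= 2 * (2 * e ^ 2)) by (apply Rmult_le_compat; lra).
        assert (0 <= lam ^ 2 * (k * e ^ 2)) by (apply Rmult_le_pos; lra). nra. }
      assert (hP : Rabs (cP (D t)) <= 2 * d) by (apply normal_le; apply (Hcl t Ht)).
      assert (hS : Rabs (S1 - S0) <= L * e).
      { apply Hlip.
        - apply approx_env_inbox; try lra. apply cos_sin_sq.
        - apply approx_env_inbox; try lra. apply cos_sin_sq.
        - intros j. destruct j as [|[|[|[|j]]]]; unfold approx_env, quad;
            rewrite ?Rminus_0_r, ?Rminus_eq_0, ?Rabs_R0; try lra.
          rewrite Rabs_pos_eq; lra. }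
      apply Rle_trans with (16 * e ^ 2 * (1 * (2 * d)) + 1 * (3 * (C * (rho * d)))
        + 2 * (1 * (2 * (C * (rho * d)))) + e ^ 3 * (L * e)).
      + repeat apply Rabs_plus_le; repeat apply Rabs_mult_le; auto.
        all: try (rewrite Rabs_Ropp; exact hS).
        all: try (rewrite Rabs_pos_eq; lra).
      + unfold B. assert (h1 : 0 <= C * (rho * d)) by (apply Rmult_le_pos; lra).
        assert (h2 : 0 <= C * (e ^ 2 * d)) by (apply Rmult_le_pos; lra).
        assert (h3 : 0 <= C * e ^ 4) by (apply Rmult_le_pos; lra).
        assert (h5 : 0 <= L * (rho * d)) by (apply Rmult_le_pos; lra).
        assert (h6 : 0 <= L * (e ^ 2 * d)) by (apply Rmult_le_pos; lra).
        replace (e ^ 3 * (L * e)) with (L * e ^ 4) by ring. lra. }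
  assert (Hend : Rabs (eta tau - eta 0) <= B * tau - B * 0).
  { apply (derive_bound eta (fun t => B * t) (fun _ => B)); [lra | exact Hder |].
    intros t _. apply is_derive_linear. }
  assert (EO : O * tau = PI) by (unfold tau; field; lra).
  assert (E0 : eta 0 = 0).
  { unfold eta, Gam, D. rewrite H0. replace (O * 0) with 0 by ring. rewrite sin_0. field. lra. }
  assert (E1 : eta tau = - (cM (D tau) - e ^ 3 * (tau * lam ^ 2 * (k - cstar)))).
  { unfold eta, Gam. rewrite EO, cos_PI, sin_PI. unfold b, b2, a4, cstar. field [h4]. lra. }
  rewrite E0, E1, Rminus_0_r, Rabs_Ropp in Hend.
  eapply Rle_trans; [exact Hend|].
  assert (HB : 0 <= B) by (unfold B; apply Rmult_le_pos; lra).
  assert (B * tau <= B * 8) by (apply Rmult_le_compat_l; lra).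
  unfold B in *. lra.
Qed.

(** * Periodic solutions bifurcating from the equilibrium *)

(** The initial points: the approximate solution, corrected by y in the direction cQ of the saddle plane.
They satisfy v = 0 and a = b. *)
Definition start (e y : R) : state := fun i => approx e 1 0 i + y * ofPMQN 0 0 1 0 i.

Lemma unit_PQ (i : nat) : Rabs (ofPMQN 0 0 1 0 i) <= 1.
Proof. destruct i as [|[|[|[|i]]]]; unfold ofPMQN, quad; apply Rabs_le; lra. Qed.

Lemma approx_at_0 (e k : R) (i : nat) : approx_at e k 0 i = approx e 1 0 i.
Proof. unfold approx_at. rewrite Rmult_0_r, cos_0, sin_0. reflexivity. Qed.

Lemma start_lipschitz : exists C, 0 <= C /\ forall e e' y y', 0 <= e <= 1 -> 0 <= e' <= 1 ->
  near (C * (Rabs (e - e') + Rabs (y - y'))) (start e y) (start e' y').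
Proof.
  set (a := Rabs (al0 + al2)). set (b := Rabs (be0 + be2)).
  assert (ha : 0 <= a) by apply Rabs_pos. assert (hb : 0 <= b) by apply Rabs_pos.
  exists (1 + (1 + 2 * a) + 2 * b). split; [lra|].
  intros e e' y y' He He' i.
  assert (hee := Rabs_pos (e - e')). assert (hyy := Rabs_pos (y - y')).
  assert (he2 : Rabs (e ^ 2 - e' ^ 2) <= 2 * Rabs (e - e')).
  { replace (e ^ 2 - e' ^ 2) with ((e + e') * (e - e')) by ring.
    apply Rabs_mult_le; [rewrite Rabs_pos_eq; lra | lra]. }
  set (p := (e - e') + (e ^ 2 - e' ^ 2) * (al0 + al2)).
  set (q := (e ^ 2 - e' ^ 2) * (be0 + be2)).
  assert (Hp : Rabs p <= (1 + 2 * a) * Rabs (e - e')).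
  { replace ((1 + 2 * a) * Rabs (e - e')) with (Rabs (e - e') + 2 * Rabs (e - e') * a) by ring.
    apply Rabs_plus_le; [lra|]. apply Rabs_mult_le; [exact he2 | apply Rle_refl]. }
  assert (Hq : Rabs q <= 2 * b * Rabs (e - e')).
  { replace (2 * b * Rabs (e - e')) with (2 * Rabs (e - e') * b) by ring.
    apply Rabs_mult_le; [exact he2 | apply Rle_refl]. }
  assert (Hb : inbox ((1 + 2 * a) * Rabs (e - e') + 0 + 2 * b * Rabs (e - e') + 0) (ofPMQN p 0 q 0)).
  { destruct (ofPMQN_normal p 0 q 0) as [EP [EM [EQ EN]]]. apply normal_bound.
    - intros j Hj. destruct j as [|[|[|[|j]]]]; try lia. reflexivity.
    - rewrite EP; exact Hp.
    - rewrite EM, Rabs_R0; lra.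
    - rewrite EQ; exact Hq.
    - rewrite EN, Rabs_R0; lra. }
  replace (start e y i - start e' y' i) with (ofPMQN p 0 q 0 i + (y - y') * ofPMQN 0 0 1 0 i).
  - eapply Rle_trans; [apply Rabs_plus_le; [apply Hb | apply Rabs_mult_le;
      [apply Rle_refl | apply unit_PQ]]|].
    assert (0 <= a * Rabs (y - y')) by (apply Rmult_le_pos; lra).
    assert (0 <= b * Rabs (y - y')) by (apply Rmult_le_pos; lra). lra.
  - unfold start, approx, approx_disp, p, q. destruct i as [|[|[|[|i]]]]; unfold ofPMQN, quad; field.
Qed.

(** Over the time interval [0, 8], which contains all half periods, trajectories stay at a distance O(e) from
the equilibrium and, by Gronwall's inequality with the residual as forcing, at a distance
O(|y| + e^3) from the approximate solution. *)
Lemma tracking : exists C e0, 1 <= C /\ 0 < e0 <= 1 /\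
  forall (e k y : R) (x : R -> state), 0 < e <= e0 -> 0 <= k <= 2 -> Rabs y <= e ->
  (forall t, csolves_at x t) -> supp4 x -> (forall i, x 0 i = start e y i) ->
  forall t, 0 <= t <= 8 ->
    close_pair (C * e) (C * (Rabs y + e ^ 3)) (x t) (approx_at e k t).
Proof.
  destruct csolves_dependence_global as [L0 [HL0 Hdep]].
  destruct approx_disp_bound as [C1 [HC1 Happ]].
  destruct residual_bound as [C2 [HC2 Hres]].
  destruct (poly_family_lipschitz S_field 3 S_field_ge4) as [L [HL Hlip]].
  set (Ca := 2 * (C1 + 1) * exp (L0 * 8)).
  assert (He8 : 1 <= exp (L0 * 8)) by (assert (h := exp_ineq1_le (L0 * 8)); lra).
  assert (HCa : C1 + 1 <= Ca) by (unfold Ca; nra).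
  set (Cb := 2 * (C2 + 1) * exp (4 * ((L + 1) * 8))).
  assert (HCb : 0 <= Cb).
  { unfold Cb. apply Rmult_le_pos; [lra | apply Rlt_le, exp_pos]. }
  exists (Ca + Cb + 1), (/ (Ca + 1)).
  split; [lra|]. split.
  { split; [apply Rinv_0_lt_compat; lra|]. rewrite <- Rinv_1. apply Rinv_le_contravar; lra. }
  intros e k y x He Hk Hy Hx Sx Hx0.
  assert (HCe : Ca * e <= 1).
  { destruct He as [He He']. apply (Rmult_le_compat_l (Ca + 1)) in He'; [|lra].
    rewrite Rinv_r in He' by lra. lra. }
  assert (He1 : 0 <= e <= 1) by (split; nra).
  assert (he3 : 0 <= e ^ 3) by (apply pow_le; lra).
  assert (Hy0 := Rabs_pos y).
  assert (Beq : inbox 2 equil).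
  { assert (h := lam2_bounds). intros i. destruct i as [|[|[|[|i]]]]; unfold equil, quad; apply Rabs_le; lra. }
  assert (Beq3 : inbox 3 equil) by (intros i; specialize (Beq i); lra).
  assert (Hb3 : forall z, near (Ca * e) z equil -> inbox 3 z).
  { intros z Hz j. replace (z j) with ((z j - equil j) + equil j) by ring.
    eapply Rle_trans; [apply Rabs_plus_le; [apply Hz | apply Beq]|]. lra. }
  assert (N2 : forall t, near (Ca * e) (approx_at e k t) equil).
  { intros t j. unfold approx_at, approx.
    replace (equil j + _ - equil j) with (approx_disp e (cos (freq e k * t)) (sin (freq e k * t)) j) by ring.
    eapply Rle_trans; [apply Happ; [lra | apply cos_sin_sq]|]. apply Rmult_le_compat_r; lra. }
  assert (N1 : forall t, 0 <= t <= 8 -> near (Ca * e) (x t) equil).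
  { intros t Ht.
    apply near_le with (2 * ((C1 + 1) * e) * exp (L0 * Rabs (t - 0))).
    - replace (Ca * e) with (2 * ((C1 + 1) * e) * exp (L0 * 8)) by (unfold Ca; ring).
      apply Rmult_le_compat_l.
      + apply Rmult_le_pos; [lra|]. apply Rmult_le_pos; lra.
      + rewrite Rminus_0_r, Rabs_pos_eq by lra.
        apply exp_mono. nra.
    - apply (Hdep x (fun _ => equil) 0 t); auto.
      + intros s. apply csolves_of_solves; [exact Beq3 | apply equil_solves].
      + apply equil_bounded_solution.
      + intros j. rewrite Hx0. unfold start, approx.
        replace (_ - _) with (approx_disp e 1 0 j + y * ofPMQN 0 0 1 0 j) by ring.
        replace ((C1 + 1) * e) with (C1 * e + e * 1) by ring.
        apply Rabs_plus_le; [apply Happ; lra|]. apply Rabs_mult_le; [exact Hy | apply unit_PQ]. }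
  assert (N3 : forall t, 0 <= t <= 8 -> near (Cb * (Rabs y + e ^ 3)) (x t) (approx_at e k t)).
  { intros t Ht.
    assert (h := trajectories_near x (approx_at e k) (fun t i => eval (x t) (S_field i))
      (fun t i => eval (approx_at e k t) (S_field i) + residual_at e k t i)
      (fun t => (L + 1) * t) (fun _ => L + 1) 0 t (C2 * e ^ 3) (Rabs y)).
    apply near_le with (2 * (Rabs y + C2 * e ^ 3) * exp (4 * ((L + 1) * t - (L + 1) * 0))).
    - replace (Cb * (Rabs y + e ^ 3)) with (2 * ((C2 + 1) * (Rabs y + e ^ 3)) * exp (4 * ((L + 1) * 8)))
        by (unfold Cb; ring).
      apply Rmult_le_compat.
      + assert (0 <= C2 * e ^ 3) by (apply Rmult_le_pos; lra). lra.
      + apply Rlt_le, exp_pos.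
      + assert (0 <= C2 * Rabs y) by (apply Rmult_le_pos; lra). lra.
      + apply exp_mono. nra.
    - apply h; try lra.
      + apply Rmult_le_pos; lra.
      + intros s Hs i. apply solves_of_csolves; [apply Hb3, N1; lra | apply Hx].
      + intros s Hs i. apply approx_at_derive.
      + intros s j Hj. rewrite Sx by auto.
        destruct j as [|[|[|[|j]]]]; try lia. unfold approx_at, approx, approx_disp, ofPMQN, equil, quad. ring.
      + intros s _. apply is_derive_linear.
      + intros s Hs i r Hr.
        assert (Hr0 := near_ge0 _ _ _ Hr).
        assert (B1 : Rabs (eval (x s) (S_field i) - eval (approx_at e k s) (S_field i)) <= L * r).
        { apply Hlip; [apply Hb3, N1; lra | apply Hb3, N2 | exact Hr]. }
        assert (B2 : Rabs (residual_at e k s i) <= C2 * e ^ 3) by (apply Hres; auto; apply cos_sin_sq).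
        set (rho := C2 * e ^ 3) in *.
        assert (B3 : Rabs ((x s i - approx_at e k s i) * (eval (x s) (S_field i) -
           (eval (approx_at e k s) (S_field i) + residual_at e k s i))) <= r * (L * r + rho)).
        { apply Rabs_mult_le; [apply Hr|].
          replace (_ - _) with ((eval (x s) (S_field i) - eval (approx_at e k s) (S_field i))
            + - residual_at e k s i) by ring.
          apply Rabs_plus_le; [exact B1 | rewrite Rabs_Ropp; exact B2]. }
        eapply Rle_trans; [apply Rle_abs|]. eapply Rle_trans; [exact B3|].
        assert (hq := pow2_ge_0 (r - rho)). assert (0 <= L * rho ^ 2).
        { apply Rmult_le_pos; [lra | apply pow2_ge_0]. }
        assert (0 <= r ^ 2) by apply pow2_ge_0. nra.
      + intros j. rewrite Hx0, approx_at_0. unfold start.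
        replace (_ - _) with (y * ofPMQN 0 0 1 0 j) by ring.
        rewrite <- (Rmult_1_r (Rabs y)). apply Rabs_mult_le; [lra | apply unit_PQ]. }
  intros t Ht.
  assert (hm : forall a b w, 0 <= w -> 0 <= a -> 0 <= b -> a * w <= (a + b + 1) * w /\ b * w <= (a + b + 1) * w).
  { intros a b w Hw Ha Hb. split; apply Rmult_le_compat_r; lra. }
  split; [|split; [|split; [|split]]].
  - apply Hb3, N1, Ht.
  - apply Hb3, N2.
  - eapply near_le; [|apply N1, Ht]. apply hm; lra.
  - eapply near_le; [|apply N2]. apply hm; lra.
  - eapply near_le; [|apply N3, Ht]. apply hm; lra.
Qed.

Lemma cstar_bounds : 9 / 20 <= cstar <= 1.
Proof. assert (h := lam2_bounds). unfold cstar. lra. Qed.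

(** For a fixed half period, that is a fixed kap = k e^2, the unknowns are the amplitude e and the
correction y.  The amplitude ranges over [x0, 2 x0], where k decreases from 2 cstar to cstar / 2. *)
Lemma periodic_near_equilibrium : exists K kap1, 0 < K /\ 0 < kap1 < 1 /\
  forall kap, 0 < kap < kap1 -> let tau := PI / (lam * (1 - kap)) in
  exists W, bounded_solution W /\ (forall t i, W (t + 2 * tau) i = W t i) /\
    near (K * sqrt kap) (W 0) equil /\ ~ (forall i, W 0 i = W tau i).
Proof.
  destruct tracking as [C [e0 [HC [He0 Htrack]]]].
  destruct hyperbolic_pairing as [Hh [HHh Hhyp]].
  destruct elliptic_pairing as [He [HHe Hell]].
  destruct residual_bound as [C2 [HC2 Hres]].
  destruct start_lipschitz as [Cs [HCs Hstart]].
  destruct csolves_dependence_global as [L0 [HL0 Hdep]].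
  assert (hl := lam_bounds). assert (hl2 := lam2_bounds). assert (hc := cstar_bounds).
  assert (hpi := PI_RGT_0). assert (hpi2 := PI2_1).
  set (C3 := 2 * exp (L0 * 8)).
  assert (HC3 : 0 < C3) by (unfold C3; assert (h := exp_pos (L0 * 8)); lra).
  (* the correction y is sought below Y e^3 up to the factor 8 = (x1 / x0)^3; D e^3 then bounds the
     distance to the approximate solution, E e^4 the error of the oscillator condition, and 1 / Q the
     amplitudes that are admitted *)
  set (Y := 4 * (Hh * (C * C + C2)) + 1).
  assert (HCC : 0 <= C * C) by nra.
  assert (HhC : 0 <= Hh * (C * C + C2)) by (apply Rmult_le_pos; lra).
  assert (HhCC : 0 <= Hh * (C * C)) by (apply Rmult_le_pos; lra).
  assert (HY : 1 <= Y) by (unfold Y; lra).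
  set (D := C * (8 * Y + 1)).
  assert (HD : 0 <= D) by (unfold D; apply Rmult_le_pos; lra).
  set (E := He * (C * D + D + 1)).
  assert (HCD : 0 <= C * D) by (apply Rmult_le_pos; lra).
  assert (HE : 0 <= E) by (unfold E; apply Rmult_le_pos; lra).
  set (Q := 4 * (Hh * (C * C)) + 2 * (Hh * (C * C3)) + 10 * E + 4 * D + 8 * Y + 2).
  assert (HhC3 : 0 <= Hh * (C * C3)).
  { apply Rmult_le_pos; [lra|]. apply Rmult_le_pos; lra. }
  assert (HQ : 2 <= Q) by (unfold Q; lra).
  set (em := Rmin e0 (/ Q)).
  assert (Hem : 0 < em).
  { apply Rmin_glb_lt; [lra | apply Rinv_0_lt_compat; lra]. }
  assert (Heme : em <= e0) by apply Rmin_l.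
  assert (HemQ : em * Q <= 1).
  { assert (h : em <= / Q) by apply Rmin_r.
    apply (Rmult_le_compat_r Q) in h; [|lra]. rewrite Rinv_l in h by lra. exact h. }
  assert (Hem1 : em <= 1 / 2) by nra.
  exists (4 * C), (cstar * em ^ 2 / 2).
  assert (Hem2 : 0 < em ^ 2) by (apply pow_lt; lra).
  assert (Hem2' : em ^ 2 <= 1 / 4) by nra.
  split; [lra|]. split; [split; nra|].
  intros kap Hkap tau.
  set (x0 := sqrt (kap / (2 * cstar))). set (x1 := 2 * x0).
  assert (Hx02 : x0 ^ 2 = kap / (2 * cstar)) by (apply pow2_sqrt, Rdiv_le_0_compat; lra).
  assert (Hx0 : 0 < x0) by (apply sqrt_lt_R0, Rdiv_lt_0_compat; lra).
  assert (Hk : kap = 2 * cstar * x0 ^ 2) by (rewrite Hx02; field; lra).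
  assert (Hx1 : x1 <= em).
  { unfold x1. apply Rnot_lt_le. intros Hlt.
    assert (em ^ 2 < (2 * x0) ^ 2) by nra. nra. }
  assert (Hkap1 : kap <= 1 / 8) by nra.
  set (kk := fun e : R => kap / e ^ 2).
  assert (Hkk : forall e, x0 <= e <= x1 -> kk e * e ^ 2 = kap).
  { intros e Hee. unfold kk. field. lra. }
  assert (Hkr : forall e, x0 <= e <= x1 -> 0 <= kk e <= 2).
  { intros e Hee. unfold kk. split.
    - apply Rdiv_le_0_compat; [lra | apply pow_lt; lra].
    - apply Rle_div_l; [apply pow_lt; lra|]. rewrite Hk.
      assert (x0 ^ 2 <= e ^ 2) by (apply pow_incr; lra). nra. }
  assert (HOm : forall e, x0 <= e <= x1 -> PI / freq e (kk e) = tau).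
  { intros e Hee. unfold freq. rewrite Hkk by auto. reflexivity. }
  destruct (half_period_bounds x0 (kk x0)) as [Htau Htaul].
  { rewrite Hkk; unfold x1; lra. }
  rewrite HOm in Htau, Htaul by (unfold x1; lra).
  assert (Htau0 : 0 < tau).
  { assert (0 < tau * lam) by lra. apply Rnot_le_lt. intros Hle. nra. }
  assert (Htl2 : 1 <= tau * lam ^ 2).
  { replace (tau * lam ^ 2) with (tau * lam * lam) by ring. nra. }
  set (r := 8 * Y * x0 ^ 3).
  assert (Hx03 : 0 < x0 ^ 3) by (apply pow_lt; lra).
  assert (Hr : 0 < r) by (unfold r; nra).
  assert (HrY : forall e, x0 <= e <= x1 -> Y * e ^ 3 <= r <= 8 * Y * e ^ 3).
  { intros e Hee. unfold r.
    assert (x0 ^ 3 <= e ^ 3) by (apply pow_incr; lra).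
    assert (e ^ 3 <= x1 ^ 3) by (apply pow_incr; lra).
    assert (x1 ^ 3 = 8 * x0 ^ 3) by (unfold x1; ring). split; nra. }
  assert (Hsmall : forall e, x0 <= e <= x1 -> 0 < e <= em /\ e * Q <= 1).
  { intros e Hee. split; [lra|]. apply Rle_trans with (em * Q); [|exact HemQ].
    apply Rmult_le_compat_r; lra. }
  assert (Hre : forall e, x0 <= e <= x1 -> r <= e).
  { intros e Hee. destruct (HrY e Hee) as [_ h]. eapply Rle_trans; [exact h|].
    destruct (Hsmall e Hee) as [h1 h2].
    assert (8 * Y * e <= 1).
    { assert (e * (8 * Y) <= e * Q) by (apply Rmult_le_compat_l; [lra | unfold Q; lra]). lra. }
    replace (8 * Y * e ^ 3) with (8 * Y * e * (e * e)) by ring.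
    assert (0 <= e * e <= e) by (split; nra). nra. }
  destruct (functional_choice (fun (p : R * R) (x : R -> state) =>
    (forall i, x 0 i = start (fst p) (snd p) i) /\ (forall t, csolves_at x t) /\ supp4 x))
    as [X HX].
  { intros p. apply csolution_exists. intros j Hj. destruct j as [|[|[|[|j]]]]; try lia.
    unfold start, approx, approx_disp, ofPMQN, equil, quad. ring. }
  assert (Htr : forall e y, x0 <= e <= x1 -> Rabs y <= r -> forall t, 0 <= t <= tau ->
    close_pair (C * e) (C * (Rabs y + e ^ 3)) (X (e, y) t) (approx_at e (kk e) t)).
  { intros e y Hee Hy t Ht. destruct (HX (e, y)) as [h1 [h2 h3]].
    destruct (Hsmall e Hee) as [h4 _].
    apply (Htrack e (kk e) y (X (e, y))); auto; try lra.
    assert (h := Hre e Hee). lra. }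
  assert (Hsol : forall e y, x0 <= e <= x1 -> Rabs y <= r -> forall t, 0 <= t <= tau ->
    solves_at (X (e, y)) t).
  { intros e y Hee Hy t Ht. destruct (HX (e, y)) as [h1 [h2 h3]].
    apply solves_of_csolves; [apply (Htr e y); auto | apply h2]. }
  assert (Hlipt : forall e y e' y', x0 <= e <= x1 -> x0 <= e' <= x1 -> forall t, 0 <= t <= tau ->
    forall d, near d (start e y) (start e' y') -> near (C3 * d) (X (e, y) t) (X (e', y') t)).
  { intros e y e' y' Hee Hee' t Ht d Hd.
    destruct (HX (e, y)) as [h1 [h2 h3]]. destruct (HX (e', y')) as [h1' [h2' h3']].
    assert (hd := near_ge0 _ _ _ Hd).
    apply near_le with (2 * d * exp (L0 * Rabs (t - 0))).
    - unfold C3. replace (2 * exp (L0 * 8) * d) with (2 * d * exp (L0 * 8)) by ring.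
      apply Rmult_le_compat_l; [lra|]. rewrite Rminus_0_r, Rabs_pos_eq by lra.
      apply exp_mono. nra.
    - apply Hdep; auto. intros j. rewrite h1, h1'. apply Hd. }
  set (f := fun e y => cM (X (e, y) tau)). set (g := fun e y => cN (X (e, y) tau)).
  assert (HS : 1 <= lam * sinh (lam * tau)).
  { assert (h := sinh_half_le (lam * tau) ltac:(nra)). nra. }
  set (S := lam * sinh (lam * tau)) in *.
  assert (Hcs : forall y e k, cQ (sdiff (start e y) (approx_at e k 0)) = y /\
     cN (sdiff (start e y) (approx_at e k 0)) = 0 /\ cM (sdiff (start e y) (approx_at e k 0)) = 0).
  { intros y e k. unfold cQ, cN, cM, sdiff. rewrite !approx_at_0.
    unfold start, ofPMQN, quad. split; [|split]; field. }
  assert (HA : forall e, x0 <= e <= x1 -> cN (approx_at e (kk e) tau) = 0 /\ cM (approx_at e (kk e) tau) = 0).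
  { intros e Hee. unfold approx_at.
    replace (freq e (kk e) * tau) with PI.
    - rewrite cos_PI, sin_PI. unfold cN, cM, approx, approx_disp, ofPMQN, equil, quad. split; field.
    - rewrite <- (HOm e Hee). destruct (freq_bounds e (kk e)) as [h _]; [rewrite Hkk; lra|].
      field. lra. }
  (* the saddle condition is expanding in y *)
  assert (Hg1 : forall e y y', x0 <= e <= x1 -> Rabs y <= r -> Rabs y' <= r ->
    Rabs (g e y - g e y' - S * (y - y')) <= 1 / 2 * Rabs (y - y')).
  { intros e y y' Hee Hy Hy'.
    destruct (HX (e, y)) as [i1 _]. destruct (HX (e, y')) as [i2 _]. simpl fst in *; simpl snd in *.
    assert (Hd : near (Rabs (y - y')) (start e y) (start e y')).
    { intros j. unfold start.
      replace (_ - _) with ((y - y') * ofPMQN 0 0 1 0 j) by ring.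
      rewrite <- (Rmult_1_r (Rabs (y - y'))). apply Rabs_mult_le; [lra | apply unit_PQ]. }
    assert (P := Hhyp (X (e, y)) (X (e, y')) (fun _ _ => 0) tau (C * e) (C3 * Rabs (y - y')) 0 Htau).
    assert (P' : Rabs (cN (sdiff (X (e, y) tau) (X (e, y') tau)) -
      (cosh (lam * tau) * cN (sdiff (X (e, y) 0) (X (e, y') 0)) +
       lam * sinh (lam * tau) * cQ (sdiff (X (e, y) 0) (X (e, y') 0)))) <=
      Hh * (C * e * (C3 * Rabs (y - y')) + 0)).
    { apply P.
      - intros t Ht. apply Hsol; auto.
      - intros t Ht i. rewrite Rplus_0_r. apply Hsol; auto.
      - intros t Ht. destruct (Htr e y Hee Hy t Ht) as [b1 [_ [n1 _]]].
        destruct (Htr e y' Hee Hy' t Ht) as [b2 [_ [n2 _]]].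
        split; [auto|split; [auto|split; [auto|split; [auto|apply Hlipt; auto]]]].
      - intros t Ht i. rewrite Rabs_R0. lra. }
    replace (cN (sdiff (X (e, y) 0) (X (e, y') 0))) with 0 in P'.
    2:{ unfold cN, sdiff. rewrite !i1, !i2. unfold start, ofPMQN, quad. field. }
    replace (cQ (sdiff (X (e, y) 0) (X (e, y') 0))) with (y - y') in P'.
    2:{ unfold cQ, sdiff. rewrite !i1, !i2. unfold start, ofPMQN, quad. field. }
    unfold sdiff in P'. rewrite cN_minus in P'. fold S in P'.
    unfold g. rewrite Rmult_0_r, Rplus_0_l, Rplus_0_r in P'.
    eapply Rle_trans; [exact P'|].
    replace (Hh * (C * e * (C3 * Rabs (y - y')))) with (Hh * (C * C3) * e * Rabs (y - y')) by ring.
    apply Rmult_le_compat_r; [apply Rabs_pos|].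
    destruct (Hsmall e Hee) as [h1 h2].
    assert (e * (2 * (Hh * (C * C3))) <= e * Q) by (apply Rmult_le_compat_l; [lra | unfold Q; lra]).
    lra. }
  (* the saddle condition has the sign of y at y = r and y = - r *)
  assert (Hg2 : forall e y, x0 <= e <= x1 -> Rabs y <= r -> Rabs (g e y - S * y) <= r / 2).
  { intros e y Hee Hy.
    destruct (HX (e, y)) as [i1 _]. simpl fst in *; simpl snd in *.
    destruct (Hsmall e Hee) as [h1 h2].
    assert (P : Rabs (cN (sdiff (X (e, y) tau) (approx_at e (kk e) tau)) -
      (cosh (lam * tau) * cN (sdiff (X (e, y) 0) (approx_at e (kk e) 0)) +
       lam * sinh (lam * tau) * cQ (sdiff (X (e, y) 0) (approx_at e (kk e) 0)))) <=
      Hh * (C * e * (C * (Rabs y + e ^ 3)) + C2 * e ^ 3)).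
    { apply (Hhyp (X (e, y)) (approx_at e (kk e)) (residual_at e (kk e)) tau).
      - exact Htau.
      - intros t Ht. apply Hsol; auto.
      - intros t Ht i. apply approx_at_derive.
      - intros t Ht. apply Htr; auto.
      - intros t Ht. apply Hres; [lra | apply Hkr, Hee | apply cos_sin_sq]. }
    destruct (Hcs y e (kk e)) as [EQ [EN _]].
    replace (cN (sdiff (X (e, y) 0) (approx_at e (kk e) 0))) with 0 in P.
    2:{ etransitivity; [symmetry; exact EN|]. unfold cN, sdiff. rewrite !i1. reflexivity. }
    replace (cQ (sdiff (X (e, y) 0) (approx_at e (kk e) 0))) with y in P.
    2:{ etransitivity; [symmetry; exact EQ|]. unfold cQ, sdiff. rewrite !i1. reflexivity. }
    unfold sdiff in P. rewrite cN_minus, (proj1 (HA e Hee)) in P. fold S in P.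
    unfold g. rewrite Rmult_0_r, Rplus_0_l, Rminus_0_r in P.
    eapply Rle_trans; [exact P|].
    assert (he3 : 0 <= e ^ 3) by (apply pow_le; lra).
    destruct (HrY e Hee) as [hr1 _].
    assert (b1 : Hh * (C * C) * e * Rabs y <= 1 / 4 * r).
    { assert (e * (4 * (Hh * (C * C))) <= e * Q) by (apply Rmult_le_compat_l; [lra | unfold Q; lra]).
      apply Rmult_le_compat; try lra; [apply Rmult_le_pos; lra | apply Rabs_pos]. }
    assert (b2 : Hh * (C * C) * (e * e ^ 3) <= Hh * (C * C) * e ^ 3).
    { apply Rmult_le_compat_l; [lra|]. nra. }
    assert (b3 : Hh * (C * C + C2) * e ^ 3 <= r / 4).
    { assert (4 * (Hh * (C * C + C2)) * e ^ 3 <= Y * e ^ 3)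
        by (apply Rmult_le_compat_r; [lra | unfold Y; lra]). lra. }
    replace (Hh * (C * e * (C * (Rabs y + e ^ 3)) + C2 * e ^ 3)) with
      (Hh * (C * C) * e * Rabs y + (Hh * (C * C) * (e * e ^ 3) + Hh * C2 * e ^ 3)) by ring.
    lra. }
  assert (Hd3 : forall e y, x0 <= e <= x1 -> Rabs y <= r -> C * (Rabs y + e ^ 3) <= D * e ^ 3).
  { intros e y Hee Hy. destruct (HrY e Hee) as [_ hr2]. unfold D.
    rewrite Rmult_assoc. apply Rmult_le_compat_l; lra. }
  (* the oscillator condition has the sign of k - cstar *)
  assert (Hf : forall e y, x0 <= e <= x1 -> Rabs y <= r ->
    Rabs (f e y - e ^ 3 * (tau * lam ^ 2 * (kk e - cstar))) <= 1 / 10 * e ^ 3).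
  { intros e y Hee Hy.
    destruct (HX (e, y)) as [i1 _]. simpl fst in *; simpl snd in *.
    destruct (Hsmall e Hee) as [h1 h2].
    assert (Hke : kk e * e ^ 2 <= 1 / 2) by (rewrite Hkk; lra).
    assert (P := Hell e (kk e) (X (e, y)) (C * e) (D * e ^ 3) ltac:(lra) (Hkr e Hee) Hke).
    cbv zeta in P. rewrite (HOm e Hee) in P.
    assert (P' : Rabs (cM (sdiff (X (e, y) tau) (approx_at e (kk e) tau)) -
      e ^ 3 * (tau * lam ^ 2 * (kk e - cstar))) <=
      He * (C * e * (D * e ^ 3) + e ^ 2 * (D * e ^ 3) + e ^ 4)).
    { apply P.
      - intros t Ht. apply Hsol; auto.
      - intros t Ht. destruct (Htr e y Hee Hy t Ht) as [b1 [b2 [n1 [n2 n3]]]].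
        split; [auto|split; [auto|split; [auto|split; [auto|]]]].
        eapply near_le; [apply (Hd3 e y); auto | exact n3].
      - destruct (Hcs y e (kk e)) as [_ [_ EM]]. etransitivity; [|exact EM]. unfold cM, sdiff.
        rewrite !i1. reflexivity. }
    unfold sdiff in P'. rewrite cM_minus, (proj2 (HA e Hee)), Rminus_0_r in P'.
    eapply Rle_trans; [exact P'|].
    assert (he3 : 0 <= e ^ 3) by (apply pow_le; lra).
    assert (he4 : 0 <= e ^ 4) by (apply pow_le; lra).
    assert (b0 : e ^ 5 <= e ^ 4).
    { replace (e ^ 5) with (e ^ 4 * e) by ring. nra. }
    assert (b1 : D * e ^ 5 <= D * e ^ 4) by (apply Rmult_le_compat_l; lra).
    apply Rle_trans with (E * e * e ^ 3).
    - unfold E. replace (He * (C * D + D + 1) * e * e ^ 3) with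
        (He * (C * D * e ^ 4 + D * e ^ 4 + e ^ 4)) by ring.
      apply Rmult_le_compat_l; [lra|].
      replace (C * e * (D * e ^ 3)) with (C * D * e ^ 4) by ring.
      replace (e ^ 2 * (D * e ^ 3)) with (D * e ^ 5) by ring. lra.
    - apply Rmult_le_compat_r; [lra|].
      assert (e * (10 * E) <= e * Q) by (apply Rmult_le_compat_l; [lra | unfold Q; lra]). lra. }
  destruct (nested_root f g x0 x1 r (3 * (C3 * Cs)) (1 / 2)) as [e [y [Hee [Hy [Zf Zg]]]]].
  - unfold x1; lra.
  - lra.
  - apply Rmult_le_pos; [lra|]. apply Rmult_le_pos; lra.
  - lra.
  - intros e e' y y' Hee Hee' Hy Hy'.
    destruct (Hsmall e Hee) as [h1 _]. destruct (Hsmall e' Hee') as [h1' _].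
    assert (hn := Hlipt e y e' y' Hee Hee' tau ltac:(lra) _ (Hstart e e' y y' ltac:(lra) ltac:(lra))).
    destruct (normal_le (fun i => X (e, y) tau i - X (e', y') tau i) _ hn) as [_ [bM [_ bN]]].
    rewrite cM_minus in bM. rewrite cN_minus in bN. unfold f, g. split; lra.
  - intros e y y' Hee Hy Hy'. specialize (Hg1 e y y' Hee Hy Hy').
    assert (h := Rabs_triang_inv (S * (y - y')) (S * (y - y') - (g e y - g e y'))).
    replace (S * (y - y') - (S * (y - y') - (g e y - g e y'))) with (g e y - g e y') in h by ring.
    rewrite (Rabs_minus_sym (S * (y - y'))), Rabs_mult, (Rabs_pos_eq S) in h by lra.
    assert (hp := Rabs_pos (y - y')). nra.
  - intros e Hee.
    assert (g1 := Hg2 e r Hee ltac:(rewrite Rabs_pos_eq; lra)).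
    assert (g2 := Hg2 e (- r) Hee ltac:(rewrite Rabs_Ropp, Rabs_pos_eq; lra)).
    apply Rabs_le_between in g1, g2. split; nra.
  - intros y Hy.
    assert (h := Hf x0 y ltac:(unfold x1; lra) Hy).
    assert (Ek : kk x0 = 2 * cstar) by (unfold kk; rewrite Hk; field; lra).
    rewrite Ek in h. apply Rabs_le_between in h.
    assert (9 / 20 <= tau * lam ^ 2 * (2 * cstar - cstar)) by nra. nra.
  - intros y Hy.
    assert (h := Hf x1 y ltac:(unfold x1; lra) Hy).
    assert (Ek : kk x1 = cstar / 2) by (unfold kk, x1; rewrite Hk; field; lra).
    rewrite Ek in h. apply Rabs_le_between in h.
    assert (Hx13 : 0 < x1 ^ 3) by (apply pow_lt; unfold x1; lra).
    assert (tau * lam ^ 2 * (cstar / 2 - cstar) <= - (9 / 40)) by nra. nra.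
  - destruct (HX (e, y)) as [i1 [_ i3]]. simpl fst in *; simpl snd in *.
    destruct (Hsmall e Hee) as [h1 h2].
    destruct (periodic_extension (X (e, y)) 0 tau) as [W [HW [HP Hag]]]; auto.
    + intros t Ht. apply (Htr e y); auto.
    + unfold symmetric. rewrite !i1. unfold start, approx, approx_disp, ofPMQN, equil, quad. split; field.
    + unfold symmetric. unfold f, g, cM, cN in Zf, Zg. split; lra.
    + exists W. split; [exact HW|]. split; [|split].
      * intros t i. rewrite <- (HP t i). f_equal; ring.
      * apply near_le with (C * e).
        -- replace (4 * C * sqrt kap) with (C * (4 * sqrt kap)) by ring.
           apply Rmult_le_compat_l; [lra|].
           assert (x0 <= 2 * sqrt kap).
           { unfold x0. replace 2 with (sqrt 4) at 2.
             2:{ apply sqrt_lem_1; lra. }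
             rewrite <- sqrt_mult by lra. apply sqrt_le_1_alt.
             apply Rle_div_l; [lra|]. nra. }
           unfold x1 in Hee. lra.
        -- intros j. rewrite Hag by lra. apply (Htr e y); auto; lra.
      * intros Heq.
        assert (EP : cP (X (e, y) 0) = cP (X (e, y) tau)).
        { unfold cP. rewrite <- !(Hag 0), <- !(Hag tau) by lra. rewrite !Heq. reflexivity. }
        destruct (Htr e y Hee Hy 0 ltac:(lra)) as [_ [_ [_ [_ n0]]]].
        destruct (Htr e y Hee Hy tau ltac:(lra)) as [_ [_ [_ [_ n1]]]].
        destruct (normal_le (fun i => X (e, y) 0 i - approx_at e (kk e) 0 i) _ n0) as [b0 _].
        destruct (normal_le (fun i => X (e, y) tau i - approx_at e (kk e) tau i) _ n1) as [b1 _].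
        rewrite cP_minus in b0, b1.
        (* the second-order terms agree at the angles 0 and PI, the first-order term changes sign *)
        assert (EA : cP (approx_at e (kk e) 0) - cP (approx_at e (kk e) tau) = 2 * e).
        { unfold approx_at. replace (freq e (kk e) * tau) with PI.
          - rewrite Rmult_0_r, cos_0, sin_0, cos_PI, sin_PI.
            unfold cP, approx, approx_disp, ofPMQN, equil, quad. field.
          - rewrite <- (HOm e Hee). destruct (freq_bounds e (kk e)) as [h _]; [rewrite Hkk; lra|].
            field. lra. }
        assert (hd := Hd3 e y Hee Hy).
        assert (D * e ^ 3 <= e / 4 * (1 / 2)).
        { assert (e * (4 * D) <= e * Q) by (apply Rmult_le_compat_l; [lra | unfold Q; lra]).
          replace (D * e ^ 3) with ((e * D) * (e * e)) by ring.
          assert (0 <= e * D) by (apply Rmult_le_pos; lra).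
          assert (e * e <= e * (1 / 2)) by (apply Rmult_le_compat_l; lra).
          assert (0 <= e * e) by nra. nra. }
        apply Rabs_le_between in b0, b1. lra.
Qed.

(** * The two families *)

Theorem theorem1p1 :
  exists T1 T2 : R,
    T0 < T1 /\ T1 <= T2 /\
    exists u v a b : R -> R -> R,
      (forall T : R, (T0 < T < T1 \/ T2 < T) ->
         solution (u T) (v T) (a T) (b T) /\
         periodic (2 * T) (u T) (v T) (a T) (b T) /\
         ~ constant_orbit (u T) (v T) (a T) (b T)) /\
      (forall alpha beta : R, 0 < alpha < 1 -> 0 < beta < 1 ->
         family_lim (at_right T0) alpha beta u v a b
           (fun _ => 1) (fun _ => 0)
           (fun _ => 1 / (2 * sqrt 2)) (fun _ => 1 / (2 * sqrt 2))) /\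
      (exists t0 : R,
         forall alpha beta : R, 0 < alpha < 1 -> 0 < beta < 1 ->
           family_lim (Rbar_locally p_infty) alpha beta u v a b
             (fun t => u0 (t - t0)) (fun t => Derive u0 (t - t0))
             (fun t => a0 (t - t0)) (fun t => b0 (t - t0))) /\
      homoclinic u0 (Derive u0) a0 b0.
Proof.
  destruct periodic_near_equilibrium as [K1 [kap1 [HK1 [Hkap1 HE]]]].
  destruct periodic_near_homoclinic as [K2 [S2 [HK2 [HS2 HH]]]].
  assert (hlam := lam_bounds). assert (hT0 := T0_lam). assert (hpi := PI_RGT_0).
  assert (HT0 : 0 < T0) by (apply Rmult_lt_reg_r with lam; lra).
  set (T1 := T0 / (1 - kap1)).
  assert (HT1 : T0 < T1).
  { assert (h : 0 < T0 * kap1) by (apply Rmult_lt_0_compat; lra).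
    apply (Rlt_div_r T0 T0 (1 - kap1)); lra. }
  (* with this kappa the half period PI / (lam (1 - kappa)) is T / 2 *)
  set (kap := fun T => 1 - T0 / T).
  assert (Hkap : forall T, T0 < T < T1 -> 0 < kap T < kap1).
  { intros T [h1 h2]. unfold kap.
    assert (E : T0 / T * T = T0) by (field; lra).
    assert (E1 : T1 * (1 - kap1) = T0) by (unfold T1; field; lra).
    assert (0 < T0 / T) by (apply Rdiv_lt_0_compat; lra).
    split; apply Rnot_le_lt; intros Hle; nra. }
  assert (Htau : forall T, T0 < T < T1 -> PI / (lam * (1 - kap T)) = T / 2).
  { intros T HT. unfold kap. replace PI with (T0 * lam / 2) by lra. field. lra. }
  set (T2 := Rmax T1 S2).
  assert (HT12 : T1 <= T2) by apply Rmax_l.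
  assert (HS12 : S2 <= T2) by apply Rmax_r.
  destruct (functional_choice (fun T W =>
    (T0 < T < T1 -> bounded_solution W /\ (forall t i, W (t + T) i = W t i) /\
       near (K1 * sqrt (kap T)) (W 0) equil /\ ~ (forall i, W 0 i = W (T / 2) i)) /\
    (T2 < T -> bounded_solution W /\ (forall t i, W (t + 2 * T) i = W t i) /\
       near (K2 * ee (- T)) (W 0) (hom 0) /\ W 0 0%nat <> W (- T) 0%nat))) as [W HW].
  { intros T. destruct (Rle_dec T1 T) as [HT|HT].
    - destruct (Rlt_dec T2 T) as [HT'|HT'].
      + destruct (HH T ltac:(lra)) as [W HW]. exists W. split; [lra | auto].
      + exists (fun _ => equil). split; lra.
    - destruct (Rlt_dec T0 T) as [HT'|HT'].
      + destruct (HE (kap T) (Hkap T ltac:(lra))) as [W HW].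
        rewrite Htau in HW by lra. replace (2 * (T / 2)) with T in HW by field.
        exists W. split; [auto | lra].
      + exists (fun _ => equil). split; lra. }
  exists T1, T2. split; [exact HT1|]. split; [exact HT12|].
  exists (fun T t => W T t 0%nat), (fun T t => W T t 1%nat),
    (fun T t => W T t 2%nat), (fun T t => W T t 3%nat).
  split; [|split; [|split]].
  - intros T HT. destruct (HW T) as [HW1 HW2].
    assert (Q : bounded_solution (W T) /\ (forall t i, W T (t + 2 * T) i = W T t i) /\
      exists s t, ~ (forall i, W T s i = W T t i)).
    { destruct HT as [HT|HT].
      - destruct (HW1 HT) as [h1 [h2 [_ h3]]]. split; [auto|]. split.
        + intros t i. replace (t + 2 * T) with (t + T + T) by ring. rewrite !h2. reflexivity.
        + exists 0, (T / 2). exact h3.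
      - destruct (HW2 HT) as [h1 [h2 [_ h3]]]. split; [auto|]. split; [auto|].
        exists 0, (- T). intros h. apply h3, h. }
    destruct Q as [Hb [Hp [s [t Hst]]]]. split; [apply solution_of_bounded, Hb|]. split.
    + intros x. rewrite !Hp. auto.
    + intros Hc. apply Hst. intros i. destruct (Hc s t) as [c0 [c1 [c2 c3]]].
      destruct i as [|[|[|[|i]]]]; auto.
      destruct Hb as [_ [_ H4]]. rewrite !H4 by lia. reflexivity.
  - intros alpha beta Ha Hb.
    set (w := fun _ : R => quad 1 0 (1 / (2 * sqrt 2)) (1 / (2 * sqrt 2))).
    assert (E : forall t i, equil i = w t i).
    { intros t i. assert (h4 := lam4). unfold w, equil. rewrite sqrt2_lam.
      replace (1 / (2 * lam ^ 2)) with (lam ^ 2 / 4); [reflexivity|].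
      assert (lam ^ 2 <> 0) by (apply Rgt_not_eq, pow_lt; lra).
      apply (Rmult_eq_reg_r (lam ^ 2)); auto.
      replace (lam ^ 2 / 4 * lam ^ 2) with (lam ^ 4 / 4) by field. rewrite h4. field. lra. }
    apply (family_lim_of_initial_data (at_right T0) _ W w (fun T => K1 * sqrt (kap T))); auto.
    + apply (bounded_solution_ext (fun _ => equil)); [exact E | apply equil_bounded_solution].
    + exists (mkposreal (T1 - T0) ltac:(lra)). intros T Hball HT.
      unfold ball in Hball; simpl in Hball. unfold AbsRing_ball, abs, minus, plus, opp in Hball.
      simpl in Hball. apply Rabs_def2 in Hball.
      destruct (HW T) as [HW1 _]. destruct (HW1 ltac:(lra)) as [h1 [_ [h2 _]]].
      split; [exact h1|]. intros j. rewrite <- E. apply h2.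
    + intros eps Heps.
      assert (Hd : 0 < T0 * (eps / K1) ^ 2).
      { apply Rmult_lt_0_compat; [lra|]. apply pow_lt, Rdiv_lt_0_compat; lra. }
      exists (mkposreal _ Hd). intros T Hball HT.
      unfold ball in Hball; simpl in Hball. unfold AbsRing_ball, abs, minus, plus, opp in Hball.
      simpl in Hball. apply Rabs_def2 in Hball.
      assert (Hk : 0 <= kap T < (eps / K1) ^ 2).
      { unfold kap. assert (EE : T0 / T * T = T0) by (field; lra).
        assert (0 < T0 / T) by (apply Rdiv_lt_0_compat; lra).
        assert (0 < (eps / K1) ^ 2) by (apply pow_lt, Rdiv_lt_0_compat; lra).
        simpl in *. set (q := eps / K1 * (eps / K1 * 1)) in *.
        split; apply Rnot_lt_le || apply Rnot_le_lt; intros Hle; nra. }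
      assert (Hs : sqrt (kap T) < eps / K1).
      { rewrite <- (sqrt_pow2 (eps / K1)) by (apply Rlt_le, Rdiv_lt_0_compat; lra).
        apply sqrt_lt_1_alt. exact Hk. }
      apply (Rmult_lt_compat_l K1) in Hs; [|lra].
      replace (K1 * (eps / K1)) with eps in Hs by (field; lra). exact Hs.
  - exists 0. intros alpha beta Ha Hb.
    set (w := fun t : R => quad (u0 (t - 0)) (Derive u0 (t - 0)) (a0 (t - 0)) (b0 (t - 0))).
    assert (E : forall t i, hom t i = w t i).
    { intros t i. unfold w. rewrite Rminus_0_r. symmetry. apply profile_hom. }
    apply (family_lim_of_initial_data (Rbar_locally p_infty) _ W w (fun T => K2 * ee (- T))); auto.
    + apply (bounded_solution_ext hom); [exact E | apply hom_bounded_solution].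
    + exists T2. intros T HT. destruct (HW T) as [_ HW2].
      destruct (HW2 HT) as [h1 [_ [h2 _]]]. split; [exact h1|].
      intros j. rewrite <- E. apply h2.
    + intros eps Heps. exists (- 4 * ln (eps / K2)). intros T HT.
      assert (Hq : 0 < eps / K2) by (apply Rdiv_lt_0_compat; lra).
      assert (Hs : ee (- T) < eps / K2).
      { unfold ee. rewrite <- (exp_ln (eps / K2)) by exact Hq. apply exp_increasing. lra. }
      apply (Rmult_lt_compat_l K2) in Hs; [|lra].
      replace (K2 * (eps / K2)) with eps in Hs by (field; lra). exact Hs.
  - exact homoclinic_profile.
Qed.
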